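(* Let $1<p<\infty$, set $q=\max\bigl(p,\tfrac{p}{p-1}\bigr)$, and let $\delta\ge 0$. The following statement holds if and only if $\delta<\frac{1}{2q}$: There is a constant $C_p>0$, independent of $n$, such that for every integer $n\ge 0$ and every choice of points $z_{n0},\dots,z_{nn}$ on the unit circle satisfying $|\arg(z_{nj}\overline{\omega_{nj}})|\le \frac{2\pi\delta}{n+1}$ for $0\le j\le n$, one has \[ \frac{C_p^{-1}}{n+1}\sum_{j=0}^n |P(z_{nj})|^p \;\le\; \int_0^{2\pi}|P(e^{i\theta})|^p\,\frac{d\theta}{2\pi}\;\le\; \frac{C_p}{n+1}\sum_{j=0}^n |P(z_{nj})|^p \] for every holomorphic (complex) polynomial $P$ of degree at most $n$.
   Context: For $n\ge 0$ and $0\le j\le n$, $\omega_{nj}=e^{2\pi i j/(n+1)}$ denote the $(n+1)$th roots of unity. $\arg$ denotes the principal argument with values in $(-\pi,\pi]$. *)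

(* Defs.v *)
From Stdlib Require Import Reals Lra.
Open Scope R_scope.

Definition C : Type := (R * R)%type.
Definition Cadd (z w : C) : C := (fst z + fst w, snd z + snd w).
Definition Cmul (z w : C) : C :=
  (fst z * fst w - snd z * snd w, fst z * snd w + snd z * fst w).
Definition Cconj (z : C) : C := (fst z, - snd z).
Definition Cmod (z : C) : R := sqrt (fst z * fst z + snd z * snd z).
Fixpoint Cpow (z : C) (k : nat) : C :=
  match k with O => (1, 0) | S k' => Cmul z (Cpow z k') end.
Definition Cexp_i (theta : R) : C := (cos theta, sin theta).

Definition omega (n j : nat) : C := Cexp_i (2 * PI * INR j / INR (S n)).

(* principal argument in (-pi, pi] (the usual atan2; arg 0 := 0) *)
Definition arg (z : C) : R :=
  let x := fst z in let y := snd z in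
  if Rlt_dec 0 x then atan (y / x)
  else if Rlt_dec x 0 then
    (if Rle_dec 0 y then atan (y / x) + PI else atan (y / x) - PI)
  else
    if Rlt_dec 0 y then PI / 2
    else if Rlt_dec y 0 then - (PI / 2) else 0.

Fixpoint Peval (a : nat -> C) (n : nat) (z : C) : C :=
  match n with
  | O => Cmul (a O) (Cpow z O)
  | S m => Cadd (Peval a m z) (Cmul (a (S m)) (Cpow z (S m)))
  end.

(* x^p for x >= 0, p > 0 real, with 0^p = 0 *)
Definition rpow (x p : R) : R :=
  if Req_EM_T x 0 then 0 else Rpower x p.

Definition integral_is (f : R -> R) (a b I : R) : Prop :=
  exists pr : Riemann_integrable f a b, RiemannInt pr = I.

Definition MZ_property (p delta : R) : Prop :=
  exists Cp : R, 0 < Cp /\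
    forall (n : nat) (z : nat -> C),
      (forall j : nat, (j <= n)%nat ->
          Cmod (z j) = 1 /\
          Rabs (arg (Cmul (z j) (Cconj (omega n j)))) <= 2 * PI * delta / INR (S n)) ->
      forall (a : nat -> C) (I : R),
        integral_is (fun theta => rpow (Cmod (Peval a n (Cexp_i theta))) p) 0 (2 * PI) I ->
        let Ssum := sum_f_R0 (fun j => rpow (Cmod (Peval a n (z j))) p) n in
        / Cp / INR (S n) * Ssum <= I / (2 * PI) /\
        I / (2 * PI) <= Cp / INR (S n) * Ssum.

(* Main.v *)
(* Put N = n + 1, let E(w) be the product of the 1 - w conj(z_j), and fix the radius
   r = N / (N + c) with c large.  On |w| = r the argument of E stays within
   pi delta + O(1/c) of a constant, and |E| times the jump of P/E between w and
   1/conj(w) is a combination of the samples P(z_j) with kernel |E| times a Poisson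
   kernel; Lagrange interpolation of 1 and the near-constant phases of the coefficients
   bound the rows and columns of this kernel (Schur's test).  To recover P from the jump,
   let f = P(w), let h be the value at w of the reversed polynomial, and phi the deviation
   of arg E(w) from the constant.  If |2 phi| < pi/q then
     c (|f|^p + |h|^p) <= A |e^(-i phi) f - e^(i phi) conj h|^p - psi(f h)
   with psi subharmonic (a smoothed real part of a power), so that the mean of psi(f h)
   is bounded below by its value at the origin.  This gives the upper bound for the
   integral; the lower one is Poisson's formula with Jensen's inequality.

   For delta = 1/(2q) take B a polynomial close to (1 - r z)^(-1/p), A = B if p >= 2 and
   A = B (1 - r z) if p <= 2, nodes solving z^N = A / conj A, and P = B - r z^n conj B,
   resp. B + r z^n conj B.  The normalized sample sums of |P|^p stay bounded while the
   integral grows like log (1 / (1 - r)). *)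
Require Import Defs.
From Stdlib Require Import Reals Lra Lia Psatz Arith.
From Coquelicot Require Import Coquelicot.
Open Scope R_scope.

(** On the unit circle P/E has poles and arg E jumps by pi at every node; hence the circle |w| = r
    at distance c/(N + c), where E still resembles 1 - w^N with |w^N| at most 1/(1 + c). Returning
    to the unit circle costs factors depending only on c and p. Since E has degree n + 1, one more
    than P, the reversed polynomial comes with an extra factor w, so f h vanishes at the origin. As
    f h is holomorphic, subharmonicity takes the place of a bound for the conjugate function. The
    difference can cancel only where arg(f h) is near 2 phi, so psi has to be negative in a sector
    about the positive axis: -Re (f h)^(p/2) allows half-opening pi/p, Re (-f h)^(p/2) allows pi -
    pi/p, and these are pi/q for p >= 2 and p <= 2 respectively. With phi up to pi delta, this is
    delta < 1/(2q). The same angle limits the counterexample: |arg(1 - r z)| stays below pi/2, so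
    |arg A| stays below pi/(2q), and a node moves by 2 arg A / N. There n tends to infinity at fixed
    r, which decouples B from z^n conj B, and only then r tends to 1. *)

(** * The unit circle and polar form *)

Definition cis (t : R) : C := (cos t, sin t).

Lemma C_eq (z w : C) : fst z = fst w -> snd z = snd w -> z = w.
Proof. destruct z, w; simpl; intros -> ->; reflexivity. Qed.

Lemma cis_0 : cis 0 = 1%C.
Proof. apply C_eq; simpl; [apply cos_0 | apply sin_0]. Qed.

Lemma cis_add (a b : R) : cis (a + b) = (cis a * cis b)%C.
Proof. apply C_eq; simpl; [rewrite cos_plus | rewrite sin_plus]; ring. Qed.

Lemma cis_conj (a : R) : Cconj (cis a) = cis (- a).
Proof. apply C_eq; simpl; [now rewrite cos_neg | now rewrite sin_neg]. Qed.

Lemma cis_mod (a : R) : Cmod (cis a) = 1.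
Proof.
  unfold Cmod, cis; simpl. transitivity (sqrt 1); [f_equal | apply sqrt_1].
  generalize (sin2_cos2 a); unfold Rsqr; intro H; nra.
Qed.

Lemma cis_inv_l (a : R) : (cis (- a) * cis a)%C = 1%C.
Proof. rewrite <- cis_add. replace (- a + a) with 0 by ring. apply cis_0. Qed.

Lemma cis_neq_0 (a : R) : cis a <> 0%C.
Proof. apply Cmod_gt_0. rewrite cis_mod. lra. Qed.

Lemma cis_pow (a : R) (n : nat) : (cis a ^ n)%C = cis (INR n * a).
Proof.
  induction n as [|n IH].
  - simpl. rewrite Rmult_0_l, cis_0. reflexivity.
  - rewrite Cpow_S, IH, <- cis_add. f_equal. rewrite S_INR. ring.
Qed.

Lemma cis_period (a : R) (k : nat) : cis (a + 2 * INR k * PI) = cis a.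
Proof. apply C_eq; simpl; [apply cos_period | apply sin_period]. Qed.

Lemma cis_polar (z : C) : exists t, z = (RtoC (Cmod z) * cis t)%C.
Proof.
  destruct (Req_dec (Cmod z) 0) as [H0|H0].
  - exists 0. rewrite H0. rewrite (Cmod_eq_0 _ H0). ring.
  - assert (Hp : 0 < Cmod z) by (generalize (Cmod_ge_0 z); lra).
    assert (Hs : (fst z / Cmod z)² + (snd z / Cmod z)² = 1).
    { generalize (Cmod2_alt z). unfold Re, Im. intro H.
      unfold Rsqr. replace (fst z / Cmod z * (fst z / Cmod z) + snd z / Cmod z * (snd z / Cmod z))
        with ((fst z ^ 2 + snd z ^ 2) / Cmod z ^ 2) by (field; lra).
      rewrite <- H. field. lra. }
    assert (Hb : -1 <= fst z / Cmod z <= 1).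
    { unfold Rsqr in Hs. nra. }
    destruct (Rle_dec 0 (snd z)) as [Hy|Hy].
    + exists (acos (fst z / Cmod z)).
      apply C_eq; simpl.
      * rewrite cos_acos by exact Hb. field; lra.
      * rewrite sin_acos by exact Hb.
        replace (1 - (fst z / Cmod z)²) with ((snd z / Cmod z)²) by lra.
        rewrite sqrt_Rsqr. field; lra.
        apply Rmult_le_pos; [lra|]. left; now apply Rinv_0_lt_compat.
    + exists (- acos (fst z / Cmod z)).
      apply C_eq; simpl.
      * rewrite cos_neg, cos_acos by exact Hb. field; lra.
      * rewrite sin_neg, sin_acos by exact Hb.
        replace (1 - (fst z / Cmod z)²) with ((- (snd z / Cmod z))²)
          by (rewrite <- Rsqr_neg; lra).
        rewrite sqrt_Rsqr. field; lra.
        replace (- (snd z / Cmod z)) with ((- snd z) * / Cmod z) by (field; lra).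
        apply Rmult_le_pos; [lra|]. left; now apply Rinv_0_lt_compat.
Qed.

Lemma Cmod_sqr (z : C) : Cmod z * Cmod z = fst z * fst z + snd z * snd z.
Proof. generalize (Cmod2_alt z). unfold Re, Im. intro H. nra. Qed.

(** * Polynomial functions *)

(* Horner form: [poly_le n F] says that [F] is a polynomial function of degree at most [n]. *)
Fixpoint poly_le (n : nat) (F : C -> C) : Prop :=
  match n with
  | O => exists c : C, forall w, F w = c
  | S m => exists (c : C) (G : C -> C), poly_le m G /\ forall w, F w = (c + w * G w)%C
  end.

Lemma poly_le_ext (n : nat) (F G : C -> C) : (forall w, F w = G w) -> poly_le n F -> poly_le n G.
Proof.
  destruct n; simpl.
  - intros H [c Hc]. exists c. intro w. rewrite <- H. apply Hc.
  - intros H (c & K & HK & Hc). exists c, K. split; [exact HK|].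
    intro w. rewrite <- H. apply Hc.
Qed.

Lemma poly_le_zero (n : nat) : poly_le n (fun _ => 0%C).
Proof.
  induction n; simpl.
  - exists 0%C. reflexivity.
  - exists 0%C, (fun _ => 0%C). split; [exact IHn|]. intro; ring.
Qed.

Lemma poly_le_const (n : nat) (c : C) : poly_le n (fun _ => c).
Proof.
  destruct n; simpl.
  - exists c. reflexivity.
  - exists c, (fun _ => 0%C). split; [apply poly_le_zero|]. intro; ring.
Qed.

Lemma poly_le_add (n : nat) : forall F G, poly_le n F -> poly_le n G -> poly_le n (fun w => F w + G w)%C.
Proof.
  induction n as [|n IH]; simpl; intros F G.
  - intros [c Hc] [d Hd]. exists (c + d)%C. intro w. now rewrite Hc, Hd.
  - intros (c & F1 & HF & Hc) (d & G1 & HG & Hd).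
    exists (c + d)%C, (fun w => F1 w + G1 w)%C. split; [now apply IH|].
    intro w. rewrite Hc, Hd. ring.
Qed.

Lemma poly_le_scal (n : nat) (a : C) : forall F, poly_le n F -> poly_le n (fun w => a * F w)%C.
Proof.
  induction n as [|n IH]; simpl; intros F.
  - intros [c Hc]. exists (a * c)%C. intro w. now rewrite Hc.
  - intros (c & F1 & HF & Hc).
    exists (a * c)%C, (fun w => a * F1 w)%C. split; [now apply IH|].
    intro w. rewrite Hc. ring.
Qed.

Lemma poly_le_mulX (n : nat) (F : C -> C) : poly_le n F -> poly_le (S n) (fun w => w * F w)%C.
Proof. intro H. exists 0%C, F. split; [exact H|]. intro; ring. Qed.

Lemma poly_le_S (n : nat) : forall F, poly_le n F -> poly_le (S n) F.
Proof.
  induction n as [|n IH]; intros F.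
  - intros [c Hc]. exists c, (fun _ => 0%C). split; [apply poly_le_zero|].
    intro w; rewrite Hc; ring.
  - intros (c & F1 & HF & Hc). exists c, F1. split; [now apply IH|exact Hc].
Qed.

Lemma poly_le_le (n m : nat) (F : C -> C) : (n <= m)%nat -> poly_le n F -> poly_le m F.
Proof. induction 1; [tauto|]. intro; now apply poly_le_S, IHle. Qed.

Lemma poly_le_mul (n m : nat) : forall F G, poly_le n F -> poly_le m G -> poly_le (n + m) (fun w => F w * G w)%C.
Proof.
  induction n as [|n IH]; intros F G HF HG.
  - destruct HF as [c Hc]. apply (poly_le_ext _ (fun w => c * G w)%C).
    { intro w; now rewrite Hc. } { now apply poly_le_scal. }
  - destruct HF as (c & F1 & HF & Hc).
    apply (poly_le_ext _ (fun w => c * G w + w * (F1 w * G w))%C).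
    { intro w. rewrite Hc. ring. }
    apply poly_le_add.
    + apply poly_le_scal. apply (poly_le_le m); [lia|exact HG].
    + apply (poly_le_mulX (n + m)). now apply IH.
Qed.

Lemma poly_le_pow (n k : nat) (F : C -> C) : poly_le n F -> poly_le (k * n) (fun w => F w ^ k)%C.
Proof.
  intro H. induction k as [|k IH].
  - apply (poly_le_ext _ (fun _ => 1%C)). reflexivity. apply poly_le_const.
  - apply (poly_le_ext _ (fun w => F w * F w ^ k)%C). reflexivity. now apply (poly_le_mul n).
Qed.

Lemma poly_le_X : poly_le 1 (fun w => w).
Proof. exists 0%C, (fun _ => 1%C). split; [apply poly_le_const|]. intro; ring. Qed.

Lemma poly_le_Xn (k : nat) : poly_le k (fun w => w ^ k)%C.
Proof. replace k with (k * 1)%nat at 1 by lia. apply poly_le_pow, poly_le_X. Qed.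


Lemma poly_le_Peval (a : nat -> C) (n : nat) : poly_le n (Peval a n).
Proof.
  assert (Hp : forall z k, Defs.Cpow z k = (z ^ k)%C) by (induction k as [|k IHk]; [reflexivity | simpl; rewrite IHk; reflexivity]).
  induction n as [|n IH].
  - exists (a O). intro w. simpl. change (Cmult (a O) (RtoC 1) = a O). ring.
  - apply (poly_le_ext _ (fun w => Peval a n w + a (S n) * w ^ (S n))%C).
    + intro w. rewrite <- Hp. reflexivity.
    + apply poly_le_add. now apply poly_le_S. apply poly_le_scal, poly_le_Xn.
Qed.

(** [Peval] adds the top coefficient at each step while [poly_le] peels off the constant one;
    splitting off the lowest coefficient connects the two recursions. *)
Lemma Peval_S_low (a : nat -> C) (n : nat) (w : C) :
  Peval a (S n) w = (a O + w * Peval (fun k => a (S k)) n w)%C.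
Proof.
  revert a. induction n as [|n IH]; intro a.
  - simpl. unfold Cadd, Cmul. apply C_eq; simpl; ring.
  - change (Peval a (S (S n)) w) with (Peval a (S n) w + a (S (S n)) * Defs.Cpow w (S (S n)))%C.
    rewrite IH.
    change (Peval (fun k : nat => a (S k)) (S n) w) with
      (Peval (fun k => a (S k)) n w + a (S (S n)) * Defs.Cpow w (S n))%C.
    change (Defs.Cpow w (S (S n))) with (w * Defs.Cpow w (S n))%C.
    match goal with |- ?x = ?y => change (@eq C x y) end. ring.
Qed.

Lemma Peval_of_pd (n : nat) : forall F, poly_le n F -> exists a, forall w, F w = Peval a n w.
Proof.
  induction n as [|n IH]; intros F.
  - intros [c Hc]. exists (fun _ => c). intro w. rewrite Hc. simpl.
    change (c = Cmult c (RtoC 1)). ring.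
  - intros (c & G & HG & Hc). destruct (IH G HG) as [a Ha].
    exists (fun k => match k with O => c | S k' => a k' end).
    intro w. rewrite Peval_S_low, Hc, Ha. reflexivity.
Qed.

Lemma poly_le_factor (n : nat) (z0 : C) : forall F, poly_le (S n) F ->
  exists G, poly_le n G /\ forall w, F w = (F z0 + (w - z0) * G w)%C.
Proof.
  induction n as [|n IH]; intros F (c & G & HG & Hc).
  - exists G. split; [exact HG|]. destruct HG as [d Hd].
    intro w. rewrite !Hc, !Hd. ring.
  - destruct (IH G HG) as (K & HK & HKe).
    exists (fun w => G z0 + w * K w)%C. split.
    + exists (G z0), K. split; [exact HK|reflexivity].
    + intro w. rewrite !Hc, (HKe w). ring.
Qed.

Lemma poly_le_roots (n : nat) : forall (F : C -> C) (z : nat -> C), poly_le n F ->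
  (forall i j, (i <= n)%nat -> (j <= n)%nat -> i <> j -> z i <> z j) ->
  (forall i, (i <= n)%nat -> F (z i) = 0%C) -> forall w, F w = 0%C.
Proof.
  induction n as [|n IH]; intros F z HF Hd Hz w.
  - destruct HF as [c Hc]. rewrite Hc. rewrite <- (Hc (z O)). now apply Hz.
  - destruct (poly_le_factor n (z (S n)) F HF) as (G & HG & HGe).
    rewrite HGe, (Hz (S n)) by lia. rewrite (IH G z HG).
    + ring.
    + intros i j Hi Hj. apply Hd; lia.
    + intros i Hi. generalize (HGe (z i)). rewrite (Hz i), (Hz (S n)) by lia.
      intro H. assert (Hn : (z i - z (S n))%C <> 0%C).
      { intro H1. apply (Hd i (S n)); try lia.
        replace (z i) with ((z i - z (S n)) + z (S n))%C by ring. rewrite H1. ring. }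
      destruct (Ceq_dec (G (z i)) 0) as [H0|H0]; [exact H0|].
      exfalso. apply (Cmult_neq_0 _ _ Hn H0).
      replace ((z i - z (S n)) * G (z i))%C with (0 + (z i - z (S n)) * G (z i))%C by ring.
      now rewrite <- H.
Qed.

(** The reversed polynomial carries the values of [F] outside the unit disc to values of a
    polynomial inside it, so that the points w and 1/conj w can be treated by means over one
    circle. *)
Lemma poly_le_reverse (n : nat) : forall F, poly_le n F ->
  exists F', poly_le n F' /\ forall w : C, w <> 0%C -> F' w = (w ^ n * Cconj (F (/ Cconj w)))%C.
Proof.
  induction n as [|n IH]; intros F.
  - intros [c Hc]. exists (fun _ => Cconj c). split; [apply poly_le_const|].
    intros w Hw. rewrite Hc. simpl. ring.
  - intros (c & G & HG & Hc). destruct (IH G HG) as (G' & HG' & He).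
    exists (fun w => Cconj c * w ^ S n + G' w)%C. split.
    + apply poly_le_add. apply poly_le_scal, poly_le_Xn. now apply poly_le_S.
    + intros w Hw. rewrite He by exact Hw. rewrite Hc.
      assert (Hcw : Cconj w <> 0%C).
      { intro H. apply Hw. apply (f_equal Cconj) in H. rewrite Cconj_conj in H.
        rewrite H. apply C_eq; simpl; ring. }
      rewrite Cplus_conj, Cmult_conj, Cinv_conj, Cconj_conj by exact Hcw.
      rewrite Cpow_S. field. exact Hw.
Qed.

(** * Circular means of subharmonic functions of polynomials *)

Definition continuous2 (f : R -> R -> R) : Prop := forall x y, continuity_2d_pt f x y.

Lemma c2_plus f g : continuous2 f -> continuous2 g -> continuous2 (fun x y => f x y + g x y).
Proof. intros Hf Hg x y. now apply continuity_2d_pt_plus. Qed.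
Lemma c2_minus f g : continuous2 f -> continuous2 g -> continuous2 (fun x y => f x y - g x y).
Proof. intros Hf Hg x y. now apply continuity_2d_pt_minus. Qed.
Lemma c2_opp f : continuous2 f -> continuous2 (fun x y => - f x y).
Proof. intros Hf x y. now apply continuity_2d_pt_opp. Qed.
Lemma c2_mult f g : continuous2 f -> continuous2 g -> continuous2 (fun x y => f x y * g x y).
Proof. intros Hf Hg x y. now apply continuity_2d_pt_mult. Qed.
Lemma c2_inv f : continuous2 f -> (forall x y, f x y <> 0) -> continuous2 (fun x y => / f x y).
Proof. intros Hf H x y. now apply continuity_2d_pt_inv. Qed.
Lemma c2_const c : continuous2 (fun _ _ => c).
Proof. intros x y. apply continuity_2d_pt_const. Qed.
Lemma c2_fst : continuous2 (fun x _ => x).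
Proof. intros x y. apply continuity_2d_pt_id1. Qed.
Lemma c2_snd : continuous2 (fun _ y => y).
Proof. intros x y. apply continuity_2d_pt_id2. Qed.
Lemma c2_comp1 (h : R -> R) f :
  (forall x y, continuity_pt h (f x y)) -> continuous2 f -> continuous2 (fun x y => h (f x y)).
Proof. intros Hh Hf x y. now apply continuity_1d_2d_pt_comp. Qed.
Lemma c2_ext f g : (forall x y, f x y = g x y) -> continuous2 f -> continuous2 g.
Proof. intros H Hf x y. apply continuity_2d_pt_ext with (2 := Hf x y). exact H. Qed.

Lemma c2_comp p f g : continuous2 p -> continuous2 f -> continuous2 g -> continuous2 (fun x y => p (f x y) (g x y)).
Proof.
  intros Hp Hf Hg x y eps.
  destruct (Hp (f x y) (g x y) eps) as [d Hd].
  destruct (Hf x y d) as [d1 H1]. destruct (Hg x y d) as [d2 H2].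
  assert (Hm : 0 < Rmin d1 d2) by (apply Rmin_pos; apply cond_pos).
  exists (mkposreal _ Hm). simpl. intros u v Hu Hv.
  apply Hd; [apply H1 | apply H2]; eapply Rlt_le_trans; eauto;
    (apply Rmin_l || apply Rmin_r).
Qed.

Lemma c2_cont_snd f x y : continuous2 f -> continuous (fun t => f x t) y.
Proof.
  intros Hf. apply continuity_pt_filterlim. intros eps He.
  destruct (Hf x y (mkposreal eps He)) as [d Hd].
  exists d. split; [apply cond_pos|]. intros t [_ Ht]. apply Hd.
  - rewrite Rminus_eq_0, Rabs_R0. apply cond_pos.
  - exact Ht.
Qed.

Lemma c2_ex_RInt f x a b : continuous2 f -> ex_RInt (fun t => f x t) a b.
Proof. intro H. apply @ex_RInt_continuous. intros; now apply c2_cont_snd. Qed.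

Lemma MVT_is_derive (f f' : R -> R) (a b : R) : a < b ->
  (forall x, is_derive f x (f' x)) -> exists c, a <= c <= b /\ f b - f a = f' c * (b - a).
Proof.
  intros Hab Hf. destruct (MVT_gen f a b f') as (c & Hc & E).
  - intros; apply Hf.
  - intros x _. apply continuity_pt_filterlim.
    apply (@ex_derive_continuous R_AbsRing R_NormedModule). exists (f' x). apply Hf.
  - rewrite Rmin_left, Rmax_right in Hc by lra. exists c. split; [exact Hc|exact E].
Qed.

(* In log-polar coordinates circular means are convex functions of the radial
   variable, and a convex function bounded near minus infinity is nondecreasing. *)
Lemma mean_mono (u ur urr ut utt : R -> R -> R) :
  (forall r t, is_derive (fun x => u x t) r (ur r t)) ->
  (forall r t, is_derive (fun x => ur x t) r (urr r t)) ->
  (forall r t, is_derive (fun x => ut r x) t (utt r t)) ->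
  continuous2 u -> continuous2 ur -> continuous2 urr -> continuous2 utt ->
  (forall r, ut r (2 * PI) = ut r 0) ->
  (forall r t, 0 <= urr r t + utt r t) ->
  (forall r0, exists B, forall r t, r <= r0 -> Rabs (u r t) <= B) ->
  forall r1 r2, r1 <= r2 ->
  RInt (fun t => u r1 t) 0 (2 * PI) <= RInt (fun t => u r2 t) 0 (2 * PI).
Proof.
  intros Du Dur Dut Cu Cur Curr Cutt Hper Hlap Hbd r1 r2 H12.
  assert (HPI := PI_RGT_0).
  set (M := fun r => RInt (fun t => u r t) 0 (2 * PI)).
  set (J := fun r => RInt (fun t => ur r t) 0 (2 * PI)).
  set (J' := fun r => RInt (fun t => urr r t) 0 (2 * PI)).
  (* Differentiation under the integral sign, used twice: [J] is the derivative of the mean [M], and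
     [J'] that of [J]. *)
  assert (param : forall f g : R -> R -> R,
    (forall r t, is_derive (fun x => f x t) r (g r t)) -> continuous2 f -> continuous2 g ->
    forall r, is_derive (fun r => RInt (fun t => f r t) 0 (2 * PI)) r
                        (RInt (fun t => g r t) 0 (2 * PI))).
  { intros f g Df Cf Cg r.
    assert (E : forall r t, Derive (fun z => f z t) r = g r t).
    { intros; now apply is_derive_unique. }
    replace (RInt (fun t => g r t) 0 (2 * PI))
      with (RInt (fun t => Derive (fun z => f z t) r) 0 (2 * PI)).
    2:{ apply RInt_ext. intros; apply E. }
    apply (is_derive_RInt_param f).
    - apply filter_forall. intros x t _. exists (g x t). apply Df.
    - intros t _. apply continuity_2d_pt_ext with (f := g); [|apply Cg].
      intros; now rewrite E.
    - apply filter_forall. intro y. now apply c2_ex_RInt. }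
  assert (DM : forall r, is_derive M r (J r)) by (apply param; assumption).
  assert (DJ : forall r, is_derive J r (J' r)) by (apply param; assumption).
  (* Convexity of the mean: the angular part of the Laplacian integrates to zero over a period, so
     [J'] is the integral of the whole Laplacian. *)
  assert (HJ' : forall r, 0 <= J' r).
  { intro r.
    assert (Hz : is_RInt (fun t => utt r t) 0 (2 * PI) 0).
    { replace 0 with (minus (ut r (2 * PI)) (ut r 0)) at 2.
      apply (is_RInt_derive (fun t => ut r t)).
      intros; apply Dut. intros; now apply c2_cont_snd.
      rewrite Hper. unfold minus, plus, opp; simpl. ring. }
    assert (Hz' : RInt (fun t => utt r t) 0 (2 * PI) = 0) by (apply is_RInt_unique; exact Hz).
    unfold J'.
    apply Rle_trans with (plus (RInt (fun t => urr r t) 0 (2 * PI)) (RInt (fun t => utt r t) 0 (2 * PI))).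
    2:{ rewrite Hz'. right. apply Rplus_0_r. }
    rewrite <- (@RInt_plus R_CompleteNormedModule) by now apply c2_ex_RInt.
    apply RInt_ge_0. lra.
    apply (c2_ex_RInt (fun r t => urr r t + utt r t)). now apply c2_plus.
    intros t _. apply Hlap. }
  destruct (Rle_lt_or_eq_dec _ _ H12) as [Hlt|<-]; [|apply Rle_refl].
  fold (M r1) (M r2).
  (* A drop between [r1] and [r2] gives a point of negative slope; by convexity the slope is no
     larger anywhere to its left, so the mean grows at least linearly towards minus infinity,
     against its boundedness. *)
  destruct (Rle_dec (M r1) (M r2)) as [H|H]; [exact H|exfalso].
  destruct (MVT_is_derive M J r1 r2 Hlt DM) as (xi & Hxi & Exi).
  assert (HJ : J xi < 0) by nra.
  destruct (Hbd xi) as [B HB].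
  assert (HB0 : 0 <= B).
  { eapply Rle_trans; [apply Rabs_pos|]. apply (HB xi 0). lra. }
  assert (MB : forall r, r <= xi -> Rabs (M r) <= B * (2 * PI)).
  { intros r Hr. replace (B * (2 * PI)) with ((2 * PI - 0) * B) by ring.
    apply (abs_RInt_le_const (fun t => u r t)). lra. now apply c2_ex_RInt.
    intros t _. now apply HB. }
  (* Far enough to the left for the mean to differ from [M xi] by more than twice its bound 2 pi
     B. *)
  set (rr := xi - (2 * (B * (2 * PI)) + 1) / (- J xi)).
  assert (Hpos : 0 < (2 * (B * (2 * PI)) + 1) / (- J xi)).
  { apply Rdiv_lt_0_compat; nra. }
  assert (Hrr : rr < xi) by (unfold rr; lra).
  destruct (MVT_is_derive M J rr xi Hrr DM) as (eta & Heta & Eeta).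
  assert (Jle : J eta <= J xi).
  { destruct (Rle_lt_or_eq_dec eta xi (proj2 Heta)) as [Hl| ->]; [|apply Rle_refl].
    destruct (MVT_is_derive J J' eta xi Hl DJ) as (zeta & _ & Ez).
    generalize (HJ' zeta). nra. }
  assert (Hbig : M xi - M rr <= - (2 * (B * (2 * PI)) + 1)).
  { rewrite Eeta.
    assert (Hq : J xi * (xi - rr) = - (2 * (B * (2 * PI)) + 1)).
    { unfold rr. field. lra. }
    rewrite <- Hq. apply Rmult_le_compat_r; lra. }
  generalize (MB xi (Rle_refl _)) (MB rr (Rlt_le _ _ Hrr)).
  intros A1 A2. apply Rabs_le_between in A1. apply Rabs_le_between in A2. lra.
Qed.

(** The point exp(r + i t). In these coordinates the Laplacian is u_rr + u_tt up to a positive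
    factor, and the origin lies at r = - infinity. *)
Definition logpolar (r t : R) : C := (exp r * cos t, exp r * sin t).

Lemma zp_eq r t : logpolar r t = (RtoC (exp r) * cis t)%C.
Proof. apply C_eq; simpl; ring. Qed.

Lemma zp_mod r t : Cmod (logpolar r t) = exp r.
Proof.
  rewrite zp_eq, Cmod_mult, cis_mod, Cmod_R, Rmult_1_r.
  apply Rabs_pos_eq. left; apply exp_pos.
Qed.

Lemma zp_period r : logpolar r (2 * PI) = logpolar r 0.
Proof. unfold logpolar. now rewrite cos_2PI, sin_2PI, cos_0, sin_0. Qed.

Lemma Derive_eta {f : R -> R} {x l : R} : is_derive f x l -> Derive (fun t : R => f t) x = l.
Proof. exact (is_derive_unique f x l). Qed.

Lemma der_cst (f : R -> R) (c x : R) : (forall t, f t = c) -> is_derive f x 0.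
Proof.
  intro H. apply (is_derive_ext (fun _ : R => c)). intro t; now rewrite H.
  apply (is_derive_const c x).
Qed.

(** One rule for both parts of c + w G(w): s = -1 gives the real part, s = 1 the imaginary part.
    With e = 0 and s = 1 it also differentiates the sums produced by the chain rule. *)
Lemma der_lin (f g a b : R -> R) (x f' g' a' b' e s : R) :
  is_derive f x f' -> is_derive g x g' -> is_derive a x a' -> is_derive b x b' ->
  is_derive (fun t => e + (a t * f t + s * (b t * g t))) x
    (a' * f x + a x * f' + s * (b' * g x + b x * g')).
Proof.
  intros Hf Hg Ha Hb. auto_derive.
  - repeat split; eexists; eassumption.
  - rewrite (Derive_eta Hf), (Derive_eta Hg), (Derive_eta Ha), (Derive_eta Hb). ring.
Qed.

(* [F'] is z dF/dz, which is the radial derivative in log-polar coordinates. *)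
Lemma poly_le_deriv (n : nat) : forall F, poly_le n F -> exists F', poly_le n F' /\ forall r t,
  is_derive (fun x => fst (F (logpolar x t))) r (fst (F' (logpolar r t))) /\
  is_derive (fun x => snd (F (logpolar x t))) r (snd (F' (logpolar r t))) /\
  is_derive (fun x => fst (F (logpolar r x))) t (- snd (F' (logpolar r t))) /\
  is_derive (fun x => snd (F (logpolar r x))) t (fst (F' (logpolar r t))).
Proof.
  induction n as [|n IH]; intros F.
  - intros [c Hc]. exists (fun _ => 0%C). split; [apply poly_le_zero|].
    intros r t; (split; [|split; [|split]]).
    + apply (der_cst _ (fst c)). intro; now rewrite Hc.
    + apply (der_cst _ (snd c)). intro; now rewrite Hc.
    + simpl. rewrite Ropp_0. apply (der_cst _ (fst c)). intro; now rewrite Hc.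
    + apply (der_cst _ (snd c)). intro; now rewrite Hc.
  - intros (c & G & HG & Hc). destruct (IH G HG) as (G' & HG' & HD).
    exists (fun w => w * (G w + G' w))%C. split.
    { apply poly_le_mulX. now apply poly_le_add. }
    intros r t. destruct (HD r t) as (D1 & D2 & D3 & D4).
    assert (Ecr : is_derive (fun x => exp x * cos t) r (exp r * cos t)) by (auto_derive; [easy|ring]).
    assert (Esr : is_derive (fun x => exp x * sin t) r (exp r * sin t)) by (auto_derive; [easy|ring]).
    assert (Ect : is_derive (fun x => exp r * cos x) t (- (exp r * sin t))) by (auto_derive; [easy|ring]).
    assert (Est : is_derive (fun x => exp r * sin x) t (exp r * cos t)) by (auto_derive; [easy|ring]).
    split; [|split; [|split]].
    + eapply is_derive_ext; [|evar_last; [exact (der_lin _ _ _ _ _ _ _ _ _ (fst c) (-1) D1 D2 Ecr Esr)|]].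
      * intro x. rewrite Hc. simpl. ring.
      * simpl. ring.
    + eapply is_derive_ext; [|evar_last; [exact (der_lin _ _ _ _ _ _ _ _ _ (snd c) 1 D2 D1 Ecr Esr)|]].
      * intro x. rewrite Hc. simpl. ring.
      * simpl. ring.
    + eapply is_derive_ext; [|evar_last; [exact (der_lin _ _ _ _ _ _ _ _ _ (fst c) (-1) D3 D4 Ect Est)|]].
      * intro x. rewrite Hc. simpl. ring.
      * simpl. ring.
    + eapply is_derive_ext; [|evar_last; [exact (der_lin _ _ _ _ _ _ _ _ _ (snd c) 1 D4 D3 Ect Est)|]].
      * intro x. rewrite Hc. simpl. ring.
      * simpl. ring.
Qed.

Lemma poly_le_c2 (n : nat) : forall F, poly_le n F ->
  continuous2 (fun r t => fst (F (logpolar r t))) /\ continuous2 (fun r t => snd (F (logpolar r t))).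
Proof.
  assert (Hx : continuous2 (fun r t => exp r * cos t)).
  { apply c2_mult; (apply c2_comp1; [|apply c2_fst || apply c2_snd]); intros;
    apply derivable_continuous_pt; [apply derivable_pt_exp | apply derivable_pt_cos]. }
  assert (Hy : continuous2 (fun r t => exp r * sin t)).
  { apply c2_mult; (apply c2_comp1; [|apply c2_fst || apply c2_snd]); intros;
    apply derivable_continuous_pt; [apply derivable_pt_exp | apply derivable_pt_sin]. }
  induction n as [|n IH]; intros F.
  - intros [c Hc]. split; eapply c2_ext; try apply c2_const; intros; now rewrite Hc.
  - intros (c & G & HG & Hc). destruct (IH G HG) as [C1 C2]. split.
    + apply (c2_ext (fun r t => fst c + (exp r * cos t * fst (G (logpolar r t)) - exp r * sin t * snd (G (logpolar r t))))).
      intros; rewrite Hc; reflexivity.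
      apply c2_plus; [apply c2_const|]. apply c2_minus; now apply c2_mult.
    + apply (c2_ext (fun r t => snd c + (exp r * cos t * snd (G (logpolar r t)) + exp r * sin t * fst (G (logpolar r t))))).
      intros; rewrite Hc; reflexivity.
      apply c2_plus; [apply c2_const|]. apply c2_plus; now apply c2_mult.
Qed.

Lemma poly_le_bounded (n : nat) : forall F, poly_le n F ->
  forall R0, 0 <= R0 -> exists B, 0 <= B /\ forall w, Cmod w <= R0 -> Cmod (F w) <= B.
Proof.
  induction n as [|n IH]; intros F.
  - intros [c Hc] R0 H0. exists (Cmod c). split; [apply Cmod_ge_0|]. intros; rewrite Hc. lra.
  - intros (c & G & HG & Hc) R0 H0. destruct (IH G HG R0 H0) as (B & HB0 & HB).
    exists (Cmod c + R0 * B). split.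
    { generalize (Cmod_ge_0 c). nra. }
    intros w Hw. rewrite Hc. eapply Rle_trans; [apply Cmod_triangle|].
    rewrite Cmod_mult. specialize (HB w Hw). generalize (Cmod_ge_0 w) (Cmod_ge_0 (G w)). nra.
Qed.

(** Differentiability in two variables, encoded as the chain rule along every differentiable curve,
    the form in which partial derivatives are used here. *)
Definition path_derive (p px py : R -> R -> R) : Prop :=
  forall (x y : R -> R) (t x' y' : R), is_derive x t x' -> is_derive y t y' ->
  is_derive (fun t => p (x t) (y t)) t (px (x t) (y t) * x' + py (x t) (y t) * y').

(** Twice continuously differentiable with nonnegative Laplacian; [pxy] serves both mixed
    derivatives. The last clause, boundedness on squares, provides the bound near the origin
    required by [mean_mono]. *)
Definition subharmonic (p : R -> R -> R) : Prop :=
  exists px py pxx pxy pyy,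
  path_derive p px py /\ path_derive px pxx pxy /\ path_derive py pxy pyy /\
  continuous2 p /\ (continuous2 px /\ continuous2 py) /\ (continuous2 pxx /\ continuous2 pxy /\ continuous2 pyy) /\
  (forall x y, 0 <= pxx x y + pyy x y) /\
  (forall M, exists B, forall x y, Rabs x <= M -> Rabs y <= M -> Rabs (p x y) <= B).

Lemma subharmonic_mean_mono (p : R -> R -> R) (n : nat) (F : C -> C) :
  subharmonic p -> poly_le n F -> forall r1 r2, r1 <= r2 ->
  RInt (fun t => p (fst (F (logpolar r1 t))) (snd (F (logpolar r1 t)))) 0 (2 * PI) <=
  RInt (fun t => p (fst (F (logpolar r2 t))) (snd (F (logpolar r2 t)))) 0 (2 * PI).
Proof.
  intros (px & py & pxx & pxy & pyy & D0 & D1 & D2 & C0 & [Cx Cy] & (Cxx & Cxy & Cyy) & Hl & Hb) HF.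
  destruct (poly_le_deriv n F HF) as (F1 & HF1 & E1).
  destruct (poly_le_deriv n F1 HF1) as (F2 & HF2 & E2).
  destruct (poly_le_c2 n F HF) as [KX KY]. destruct (poly_le_c2 n F1 HF1) as [KX1 KY1].
  destruct (poly_le_c2 n F2 HF2) as [KX2 KY2].
  set (X := fun r t => fst (F (logpolar r t))). set (Y := fun r t => snd (F (logpolar r t))).
  set (X1 := fun r t => fst (F1 (logpolar r t))). set (Y1 := fun r t => snd (F1 (logpolar r t))).
  set (X2 := fun r t => fst (F2 (logpolar r t))). set (Y2 := fun r t => snd (F2 (logpolar r t))).
  fold X in KX. fold Y in KY. fold X1 in KX1. fold Y1 in KY1. fold X2 in KX2. fold Y2 in KY2.
  assert (dX : forall r t, is_derive (fun x => X x t) r (X1 r t)) by (intros; apply E1).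
  assert (dY : forall r t, is_derive (fun x => Y x t) r (Y1 r t)) by (intros; apply E1).
  assert (dXt : forall r t, is_derive (fun x => X r x) t (- Y1 r t)) by (intros; apply E1).
  assert (dYt : forall r t, is_derive (fun x => Y r x) t (X1 r t)) by (intros; apply E1).
  assert (dX1 : forall r t, is_derive (fun x => X1 x t) r (X2 r t)) by (intros; apply E2).
  assert (dY1 : forall r t, is_derive (fun x => Y1 x t) r (Y2 r t)) by (intros; apply E2).
  assert (dX1t : forall r t, is_derive (fun x => X1 r x) t (- Y2 r t)) by (intros; apply E2).
  assert (dY1t : forall r t, is_derive (fun x => Y1 r x) t (X2 r t)) by (intros; apply E2).
  assert (K : forall q, continuous2 q -> continuous2 (fun r t => q (X r t) (Y r t))).
  { intros q Hq. now apply c2_comp. }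
  apply (mean_mono (fun r t => p (X r t) (Y r t))
    (fun r t => px (X r t) (Y r t) * X1 r t + py (X r t) (Y r t) * Y1 r t)
    (fun r t => 0 + (X1 r t * (pxx (X r t) (Y r t) * X1 r t + pxy (X r t) (Y r t) * Y1 r t)
      + 1 * (Y1 r t * (pxy (X r t) (Y r t) * X1 r t + pyy (X r t) (Y r t) * Y1 r t)))
      + (px (X r t) (Y r t) * X2 r t + py (X r t) (Y r t) * Y2 r t))
    (fun r t => px (X r t) (Y r t) * (- Y1 r t) + py (X r t) (Y r t) * X1 r t)
    (fun r t => 0 + (- Y1 r t * (pxx (X r t) (Y r t) * (- Y1 r t) + pxy (X r t) (Y r t) * X1 r t)
      + 1 * (X1 r t * (pxy (X r t) (Y r t) * (- Y1 r t) + pyy (X r t) (Y r t) * X1 r t)))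
      + (px (X r t) (Y r t) * (- X2 r t) + py (X r t) (Y r t) * (- Y2 r t)))).
  - intros r t. apply (D0 (fun x => X x t) (fun x => Y x t) r); auto.
  - intros r t.
    evar_last.
    + eapply is_derive_ext.
      2:{ eapply (der_lin (fun x => px (X x t) (Y x t)) (fun x => py (X x t) (Y x t))
            (fun x => X1 x t) (fun x => Y1 x t) r) with (e := 0) (s := 1).
          apply (D1 (fun x => X x t) (fun x => Y x t)); auto.
          apply (D2 (fun x => X x t) (fun x => Y x t)); auto.
          apply dX1. apply dY1. }
      intro x; simpl; ring.
    + simpl. ring.
  - intros r t.
    evar_last.
    + eapply is_derive_ext.
      2:{ eapply (der_lin (fun x => px (X r x) (Y r x)) (fun x => py (X r x) (Y r x))
            (fun x => - Y1 r x) (fun x => X1 r x) t) with (e := 0) (s := 1).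
          apply (D1 (fun x => X r x) (fun x => Y r x)); auto.
          apply (D2 (fun x => X r x) (fun x => Y r x)); auto.
          apply (is_derive_opp (fun x => Y1 r x)). apply dY1t. apply dX1t. }
      intro x; simpl; ring.
    + unfold opp; simpl. ring.
  - now apply K.
  - apply c2_plus; apply c2_mult; auto.
  - repeat first [apply c2_plus | apply c2_mult | apply c2_const | assumption | now apply K].
  - repeat first [apply c2_plus | apply c2_mult | apply c2_opp | apply c2_const | assumption | now apply K].
  - intro r. unfold X, Y, X1, Y1. now rewrite zp_period.
  - intros r t. specialize (Hl (X r t) (Y r t)).
    (* By the Cauchy-Riemann equations the terms with first derivatives of [p] cancel, and the
       Laplacian of the composition is that of [p] times |w F'(w)|^2. *)
    replace (_ + _) with ((pxx (X r t) (Y r t) + pyy (X r t) (Y r t)) * (X1 r t * X1 r t + Y1 r t * Y1 r t)) by ring.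
    apply Rmult_le_pos; [exact Hl|nra].
  - intro r0. destruct (poly_le_bounded n F HF (exp r0)) as (B & HB0 & HB).
    { left; apply exp_pos. }
    destruct (Hb B) as [B' HB']. exists B'. intros r t Hr.
    assert (Hm : Cmod (F (logpolar r t)) <= B).
    { apply HB. rewrite zp_mod. destruct (Rle_lt_or_eq_dec _ _ Hr) as [H| ->]; [left; now apply exp_increasing|lra]. }
    apply HB'; (eapply Rle_trans; [|exact Hm]); eapply Rle_trans; try apply Rmax_Cmod.
    apply Rmax_l. apply Rmax_r.
Qed.

Lemma poly_le_cont0 (n : nat) F : poly_le n F -> forall eps, 0 < eps -> exists d, 0 < d /\
  forall w, Cmod w <= d -> Cmod (F w - F 0%C)%C <= eps.
Proof.
  intros HF eps He. destruct n as [|n].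
  - destruct HF as [c Hc]. exists 1. split; [lra|]. intros w _. rewrite !Hc.
    replace (c - c)%C with (RtoC 0) by ring. rewrite Cmod_0. lra.
  - destruct (poly_le_factor n 0%C F HF) as (G & HG & HGe).
    destruct (poly_le_bounded n G HG 1 ltac:(lra)) as (B & HB0 & HB).
    exists (Rmin 1 (eps / (B + 1))). split.
    { apply Rmin_pos; [lra|]. apply Rdiv_lt_0_compat; lra. }
    intros w Hw. rewrite HGe.
    replace (F 0%C + (w - 0) * G w - F 0%C)%C with (w * G w)%C by ring.
    rewrite Cmod_mult.
    assert (H1 : Cmod w <= 1) by (eapply Rle_trans; [exact Hw|apply Rmin_l]).
    assert (H2 : Cmod w <= eps / (B + 1)) by (eapply Rle_trans; [exact Hw|apply Rmin_r]).
    specialize (HB w H1).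
    apply Rle_trans with (eps / (B + 1) * (B + 1)).
    { apply Rmult_le_compat; try apply Cmod_ge_0; lra. }
    right. field. lra.
Qed.

(** By monotonicity in the radius the circle may shrink to the origin, where continuity makes the
    integral close to 2 pi times the value at [F 0]. The choice of [eps] makes the error half of the
    supposed deficit. *)
Lemma subharmonic_submean (p : R -> R -> R) (n : nat) (F : C -> C) (r : R) :
  subharmonic p -> poly_le n F ->
  2 * PI * p (fst (F 0%C)) (snd (F 0%C)) <=
  RInt (fun t => p (fst (F (logpolar r t))) (snd (F (logpolar r t)))) 0 (2 * PI).
Proof.
  intros Hp HF. apply Rnot_lt_le. intro Hlt. assert (HPI := PI_RGT_0).
  set (I0 := RInt _ _ _) in Hlt.
  set (x0 := fst (F 0%C)) in *. set (y0 := snd (F 0%C)) in *.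
  set (eps := (2 * PI * p x0 y0 - I0) / (4 * PI)).
  assert (He : 0 < eps) by (apply Rdiv_lt_0_compat; lra).
  assert (Cp : continuous2 p) by (destruct Hp as (? & ? & ? & ? & ? & ? & ? & ? & ? & _); assumption).
  destruct (Cp x0 y0 (mkposreal _ He)) as [d Hd].
  destruct (poly_le_cont0 n F HF (d / 2)) as (d' & Hd'0 & Hd').
  { generalize (cond_pos d); lra. }
  set (r1 := Rmin r (ln d')).
  assert (Hr1 : exp r1 <= d').
  { unfold r1. rewrite <- (exp_ln d') at 2 by exact Hd'0.
    destruct (Rle_lt_or_eq_dec _ _ (Rmin_r r (ln d'))) as [H|H];
      [left; now apply exp_increasing|rewrite H; lra]. }
  assert (Hm := subharmonic_mean_mono p n F Hp HF r1 r (Rmin_l _ _)). fold I0 in Hm.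
  assert (Hlow : 2 * PI * (p x0 y0 - eps) <=
    RInt (fun t => p (fst (F (logpolar r1 t))) (snd (F (logpolar r1 t)))) 0 (2 * PI)).
  { replace (2 * PI * (p x0 y0 - eps)) with (RInt (fun _ => p x0 y0 - eps) 0 (2 * PI)).
    2:{ rewrite RInt_const. unfold scal; simpl; unfold mult; simpl. ring. }
    destruct (poly_le_c2 n F HF) as [KX KY].
    apply RInt_le. lra. apply @ex_RInt_const.
    apply (c2_ex_RInt (fun r1 t => p (fst (F (logpolar r1 t))) (snd (F (logpolar r1 t))))). now apply c2_comp.
    intros t _.
    assert (Hc : Cmod (F (logpolar r1 t) - F 0%C)%C <= d / 2) by (apply Hd'; now rewrite zp_mod).
    assert (Hmx := Rmax_Cmod (F (logpolar r1 t) - F 0%C)%C). simpl in Hmx.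
    assert (Hd0 := cond_pos d).
    assert (Hq := Hd (fst (F (logpolar r1 t))) (snd (F (logpolar r1 t)))).
    simpl in Hq. apply Rlt_le. 
    assert (Hq' : Rabs (p (fst (F (logpolar r1 t))) (snd (F (logpolar r1 t))) - p x0 y0) < eps).
    { apply Hq; unfold x0, y0, Rminus.
      eapply Rle_lt_trans; [apply Rmax_l|]. eapply Rle_lt_trans; [exact Hmx|lra].
      eapply Rle_lt_trans; [apply Rmax_r|]. eapply Rle_lt_trans; [exact Hmx|lra]. }
    apply Rabs_def2 in Hq'. lra. }
  assert (2 * PI * (p x0 y0 - eps) > I0).
  { assert (E : 2 * PI * eps = (2 * PI * p x0 y0 - I0) / 2) by (unfold eps; field; lra).
    replace (2 * PI * (p x0 y0 - eps)) with (2 * PI * p x0 y0 - 2 * PI * eps) by ring.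
    rewrite E. lra. }
  lra.
Qed.

(** * Two families of subharmonic functions *)

(* With zeta = x + i sqrt(1 + y^2), [LL] is ln |zeta|^2 and [al] is arg zeta in (0, pi);
   [Cs t] and [Ss t] are the real and imaginary parts of zeta^t. As |zeta| -> oo, [Cs t] is
   asymptotic to the real part of the principal power (x + i y)^t, whose kink on the negative
   axis it smooths. *)
Definition LL (x y : R) : R := ln (x * x + y * y + 1).
Definition YY (y : R) : R := sqrt (1 + y * y).
Definition al (x y : R) : R := PI / 2 - atan (x / YY y).
Definition Cs (t x y : R) : R := exp (t / 2 * LL x y) * cos (t * al x y).
Definition Ss (t x y : R) : R := exp (t / 2 * LL x y) * sin (t * al x y).

Lemma YY_pos y : 0 < YY y.
Proof. apply sqrt_lt_R0. nra. Qed.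

Lemma YY_sqr y : YY y * YY y = 1 + y * y.
Proof. apply sqrt_sqrt. nra. Qed.

Lemma al_bound x y : 0 < al x y < PI.
Proof. unfold al. generalize (atan_bound (x / YY y)). lra. Qed.

Lemma LL_half_sqr x y : exp (LL x y / 2) * exp (LL x y / 2) = x * x + y * y + 1.
Proof.
  rewrite <- exp_plus. replace (LL x y / 2 + LL x y / 2) with (LL x y) by field.
  unfold LL. apply exp_ln. nra.
Qed.

Lemma al_polar x y :
  x = exp (LL x y / 2) * cos (al x y) /\ YY y = exp (LL x y / 2) * sin (al x y).
Proof.
  assert (HY := YY_pos y). assert (HY2 := YY_sqr y).
  set (m := exp (LL x y / 2)). assert (Hm : 0 < m) by apply exp_pos.
  assert (Hm2 : m * m = x * x + y * y + 1) by apply LL_half_sqr.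
  assert (Hs : sqrt (1 + (x / YY y)²) = m / YY y).
  { apply sqrt_lem_1.
    - generalize (Rle_0_sqr (x / YY y)); lra.
    - apply Rlt_le, Rdiv_lt_0_compat; lra.
    - unfold Rsqr. field_simplify; [|lra|lra].
      f_equal. nra. }
  unfold al. rewrite cos_shift, sin_shift, sin_atan, cos_atan, Hs. split; field; lra.
Qed.

(** Real part of zeta^(t-1) |zeta|^2 = zeta^t conj(zeta); [Ss_pred] is the imaginary part. They
    allow derivatives to be written with the exponent t - 1. *)
Lemma Cs_pred t x y :
  Cs (t - 1) x y * (x * x + y * y + 1) = Cs t x y * x + Ss t x y * YY y.
Proof.
  destruct (al_polar x y) as [Hx HY]. rewrite <- LL_half_sqr.
  transitivity (Cs t x y * (exp (LL x y / 2) * cos (al x y)) +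
    Ss t x y * (exp (LL x y / 2) * sin (al x y))); [|now rewrite <- Hx, <- HY].
  unfold Cs, Ss. replace ((t - 1) * al x y) with (t * al x y - al x y) by ring.
  rewrite cos_minus.
  replace (t / 2 * LL x y) with ((t - 1) / 2 * LL x y + LL x y / 2) by field.
  rewrite exp_plus. ring.
Qed.

Lemma Ss_pred t x y :
  Ss (t - 1) x y * (x * x + y * y + 1) = Ss t x y * x - Cs t x y * YY y.
Proof.
  destruct (al_polar x y) as [Hx HY]. rewrite <- LL_half_sqr.
  transitivity (Ss t x y * (exp (LL x y / 2) * cos (al x y)) -
    Cs t x y * (exp (LL x y / 2) * sin (al x y))); [|now rewrite <- Hx, <- HY].
  unfold Cs, Ss. replace ((t - 1) * al x y) with (t * al x y - al x y) by ring.
  rewrite sin_minus.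
  replace (t / 2 * LL x y) with ((t - 1) / 2 * LL x y + LL x y / 2) by field.
  rewrite exp_plus. ring.
Qed.


Definition DD (x y : R) : R := x * x + y * y + 1.

Lemma DD_pos x y : 0 < DD x y.
Proof. unfold DD. nra. Qed.

Lemma LL_path (x y : R -> R) (s x' y' : R) : is_derive x s x' -> is_derive y s y' ->
  is_derive (fun s => LL (x s) (y s)) s (2 * (x s * x' + y s * y') / DD (x s) (y s)).
Proof.
  intros Hx Hy. assert (HD := DD_pos (x s) (y s)). unfold LL, DD in *. auto_derive.
  - repeat split; try (eexists; eassumption); lra.
  - rewrite (Derive_eta Hx), (Derive_eta Hy). field. lra.
Qed.

Lemma YY_path (y : R -> R) (s y' : R) : is_derive y s y' ->
  is_derive (fun s => YY (y s)) s (y s * y' / YY (y s)).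
Proof.
  intros Hy. assert (HY := YY_pos (y s)). unfold YY in *. auto_derive.
  - repeat split; try (eexists; eassumption). nra.
  - rewrite (Derive_eta Hy). field. lra.
Qed.

Lemma al_path (x y : R -> R) (s x' y' : R) : is_derive x s x' -> is_derive y s y' ->
  is_derive (fun s => al (x s) (y s)) s
    (- (x' * YY (y s) - x s * (y s * y' / YY (y s))) / DD (x s) (y s)).
Proof.
  intros Hx Hy. assert (HD := DD_pos (x s) (y s)). assert (HY := YY_pos (y s)).
  assert (HY2 := YY_sqr (y s)).
  assert (HYp := YY_path y s y' Hy). unfold al.
  assert (G : forall Yf : R -> R, Yf s = YY (y s) ->
    is_derive Yf s (y s * y' / YY (y s)) ->
    is_derive (fun s => PI / 2 - atan (x s / Yf s)) s
    (- (x' * YY (y s) - x s * (y s * y' / YY (y s))) / DD (x s) (y s))).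
  2:{ exact (G (fun s => YY (y s)) eq_refl HYp). }
  intros Yf E HYf. auto_derive.
  - repeat split; try (eexists; eassumption). lra.
  - rewrite (Derive_eta Hx), (Derive_eta HYf), E. unfold DD in *.
    replace (x s * x s + y s * y s + 1) with (x s * x s + YY (y s) * YY (y s)) in * by lra.
    field. split; [lra|nra].
Qed.

Lemma exp_mult_cos_derive t (L a : R -> R) (s L' a' : R) : is_derive L s L' -> is_derive a s a' ->
  is_derive (fun s => exp (t / 2 * L s) * cos (t * a s)) s
    (t * exp (t / 2 * L s) * (L' / 2 * cos (t * a s) - a' * sin (t * a s))).
Proof.
  intros HL Ha. auto_derive. repeat split; eexists; eassumption.
  rewrite (Derive_eta HL), (Derive_eta Ha). field.
Qed.

Lemma exp_mult_sin_derive t (L a : R -> R) (s L' a' : R) : is_derive L s L' -> is_derive a s a' ->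
  is_derive (fun s => exp (t / 2 * L s) * sin (t * a s)) s
    (t * exp (t / 2 * L s) * (L' / 2 * sin (t * a s) + a' * cos (t * a s))).
Proof.
  intros HL Ha. auto_derive. repeat split; eexists; eassumption.
  rewrite (Derive_eta HL), (Derive_eta Ha). field.
Qed.

(** Real part of d(zeta^t) = t zeta^(t-1) d zeta, where d zeta = dx + i (y / Y) dy. *)
Lemma Cs_path t : path_derive (Cs t) (fun x y => t * Cs (t - 1) x y)
  (fun x y => - (t * Ss (t - 1) x y * (y / YY y))).
Proof.
  intros x y s x' y' Hx Hy.
  assert (HL := LL_path x y s x' y' Hx Hy). assert (Ha := al_path x y s x' y' Hx Hy).
  assert (HD := DD_pos (x s) (y s)). assert (HY := YY_pos (y s)).
  assert (E1 := Cs_pred t (x s) (y s)). assert (E2 := Ss_pred t (x s) (y s)).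
  fold (DD (x s) (y s)) in E1, E2.
  assert (E1' : Cs (t - 1) (x s) (y s) =
    (Cs t (x s) (y s) * x s + Ss t (x s) (y s) * YY (y s)) / DD (x s) (y s)).
  { rewrite <- E1. field. lra. }
  assert (E2' : Ss (t - 1) (x s) (y s) =
    (Ss t (x s) (y s) * x s - Cs t (x s) (y s) * YY (y s)) / DD (x s) (y s)).
  { rewrite <- E2. field. lra. }
  rewrite E1', E2'. unfold Cs, Ss.
  evar_last.
  - apply (exp_mult_cos_derive t (fun s => LL (x s) (y s)) (fun s => al (x s) (y s)) s _ _ HL Ha).
  - field. lra.
Qed.

Lemma Ss_path t : path_derive (Ss t) (fun x y => t * Ss (t - 1) x y)
  (fun x y => t * Cs (t - 1) x y * (y / YY y)).
Proof.
  intros x y s x' y' Hx Hy.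
  assert (HL := LL_path x y s x' y' Hx Hy). assert (Ha := al_path x y s x' y' Hx Hy).
  assert (HD := DD_pos (x s) (y s)). assert (HY := YY_pos (y s)).
  assert (E1 := Cs_pred t (x s) (y s)). assert (E2 := Ss_pred t (x s) (y s)).
  fold (DD (x s) (y s)) in E1, E2.
  assert (E1' : Cs (t - 1) (x s) (y s) =
    (Cs t (x s) (y s) * x s + Ss t (x s) (y s) * YY (y s)) / DD (x s) (y s)).
  { rewrite <- E1. field. lra. }
  assert (E2' : Ss (t - 1) (x s) (y s) =
    (Ss t (x s) (y s) * x s - Cs t (x s) (y s) * YY (y s)) / DD (x s) (y s)).
  { rewrite <- E2. field. lra. }
  rewrite E1', E2'. unfold Cs, Ss.
  evar_last.
  - apply (exp_mult_sin_derive t (fun s => LL (x s) (y s)) (fun s => al (x s) (y s)) s _ _ HL Ha).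
  - field. lra.
Qed.

Lemma path_derive_mult p px py q qx qy :
  path_derive p px py -> path_derive q qx qy ->
  path_derive (fun x y => p x y * q x y) (fun x y => px x y * q x y + p x y * qx x y)
    (fun x y => py x y * q x y + p x y * qy x y).
Proof.
  intros Hp Hq x y t x' y' Hx Hy.
  assert (H1 := Hp x y t x' y' Hx Hy). assert (H2 := Hq x y t x' y' Hx Hy).
  evar_last.
  - apply (is_derive_mult (fun t => p (x t) (y t)) (fun t => q (x t) (y t)) t _ _ H1 H2).
    intros; apply Rmult_comm.
  - unfold plus, mult; simpl. ring.
Qed.

Lemma path_derive_scal c p px py : path_derive p px py ->
  path_derive (fun x y => c * p x y) (fun x y => c * px x y) (fun x y => c * py x y).
Proof.
  intros Hp x y t x' y' Hx Hy. evar_last.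
  - apply (is_derive_scal (fun t => p (x t) (y t)) t c). apply Hp; [exact Hx|exact Hy].
  - simpl. unfold scal; simpl; unfold mult; simpl. ring.
Qed.

Lemma path_derive_ext p px py qx qy : path_derive p px py ->
  (forall x y, px x y = qx x y) -> (forall x y, py x y = qy x y) -> path_derive p qx qy.
Proof. intros Hp H1 H2 x y t x' y' Hx Hy. rewrite <- H1, <- H2. now apply Hp. Qed.

Lemma quot_path : path_derive (fun _ y => y / YY y) (fun _ _ => 0)
  (fun _ y => / (YY y * YY y * YY y)).
Proof.
  intros x y t x' y' Hx Hy.
  assert (HY := YY_pos (y t)). assert (HY2 := YY_sqr (y t)).
  assert (HYp := YY_path y t y' Hy).
  evar_last.
  - apply (is_derive_div y (fun t => YY (y t)) t _ _ Hy HYp). lra.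
  - apply Rmult_eq_reg_r with (YY (y t) * YY (y t) * YY (y t)).
    2:{ apply Rgt_not_eq. repeat apply Rmult_lt_0_compat; lra. }
    unfold minus, plus, opp, scal; simpl; unfold mult; simpl.
    field_simplify; [|lra|lra]. replace (YY (y t) ^ 2) with (1 + y t * y t) by (simpl; lra). ring.
Qed.

Lemma c2_YY : continuous2 (fun _ y => YY y).
Proof.
  apply (c2_ext (fun _ y => sqrt (1 + y * y))); [reflexivity|].
  apply (c2_comp1 sqrt).
  - intros _ y. apply continuity_pt_sqrt. nra.
  - apply c2_plus; [apply c2_const|apply c2_mult; apply c2_snd].
Qed.

Lemma c2_LL : continuous2 LL.
Proof.
  apply (c2_comp1 ln).
  - intros x y. apply derivable_continuous_pt. exists (/ (x * x + y * y + 1)).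
    apply derivable_pt_lim_ln. nra.
  - apply c2_plus; [|apply c2_const]. apply c2_plus; apply c2_mult; (apply c2_fst || apply c2_snd).
Qed.

Lemma c2_al : continuous2 al.
Proof.
  apply c2_minus; [apply c2_const|]. apply (c2_comp1 atan).
  - intros. apply derivable_continuous_pt, derivable_pt_atan.
  - apply c2_mult; [apply c2_fst|]. apply c2_inv; [apply c2_YY|].
    intros _ y. generalize (YY_pos y). lra.
Qed.

Lemma c2_Cs t : continuous2 (Cs t).
Proof.
  apply c2_mult; [apply (c2_comp1 exp)|apply (c2_comp1 cos)].
  - intros. apply derivable_continuous_pt, derivable_pt_exp.
  - apply c2_mult; [apply c2_const|apply c2_LL].
  - intros. apply derivable_continuous_pt, derivable_pt_cos.
  - apply c2_mult; [apply c2_const|apply c2_al].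
Qed.

Lemma c2_Ss t : continuous2 (Ss t).
Proof.
  apply c2_mult; [apply (c2_comp1 exp)|apply (c2_comp1 sin)].
  - intros. apply derivable_continuous_pt, derivable_pt_exp.
  - apply c2_mult; [apply c2_const|apply c2_LL].
  - intros. apply derivable_continuous_pt, derivable_pt_sin.
  - apply c2_mult; [apply c2_const|apply c2_al].
Qed.

Lemma sin_concave m a : 0 <= m <= 1 -> 0 <= a <= PI -> m * sin a <= sin (m * a).
Proof.
  intros Hm [Ha0 Ha]. destruct Ha0 as [Ha0|<-].
  2:{ rewrite Rmult_0_r, sin_0. lra. }
  destruct (MVT_gen (fun x => sin (m * x) - m * sin x) 0 a (fun x => m * cos (m * x) - m * cos x))
    as (c & Hc & E).
  - intros x _. auto_derive; [easy|ring].
  - intros x _. apply derivable_continuous_pt.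
    apply derivable_pt_minus; [|apply derivable_pt_scal, derivable_pt_sin].
    apply (derivable_pt_comp (fun x => m * x) sin).
    apply derivable_pt_scal, derivable_pt_id. apply derivable_pt_sin.
  - rewrite Rmin_left, Rmax_right in Hc by lra.
    rewrite Rmult_0_r, sin_0 in E.
    assert (cos c <= cos (m * c)).
    { apply cos_decr_1; try nra. }
    assert (0 <= m * cos (m * c) - m * cos c) by nra. nra.
Qed.

(* The Laplacian of [Cs s] is s / Y^3 times the left-hand side. *)
Lemma Cs_laplacian s x y :
  (s - 1) * Cs (s - 2) x y * YY y - Ss (s - 1) x y =
  exp ((s - 1) / 2 * LL x y) *
    ((s - 1) * cos ((s - 2) * al x y) * sin (al x y) - sin ((s - 1) * al x y)).
Proof.
  destruct (al_polar x y) as [_ HY]. rewrite HY. unfold Cs, Ss.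
  replace ((s - 1) / 2 * LL x y) with ((s - 2) / 2 * LL x y + LL x y / 2) by field.
  rewrite exp_plus. ring.
Qed.

(** Bounding the cosine by 1 reduces the sign to (1 - s) sin a <= sin((1 - s) a), the concavity of
    sine. For 1 <= s <= 2 the same argument with s - 1 gives the opposite sign. *)
Lemma Cs_laplacian_ge0 s x y : 0 <= s <= 1 ->
  0 <= (s - 1) * Cs (s - 2) x y * YY y - Ss (s - 1) x y.
Proof.
  intro Hs. rewrite Cs_laplacian. apply Rmult_le_pos; [left; apply exp_pos|].
  assert (Ha := al_bound x y).
  assert (H := sin_concave (1 - s) (al x y) ltac:(lra) ltac:(lra)).
  replace ((s - 1) * al x y) with (- ((1 - s) * al x y)) by ring. rewrite sin_neg.
  assert (Hsin : 0 <= sin (al x y)) by (apply sin_ge_0; lra).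
  generalize (COS_bound ((s - 2) * al x y)). intros [_ Hc].
  assert (0 <= (1 - cos ((s - 2) * al x y)) * ((1 - s) * sin (al x y))).
  { apply Rmult_le_pos; [lra|apply Rmult_le_pos; lra]. }
  nra.
Qed.

Lemma Cs_laplacian_le0 s x y : 1 <= s <= 2 ->
  (s - 1) * Cs (s - 2) x y * YY y - Ss (s - 1) x y <= 0.
Proof.
  intro Hs. rewrite Cs_laplacian.
  assert (He := exp_pos ((s - 1) / 2 * LL x y)).
  assert (Ha := al_bound x y).
  assert (H := sin_concave (s - 1) (al x y) ltac:(lra) ltac:(lra)).
  assert (Hsin : 0 <= sin (al x y)) by (apply sin_ge_0; lra).
  generalize (COS_bound ((s - 2) * al x y)). intros [_ Hc].
  assert (0 <= (1 - cos ((s - 2) * al x y)) * ((s - 1) * sin (al x y))).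
  { apply Rmult_le_pos; [lra|apply Rmult_le_pos; lra]. }
  assert ((s - 1) * cos ((s - 2) * al x y) * sin (al x y) - sin ((s - 1) * al x y) <= 0) by nra.
  nra.
Qed.

Lemma Cs_le s x y : Rabs (Cs s x y) <= exp (s / 2 * LL x y).
Proof.
  unfold Cs. rewrite Rabs_mult, (Rabs_pos_eq (exp _)) by (left; apply exp_pos).
  assert (He := exp_pos (s / 2 * LL x y)).
  assert (Rabs (cos (s * al x y)) <= 1) by (apply Rabs_le, COS_bound).
  nra.
Qed.

Lemma exp_LL_bounded s : 0 <= s -> forall M, exists B, forall x y,
  Rabs x <= M -> Rabs y <= M -> exp (s / 2 * LL x y) <= B.
Proof.
  intros Hs M. exists (exp (s / 2 * ln (M * M + M * M + 1))). intros x y Hx Hy.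
  assert (x * x <= M * M).
  { rewrite <- (Rabs_pos_eq (x * x)) by nra. rewrite Rabs_mult. generalize (Rabs_pos x). nra. }
  assert (y * y <= M * M).
  { rewrite <- (Rabs_pos_eq (y * y)) by nra. rewrite Rabs_mult. generalize (Rabs_pos y). nra. }
  assert (Hln : LL x y <= ln (M * M + M * M + 1)) by (apply ln_le; nra).
  assert (Hm : s / 2 * LL x y <= s / 2 * ln (M * M + M * M + 1)) by (apply Rmult_le_compat_l; lra).
  destruct (Rle_lt_or_eq_dec _ _ Hm) as [H1| ->]; [left; now apply exp_increasing|lra].
Qed.

(** The factor [e] is a sign: 1 for exponents in [0, 1], where the smoothed kink on the negative
    axis is a valley, and -1 for exponents in [1, 2], where it is a ridge. *)
Lemma sgn_Cs_subharmonic e s : 0 <= s ->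
  (forall x y, 0 <= e * ((s - 1) * Cs (s - 2) x y * YY y - Ss (s - 1) x y)) ->
  subharmonic (fun x y => e * Cs s x y).
Proof.
  intros Hs Hl.
  exists (fun x y => e * (s * Cs (s - 1) x y)),
    (fun x y => e * (- s * (Ss (s - 1) x y * (y / YY y)))),
    (fun x y => e * (s * ((s - 1) * Cs (s - 2) x y))),
    (fun x y => e * (s * (- ((s - 1) * Ss (s - 2) x y * (y / YY y))))),
    (fun x y => e * (- s * ((s - 1) * Cs (s - 2) x y * (y / YY y) * (y / YY y) +
       Ss (s - 1) x y * / (YY y * YY y * YY y)))).
  assert (Hs2 : s - 1 - 1 = s - 2) by ring.
  assert (cq : continuous2 (fun _ y => y / YY y)).
  { apply c2_mult; [apply c2_snd|]. apply c2_inv; [apply c2_YY|].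
    intros _ y. generalize (YY_pos y). lra. }
  assert (ci : continuous2 (fun _ y => / (YY y * YY y * YY y))).
  { apply c2_inv. apply c2_mult; [apply c2_mult|]; apply c2_YY.
    intros _ y. generalize (YY_pos y). intro.
    apply Rgt_not_eq. repeat apply Rmult_lt_0_compat; lra. }
  split; [|split; [|split; [|split; [|split; [|split; [|split]]]]]].
  - apply path_derive_scal. eapply path_derive_ext; [apply Cs_path| |]; intros; simpl; ring.
  - apply path_derive_scal. apply path_derive_scal. rewrite <- Hs2. apply Cs_path.
  - eapply path_derive_ext.
    + apply path_derive_scal. apply path_derive_scal.
      apply path_derive_mult; [apply Ss_path|apply quot_path].
    + intros; simpl. rewrite Hs2. ring.
    + intros; simpl. rewrite Hs2. ring.
  - apply c2_mult; [apply c2_const|apply c2_Cs].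
  - split; repeat first [apply c2_Cs | apply c2_Ss | exact cq | apply c2_const | apply c2_mult].
  - split; [|split];
    repeat first [apply c2_Cs | apply c2_Ss | exact cq | exact ci | apply c2_const
                 | apply c2_opp | apply c2_mult | apply c2_plus].
  - intros x y. assert (HY := YY_pos y). assert (HY2 := YY_sqr y).
    (* The second derivatives combine through Y^2 - y^2 = 1. *)
    replace (_ + _) with (s / (YY y * YY y * YY y) *
      (e * ((s - 1) * Cs (s - 2) x y * YY y - Ss (s - 1) x y))).
    + apply Rmult_le_pos; [|apply Hl]. apply Rmult_le_pos; [exact Hs|].
      left. apply Rinv_0_lt_compat. repeat apply Rmult_lt_0_compat; lra.
    + transitivity (e * s * ((s - 1) * Cs (s - 2) x y * ((YY y * YY y - y * y) / (YY y * YY y))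
        - Ss (s - 1) x y / (YY y * YY y * YY y))).
      * replace (YY y * YY y - y * y) with 1 by lra. field. lra.
      * field. lra.
  - intro M. destruct (exp_LL_bounded s Hs M) as [B HB].
    exists (Rabs e * B). intros x y Hx Hy. rewrite Rabs_mult.
    apply Rmult_le_compat_l; [apply Rabs_pos|].
    eapply Rle_trans; [apply Cs_le|]. now apply HB.
Qed.

Lemma Cs_subharmonic s : 0 <= s <= 1 -> subharmonic (fun x y => 1 * Cs s x y).
Proof.
  intro Hs. apply sgn_Cs_subharmonic; [lra|]. intros x y.
  generalize (Cs_laplacian_ge0 s x y Hs). lra.
Qed.

Lemma opp_Cs_subharmonic s : 1 <= s <= 2 -> subharmonic (fun x y => -1 * Cs s x y).
Proof.
  intro Hs. apply sgn_Cs_subharmonic; [lra|]. intros x y.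
  generalize (Cs_laplacian_le0 s x y Hs). lra.
Qed.

(** The smooth function (x^2 + y^2 + 1)^(p/2), comparable with |z|^p + 1. It stands in for |z|^p,
    which need not be twice differentiable at zeros. *)
Definition Ep (p x y : R) : R := exp (p / 2 * LL x y).

Lemma Ep_path p : path_derive (Ep p) (fun x y => p * (x * Ep (p - 2) x y))
  (fun x y => p * (y * Ep (p - 2) x y)).
Proof.
  intros x y s x' y' Hx Hy.
  assert (HL := LL_path x y s x' y' Hx Hy). assert (HD := DD_pos (x s) (y s)).
  assert (E : Ep (p - 2) (x s) (y s) = Ep p (x s) (y s) / DD (x s) (y s)).
  { unfold Ep. replace (p / 2 * LL (x s) (y s)) with ((p - 2) / 2 * LL (x s) (y s) + LL (x s) (y s)) by field.
    rewrite exp_plus. unfold LL at 3. rewrite exp_ln by exact HD. unfold DD in *. field. lra. }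
  rewrite E. unfold Ep.
  evar_last.
  - apply (is_derive_comp exp (fun s => p / 2 * LL (x s) (y s))).
    apply is_derive_exp. apply (is_derive_scal (fun s => LL (x s) (y s)) s (p / 2) _ HL).
  - unfold scal; simpl; unfold mult; simpl. field. lra.
Qed.

Lemma c2_Ep p : continuous2 (Ep p).
Proof.
  apply (c2_comp1 exp).
  - intros. apply derivable_continuous_pt, derivable_pt_exp.
  - apply c2_mult; [apply c2_const|apply c2_LL].
Qed.

Lemma fst_path : path_derive (fun x _ => x) (fun _ _ => 1) (fun _ _ => 0).
Proof. intros x y t x' y' Hx Hy. evar_last; [exact Hx|simpl; ring]. Qed.
Lemma snd_path : path_derive (fun _ y => y) (fun _ _ => 0) (fun _ _ => 1).
Proof. intros x y t x' y' Hx Hy. evar_last; [exact Hy|simpl; ring]. Qed.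

Lemma Ep_subharmonic p : 0 <= p -> subharmonic (Ep p).
Proof.
  intro Hp0.
  exists (fun x y => p * (x * Ep (p - 2) x y)), (fun x y => p * (y * Ep (p - 2) x y)),
    (fun x y => p * (1 * Ep (p - 2) x y + x * ((p - 2) * (x * Ep (p - 2 - 2) x y)))),
    (fun x y => p * (x * ((p - 2) * (y * Ep (p - 2 - 2) x y)))),
    (fun x y => p * (1 * Ep (p - 2) x y + y * ((p - 2) * (y * Ep (p - 2 - 2) x y)))).
  split; [|split; [|split; [|split; [|split; [|split; [|split]]]]]].
  - apply Ep_path.
  - eapply path_derive_ext.
    + apply path_derive_scal. apply path_derive_mult; [apply fst_path|apply Ep_path].
    + intros; simpl. ring.
    + intros; simpl. ring.
  - eapply path_derive_ext.
    + apply path_derive_scal. apply path_derive_mult; [apply snd_path|apply Ep_path].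
    + intros; simpl. ring.
    + intros; simpl. ring.
  - apply c2_Ep.
  - split; repeat first [apply c2_Ep | apply c2_const | apply c2_fst | apply c2_snd | apply c2_mult].
  - split; [|split];
    repeat first [apply c2_Ep | apply c2_const | apply c2_fst | apply c2_snd | apply c2_mult | apply c2_plus].
  - intros x y.
    assert (HD := DD_pos x y).
    assert (E : Ep (p - 2) x y = Ep (p - 2 - 2) x y * DD x y).
    { unfold Ep. replace ((p - 2) / 2 * LL x y) with ((p - 2 - 2) / 2 * LL x y + LL x y) by field.
      rewrite exp_plus. unfold LL at 2. rewrite exp_ln by exact HD. reflexivity. }
    rewrite E. assert (He : 0 < Ep (p - 2 - 2) x y) by apply exp_pos.
    unfold DD.
    replace (_ + _) with (p * Ep (p - 2 - 2) x y * (2 + p * (x * x + y * y))) by ring.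
    apply Rmult_le_pos; [nra|]. assert (0 <= x * x + y * y) by nra. nra.
  - intro M. destruct (exp_LL_bounded p Hp0 M) as [B HB]. exists B. intros x y Hx Hy.
    unfold Ep. rewrite Rabs_pos_eq by (left; apply exp_pos). now apply HB.
Qed.

(** * Real powers *)

Lemma rpow_0 p : rpow 0 p = 0.
Proof. unfold rpow. destruct (Req_EM_T 0 0); lra. Qed.

Lemma rpow_pos_eq x p : 0 < x -> rpow x p = exp (p * ln x).
Proof. intro H. unfold rpow. destruct (Req_EM_T x 0); [lra|reflexivity]. Qed.

Lemma rpow_pos x p : 0 < x -> 0 < rpow x p.
Proof. intro H. rewrite rpow_pos_eq by exact H. apply exp_pos. Qed.

Lemma rpow_ge0 x p : 0 <= rpow x p.
Proof. unfold rpow. destruct (Req_EM_T x 0); [lra|left; apply exp_pos]. Qed.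

Lemma rpow_1 p : rpow 1 p = 1.
Proof. rewrite rpow_pos_eq by lra. rewrite ln_1, Rmult_0_r. apply exp_0. Qed.

Lemma rpow_lt x y p : 0 < p -> 0 <= x < y -> rpow x p < rpow y p.
Proof.
  intros Hp [[Hx| <-] Hy].
  - rewrite !rpow_pos_eq by lra. apply exp_increasing.
    apply Rmult_lt_compat_l; [exact Hp|]. now apply ln_increasing.
  - rewrite rpow_0. now apply rpow_pos.
Qed.

Lemma rpow_le x y p : 0 < p -> 0 <= x <= y -> rpow x p <= rpow y p.
Proof.
  intros Hp [Hx [Hy| ->]]; [left; apply rpow_lt; lra|lra].
Qed.

Lemma rpow_mult x y p : 0 <= x -> 0 <= y -> rpow (x * y) p = rpow x p * rpow y p.
Proof.
  intros [Hx| <-] [Hy| <-]; rewrite ?Rmult_0_l, ?Rmult_0_r, ?rpow_0; try ring.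
  rewrite !rpow_pos_eq by (try apply Rmult_lt_0_compat; lra).
  rewrite ln_mult by assumption. rewrite <- exp_plus. f_equal. ring.
Qed.

Lemma rpow_plus x p q : 0 < x -> rpow x (p + q) = rpow x p * rpow x q.
Proof. intro H. rewrite !rpow_pos_eq by exact H. rewrite <- exp_plus. f_equal. ring. Qed.

Lemma rpow_rpow x p q : 0 <= x -> rpow (rpow x p) q = rpow x (p * q).
Proof.
  intros [Hx| <-].
  - assert (H := rpow_pos x p Hx). rewrite (rpow_pos_eq (rpow x p)) by exact H.
    rewrite !rpow_pos_eq by exact Hx. rewrite ln_exp. f_equal. ring.
  - rewrite !rpow_0. reflexivity.
Qed.

Lemma rpow_x1 x : 0 <= x -> rpow x 1 = x.
Proof.
  intros [Hx| <-]; [|apply rpow_0]. rewrite rpow_pos_eq by exact Hx.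
  rewrite Rmult_1_l. now apply exp_ln.
Qed.

Lemma rpow_pow x (n : nat) : (0 < n)%nat -> 0 <= x -> rpow x (INR n) = x ^ n.
Proof.
  intros Hn [Hx| <-].
  - rewrite rpow_pos_eq by exact Hx. now rewrite <- Rpower_pow.
  - rewrite rpow_0, pow_i; [reflexivity|lia].
Qed.

Lemma rpow_add x y p : 0 < p -> 0 <= x -> 0 <= y ->
  rpow (x + y) p <= rpow 2 p * (rpow x p + rpow y p).
Proof.
  intros Hp Hx Hy. rewrite Rmult_plus_distr_l, <- !rpow_mult by lra.
  assert (H1 := rpow_ge0 (2 * x) p). assert (H2 := rpow_ge0 (2 * y) p).
  destruct (Rle_dec x y).
  - assert (rpow (x + y) p <= rpow (2 * y) p) by (apply rpow_le; lra). lra.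
  - assert (rpow (x + y) p <= rpow (2 * x) p) by (apply rpow_le; lra). lra.
Qed.

Lemma exp_bernoulli p t : 1 <= p -> 1 + p * (exp t - 1) <= exp (p * t).
Proof.
  intro Hp.
  set (f := fun t => exp (p * t) - (1 + p * (exp t - 1))).
  assert (Df : forall t, is_derive f t (p * (exp (p * t) - exp t))).
  { intro u. unfold f. auto_derive; [easy|ring]. }
  assert (f0 : f 0 = 0) by (unfold f; rewrite Rmult_0_r, exp_0; ring).
  assert (Hmono : forall u v, u <= v -> exp u <= exp v).
  { intros u v [H| ->]; [left; now apply exp_increasing|lra]. }
  cut (0 <= f t). { unfold f; lra. }
  destruct (Rtotal_order t 0) as [H|[->|H]].
  - destruct (MVT_is_derive f _ t 0 H Df) as (c & Hc & E).
    assert (H1 : exp (p * c) <= exp c) by (apply Hmono; nra).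
    assert (H2 : 0 <= p * (exp c - exp (p * c)) * (0 - t)) by (repeat apply Rmult_le_pos; lra). lra.
  - rewrite f0; lra.
  - destruct (MVT_is_derive f _ 0 t H Df) as (c & Hc & E).
    assert (H1 : exp c <= exp (p * c)) by (apply Hmono; nra).
    assert (H2 : 0 <= p * (exp (p * c) - exp c) * (t - 0)) by (repeat apply Rmult_le_pos; lra). lra.
Qed.

Lemma rpow_bernoulli x p : 1 <= p -> 0 <= x -> 1 + p * (x - 1) <= rpow x p.
Proof.
  intros Hp [Hx| <-].
  - rewrite rpow_pos_eq by exact Hx. generalize (exp_bernoulli p (ln x) Hp).
    now rewrite exp_ln.
  - rewrite rpow_0. lra.
Qed.

(** The tangent line of the convex function x^p at m, obtained from Bernoulli's inequality by
    scaling. Summed or integrated against a weight it yields Jensen's inequality. *)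
Lemma rpow_tangent x m p : 1 <= p -> 0 <= x -> 0 < m ->
  rpow m p + p * (rpow m p / m) * (x - m) <= rpow x p.
Proof.
  intros Hp Hx Hm. assert (H := rpow_bernoulli (x / m) p Hp).
  assert (H0 : 0 <= x / m) by (apply Rmult_le_pos; [exact Hx|left; now apply Rinv_0_lt_compat]).
  specialize (H H0). assert (HP := rpow_pos m p Hm).
  replace (rpow x p) with (rpow m p * rpow (x / m) p).
  2:{ rewrite <- rpow_mult by lra. f_equal. field. lra. }
  replace (rpow m p + p * (rpow m p / m) * (x - m)) with (rpow m p * (1 + p * (x / m - 1))) by (field; lra).
  apply Rmult_le_compat_l; lra.
Qed.

Lemma rpow_continuous (g : R -> R) p t : 0 < p -> (forall t, 0 <= g t) ->
  continuous g t -> continuous (fun t => rpow (g t) p) t.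
Proof.
  intros Hp Hg Hc. apply continuity_pt_filterlim.
  apply continuity_pt_filterlim in Hc.
  destruct (Hg t) as [Ht|Ht].
  - assert (Hloc : exists d, 0 < d /\ forall x, Rabs (x - t) < d -> 0 < g x).
    { destruct (Hc (g t) Ht) as (d & Hd & H). exists d. split; [exact Hd|].
      intros x Hx. destruct (Req_dec x t) as [->|Hne]; [exact Ht|].
      assert (Hq : Rabs (g x - g t) < g t).
      { apply H. split; [split; [exact I|auto]|exact Hx]. }
      apply Rabs_def2 in Hq. lra. }
    destruct Hloc as (d & Hd & Hpos).
    apply (continuity_pt_locally_ext (fun t => exp (p * ln (g t))) _ d); [exact Hd| |].
    { intros x Hx. symmetry. apply rpow_pos_eq. now apply Hpos. }
    apply (continuity_pt_comp (fun t => p * ln (g t)) exp).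
    + apply continuity_pt_scal. apply (continuity_pt_comp g ln); [exact Hc|].
      apply derivable_continuous_pt. exists (/ g t). now apply derivable_pt_lim_ln.
    + apply derivable_continuous_pt, derivable_pt_exp.
  - intros eps He.
    destruct (Hc (rpow eps (/ p))) as (d & Hd & H). { now apply rpow_pos. }
    exists d. split; [exact Hd|]. intros x Hx.
    specialize (H x Hx). simpl in *. unfold Rdist in *.
    rewrite <- Ht, rpow_0 in *. rewrite Rminus_0_r in *.
    rewrite Rabs_pos_eq in * by (apply Hg || apply rpow_ge0).
    replace eps with (rpow (rpow eps (/ p)) p).
    + apply rpow_lt; [exact Hp|]. split; [apply Hg|exact H].
    + rewrite rpow_rpow by lra. rewrite Rinv_l by lra. apply rpow_x1. lra.
Qed.

Lemma poly_le_cont_cis (n : nat) (rho : R) : forall F, poly_le n F -> forall t,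
  continuous (fun t => fst (F (RtoC rho * cis t)%C)) t /\
  continuous (fun t => snd (F (RtoC rho * cis t)%C)) t.
Proof.
  assert (Hx : forall t, continuous (fun t => rho * cos t) t).
  { intro t. apply continuity_pt_filterlim.
    apply continuity_pt_scal, derivable_continuous_pt, derivable_pt_cos. }
  assert (Hy : forall t, continuous (fun t => rho * sin t) t).
  { intro t. apply continuity_pt_filterlim.
    apply continuity_pt_scal, derivable_continuous_pt, derivable_pt_sin. }
  induction n as [|n IH]; intros F.
  - intros [c Hc] t. split.
    + apply (continuous_ext (fun _ => fst c)). intro; now rewrite Hc. apply continuous_const.
    + apply (continuous_ext (fun _ => snd c)). intro; now rewrite Hc. apply continuous_const.
  - intros (c & G & HG & Hc) t. destruct (IH G HG t) as [C1 C2]. split.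
    + apply (continuous_ext (fun t => plus (fst c)
        (minus (mult (rho * cos t) (fst (G (RtoC rho * cis t)%C)))
               (mult (rho * sin t) (snd (G (RtoC rho * cis t)%C)))))).
      { intro x. rewrite Hc. unfold minus, plus, opp, mult; simpl. ring. }
      apply @continuous_plus; [apply continuous_const|].
      apply @continuous_minus; apply @continuous_mult; auto.
    + apply (continuous_ext (fun t => plus (snd c)
        (plus (mult (rho * cos t) (snd (G (RtoC rho * cis t)%C)))
               (mult (rho * sin t) (fst (G (RtoC rho * cis t)%C)))))).
      { intro x. rewrite Hc. unfold minus, plus, opp, mult; simpl. ring. }
      apply @continuous_plus; [apply continuous_const|].
      apply @continuous_plus; apply @continuous_mult; auto.
Qed.

Lemma Cmod_continuous (f : R -> C) t : continuous (fun t => fst (f t)) t ->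
  continuous (fun t => snd (f t)) t -> continuous (fun t => Cmod (f t)) t.
Proof.
  intros H1 H2. unfold Cmod.
  apply (continuous_comp (fun t => fst (f t) ^ 2 + snd (f t) ^ 2) sqrt).
  - apply (continuous_ext (fun t => plus (mult (fst (f t)) (fst (f t))) (mult (snd (f t)) (snd (f t))))).
    { intro x. unfold plus, mult; simpl. ring. }
    apply @continuous_plus; apply @continuous_mult; assumption.
  - apply continuous_sqrt.
Qed.

Lemma poly_le_Cmod_continuous (n : nat) (rho : R) F : poly_le n F -> forall t,
  continuous (fun t => Cmod (F (RtoC rho * cis t)%C)) t.
Proof.
  intros HF t. destruct (poly_le_cont_cis n rho F HF t). apply (Cmod_continuous (fun t => F (RtoC rho * cis t)%C)); assumption.
Qed.

Lemma poly_le_rpow_continuous (n : nat) (rho p : R) F : 0 < p -> poly_le n F -> forall t,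
  continuous (fun t => rpow (Cmod (F (RtoC rho * cis t)%C)) p) t.
Proof.
  intros Hp HF t. apply rpow_continuous; [exact Hp|intro; apply Cmod_ge_0|].
  now apply poly_le_Cmod_continuous with n.
Qed.

Lemma ex_RInt_cont (f : R -> R) a b : (forall t, continuous f t) -> ex_RInt f a b.
Proof. intro H. apply @ex_RInt_continuous. intros; apply H. Qed.

(** * A sectorial inequality for pairs of polynomials *)

Lemma cos_mono_abs x y : Rabs x <= y -> y <= PI -> cos y <= cos x.
Proof.
  intros Hx Hy. assert (E : cos x = cos (Rabs x)).
  { unfold Rabs. destruct (Rcase_abs x); [now rewrite cos_neg|reflexivity]. }
  rewrite E. generalize (Rabs_pos x). intro. apply cos_decr_1; lra.
Qed.

Lemma cos_lt_1 x : 0 < x <= PI -> cos x < 1.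
Proof. intros [H1 H2]. rewrite <- cos_0. apply cos_decreasing_1; lra. Qed.

(** An angle known only modulo 2 pi is replaced by a representative in [-b, b]. *)
Lemma cis_close u b : 0 <= b <= PI -> cos b < cos u ->
  exists v, Rabs v <= b /\ cis u = cis v.
Proof.
  intros Hb Hu. assert (Hbd := COS_bound u).
  assert (Hac : 0 <= acos (cos u) <= PI) by apply acos_bound.
  assert (Hc : cos (acos (cos u)) = cos u) by (apply cos_acos; lra).
  assert (Hle : acos (cos u) <= b).
  { apply Rnot_lt_le. intro H.
    assert (cos (acos (cos u)) < cos b) by (apply cos_decreasing_1; lra). lra. }
  assert (Hs : Rabs (sin u) = sin (acos (cos u))).
  { rewrite sin_acos by lra. rewrite <- sqrt_Rsqr_abs. f_equal.
    generalize (sin2_cos2 u). lra. }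
  destruct (Rcase_abs (sin u)) as [H|H].
  - exists (- acos (cos u)). rewrite Rabs_Ropp, Rabs_pos_eq by lra. split; [exact Hle|].
    apply C_eq; simpl; [now rewrite cos_neg, Hc|].
    rewrite sin_neg, <- Hs. rewrite Rabs_left by exact H. ring.
  - exists (acos (cos u)). rewrite Rabs_pos_eq by lra. split; [exact Hle|].
    apply C_eq; simpl; [now rewrite Hc|]. rewrite <- Hs. rewrite Rabs_pos_eq by lra. reflexivity.
Qed.

(** Law of cosines: the difference is small only if |a| is close to |b| and arg(a b) is close to 2
    phi modulo 2 pi. *)
Lemma Cmod_twist_sqr (a b : C) phi :
  Cmod (cis (- phi) * a - cis phi * Cconj b)%C ^ 2 =
  Cmod a ^ 2 + Cmod b ^ 2 - 2 * fst (a * b * cis (- (2 * phi)))%C.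
Proof.
  rewrite !Cmod2_alt. unfold Re, Im. destruct a as [a1 a2], b as [b1 b2]. simpl.
  rewrite !cos_neg, !sin_neg, cos_2a, sin_2a.
  generalize (sin2_cos2 phi). unfold Rsqr. set (c := cos phi). set (s := sin phi). intro H.
  assert (H1 : s * s = 1 - c * c) by lra.
  ring_simplify. 
  replace (c ^ 2) with (1 - s * s) by (simpl; lra).
  ring_simplify. ring.
Qed.

Lemma Cmod_twist_lower (a b : C) phi :
  Rabs (Cmod a - Cmod b) <= Cmod (cis (- phi) * a - cis phi * Cconj b)%C.
Proof.
  set (u := (cis (- phi) * a)%C). set (v := (cis phi * Cconj b)%C).
  assert (Hu : Cmod u = Cmod a) by (unfold u; rewrite Cmod_mult, cis_mod; ring).
  assert (Hv : Cmod v = Cmod b) by (unfold v; rewrite Cmod_mult, cis_mod, Cmod_conj; ring).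
  rewrite <- Hu, <- Hv. apply Rabs_le. split.
  - generalize (Cmod_triangle u (- (u - v))%C). rewrite Cmod_opp.
    replace (u + - (u - v))%C with v by ring. lra.
  - generalize (Cmod_triangle v (u - v)%C).
    replace (v + (u - v))%C with u by ring. lra.
Qed.

(* Outside the sector |arg w^m| < alpha (up to a bounded translation) the argument of
   w = ab stays away from the values [2 phi] at which the left-hand difference may vanish. *)
Lemma off_sector (m : nat) (Theta alpha : R) :
  (0 < m)%nat -> 0 <= Theta -> INR m * Theta < alpha -> alpha <= PI / 2 ->
  exists eta K, 0 < eta /\ 0 <= K /\ forall (a b : C) (phi : R),
  Rabs (2 * phi) <= Theta ->
  fst ((a * b) ^ m)%C - cos alpha / sin alpha * Rabs (snd ((a * b) ^ m)%C) <= cos alpha / sin alpha ->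
  eta * (Cmod a ^ 2 + Cmod b ^ 2) - K <= Cmod (cis (- phi) * a - cis phi * Cconj b)%C ^ 2.
Proof.
  intros Hm HT Ha Ha2. assert (HPI := PI_RGT_0).
  assert (Hm1 : 1 <= INR m) by (apply (le_INR 1); lia).
  (* Half the slack between Theta and alpha / m: angles within [beta] of 2 phi still lie strictly
     inside the sector after multiplication by m. *)
  set (beta := (alpha / INR m - Theta) / 2).
  assert (Hb0 : 0 < beta).
  { unfold beta. assert (Theta < alpha / INR m); [|lra].
    apply Rmult_lt_reg_r with (INR m); [lra|]. replace (alpha / INR m * INR m) with alpha by (field; lra). lra. }
  assert (Hbeta : INR m * (Theta + beta) = (INR m * Theta + alpha) / 2) by (unfold beta; field; lra).
  assert (Hb1 : beta <= PI / 2).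
  { assert (INR m * beta <= alpha) by nra. nra. }
  set (T := cos alpha / sin alpha).
  assert (Hal0 : 0 < alpha) by nra.
  assert (Hsa : 0 < sin alpha) by (apply sin_gt_0; lra).
  assert (Hca : 0 <= cos alpha) by (apply cos_ge_0; lra).
  assert (HT0 : 0 <= T) by (apply Rmult_le_pos; [lra|left; now apply Rinv_0_lt_compat]).
  set (alpha2 := (INR m * Theta + alpha) / 2).
  assert (Hal2 : 0 <= alpha2 < alpha) by (unfold alpha2; nra).
  set (kap := sin (alpha - alpha2)).
  assert (Hkap : 0 < kap) by (apply sin_gt_0; lra).
  set (K1 := Rmax 1 (T / kap)).
  assert (HK1 : 1 <= K1) by apply Rmax_l.
  assert (Hcb : 0 <= cos beta) by (apply cos_ge_0; lra).
  assert (Hcb1 : cos beta < 1) by (apply cos_lt_1; lra).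
  exists (1 - cos beta), (2 * K1). split; [lra|]. split; [lra|].
  intros a b phi Hphi HW. rewrite Cmod_twist_sqr.
  set (w := (a * b)%C) in *.
  assert (Hw : Cmod w = Cmod a * Cmod b) by apply Cmod_mult.
  destruct (cis_polar w) as [lam Hlam].
  assert (Hre : fst (w * cis (- (2 * phi)))%C = Cmod w * cos (lam - 2 * phi)).
  { rewrite Hlam at 1. rewrite <- Cmult_assoc, <- cis_add. simpl.
    replace (lam + - (2 * phi)) with (lam - 2 * phi) by ring. ring. }
  rewrite Hre.
  assert (Hrho := Cmod_ge_0 a). assert (Hsig := Cmod_ge_0 b). assert (Hw0 := Cmod_ge_0 w).
  destruct (Rle_lt_dec (cos (lam - 2 * phi)) (cos beta)) as [Hc|Hc].
  - assert (Cmod w * cos (lam - 2 * phi) <= Cmod w * cos beta) by (apply Rmult_le_compat_l; lra).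
    rewrite Hw in *. set (x := Cmod a) in *. set (y := Cmod b) in *.
    assert (0 <= (x - y) ^ 2) by apply pow2_ge_0.
    assert (0 <= cos beta * (x - y) ^ 2) by (apply Rmult_le_pos; lra). nra.
  (* Now arg(w^m) is at most alpha2 < alpha in absolute value, so the hypothesis forces |w|^m kap <=
     cot alpha. Such w are bounded, and their contribution goes into the additive constant. *)
  - assert (Hbnd : Cmod w <= K1).
    { destruct (cis_close (lam - 2 * phi) beta) as (v & Hv & Ev); [lra|exact Hc|].
      assert (El : cis lam = cis (2 * phi + v)).
      { replace lam with (2 * phi + (lam - 2 * phi)) by ring. rewrite !cis_add, Ev. reflexivity. }
      set (xi := INR m * (2 * phi + v)).
      assert (Hxi : Rabs xi <= alpha2).
      { unfold xi. rewrite Rabs_mult, (Rabs_pos_eq (INR m)) by lra.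
        unfold alpha2. rewrite <- Hbeta. apply Rmult_le_compat_l; [lra|].
        eapply Rle_trans; [apply Rabs_triang|lra]. }
      assert (EW : (w ^ m)%C = (RtoC (Cmod w ^ m) * cis xi)%C).
      { rewrite Hlam at 1. rewrite Cpow_mult_l, El, cis_pow, RtoC_pow. reflexivity. }
      assert (HcisX : fst (w ^ m)%C = Cmod w ^ m * cos xi) by (rewrite EW; simpl; ring).
      assert (HcisY : snd (w ^ m)%C = Cmod w ^ m * sin xi) by (rewrite EW; simpl; ring).
      rewrite HcisX, HcisY in HW. fold T in HW.
      assert (HM : 0 <= Cmod w ^ m) by now apply pow_le.
      rewrite Rabs_mult, (Rabs_pos_eq (Cmod w ^ m)) in HW by exact HM.
      assert (Hab : Rabs (sin xi) = sin (Rabs xi)).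
      { unfold Rabs at 2. destruct (Rcase_abs xi) as [H|H].
        - rewrite sin_neg. rewrite Rabs_left1; [reflexivity|].
          rewrite <- (Ropp_involutive xi), sin_neg.
          assert (0 <= sin (- xi)); [|lra]. rewrite Rabs_left in Hxi by exact H. apply sin_ge_0; lra.
        - apply Rabs_pos_eq. rewrite Rabs_pos_eq in Hxi by lra. apply sin_ge_0; lra. }
      assert (Hcx : cos xi = cos (Rabs xi)).
      { unfold Rabs. destruct (Rcase_abs xi); [now rewrite cos_neg|reflexivity]. }
      assert (Hx0 := Rabs_pos xi).
      assert (Hlow : kap <= cos xi - T * Rabs (sin xi)).
      { rewrite Hab, Hcx.
        assert (E : cos (Rabs xi) - T * sin (Rabs xi) = sin (alpha - Rabs xi) / sin alpha).
        { unfold T. rewrite sin_minus. field. lra. }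
        rewrite E. assert (H1 : kap <= sin (alpha - Rabs xi)) by (apply sin_incr_1; lra).
        assert (Hs1 : sin alpha <= 1) by apply SIN_bound.
        apply Rmult_le_reg_r with (sin alpha); [exact Hsa|].
        replace (sin (alpha - Rabs xi) / sin alpha * sin alpha) with (sin (alpha - Rabs xi)) by (field; lra).
        nra. }
      assert (Hfin : Cmod w ^ m * kap <= T) by nra.
      assert (Hfin2 : Cmod w ^ m <= T / kap).
      { apply Rmult_le_reg_r with kap; [exact Hkap|].
        replace (T / kap * kap) with T by (field; lra). exact Hfin. }
      destruct (Rle_dec (Cmod w) 1) as [H1|H1]; [lra|].
      assert (Cmod w <= Cmod w ^ m).
      { rewrite <- (pow_1 (Cmod w)) at 1. apply Rle_pow; [lra|lia]. }
      unfold K1. eapply Rle_trans; [|apply Rmax_r]. lra. }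
    assert (Hcc := COS_bound (lam - 2 * phi)).
    assert (Cmod w * cos (lam - 2 * phi) <= K1) by nra.
    assert (0 <= Cmod a ^ 2 + Cmod b ^ 2) by nra. nra.
Qed.

(* A kernel: subharmonic, of growth at most |W|^s, and at most -kap |W|^s on the sector
   |arg W| < alpha. *)
Definition sector_kernel (psi : R -> R -> R) (c0 s alpha kap : R) : Prop :=
  subharmonic psi /\ 0 < kap /\
  forall W : C,
    psi (c0 * fst W) (c0 * snd W) <= exp (s / 2 * LL (fst W) (snd W)) /\
    (psi (c0 * fst W) (c0 * snd W) <= - kap * exp (s / 2 * LL (fst W) (snd W)) \/
     fst W - cos alpha / sin alpha * Rabs (snd W) <= cos alpha / sin alpha).

Lemma YY_le y : YY y <= 1 + Rabs y.
Proof.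
  apply Rsqr_incr_0_var. 2:{ generalize (Rabs_pos y); lra. }
  unfold Rsqr. rewrite YY_sqr. assert (H := Rabs_pos y).
  assert (y * y = Rabs y * Rabs y) by (rewrite <- Rabs_mult, Rabs_pos_eq; nra). nra.
Qed.

Lemma LL_opp x y : LL (-1 * x) (-1 * y) = LL x y.
Proof. unfold LL. f_equal. ring. Qed.

(** The condition arg zeta > alpha reads x < cot(alpha) Y, and Y <= 1 + |y|. This is the origin of
    the translation by cot(alpha) in the sector conditions. *)
Lemma al_gt_cot alpha x y : 0 < alpha <= PI / 2 -> alpha < al x y ->
  x - cos alpha / sin alpha * Rabs y <= cos alpha / sin alpha.
Proof.
  intros Ha Hal. assert (HY := YY_pos y). assert (HYl := YY_le y).
  assert (Hs : 0 < sin alpha) by (apply sin_gt_0; lra).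
  assert (Hc : 0 <= cos alpha) by (apply cos_ge_0; lra).
  assert (Ht : x / YY y < cos alpha / sin alpha).
  { apply Rnot_le_lt. intro Hle.
    assert (Hb := atan_bound (x / YY y)).
    assert (E : tan (PI / 2 - alpha) = cos alpha / sin alpha).
    { unfold tan. now rewrite sin_shift, cos_shift. }
    assert (E2 : atan (cos alpha / sin alpha) = PI / 2 - alpha).
    { rewrite <- E. apply atan_tan. lra. }
    assert (PI / 2 - alpha <= atan (x / YY y)).
    { rewrite <- E2. destruct Hle as [H|H]; [left; now apply atan_increasing|rewrite H; lra]. }
    unfold al in Hal. lra. }
  assert (x < cos alpha / sin alpha * YY y).
  { replace x with (x / YY y * YY y) by (field; lra). apply Rmult_lt_compat_r; lra. }
  assert (0 <= cos alpha / sin alpha).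
  { apply Rmult_le_pos; [lra|left; now apply Rinv_0_lt_compat]. }
  nra.
Qed.

Lemma al_opp x y : al (-1 * x) (-1 * y) = PI - al x y.
Proof.
  unfold al. replace (YY (-1 * y)) with (YY y) by (unfold YY; f_equal; ring).
  replace (-1 * x / YY y) with (- (x / YY y)) by (generalize (YY_pos y); intro; field; lra).
  rewrite atan_opp. lra.
Qed.

(** Evaluation at -W turns the argument [al] into pi - [al], and cos(s (pi - al)) is negative for al
    < pi - pi/(2s). For s = p/2 this angle is pi - pi/p. *)
Lemma sector_kernel_small s alpha : 1 / 2 < s <= 1 -> 0 < alpha <= PI / 2 -> alpha < PI - PI / (2 * s) ->
  exists kap, sector_kernel (fun x y => 1 * Cs s x y) (-1) s alpha kap.
Proof.
  intros Hs Ha Ha2. assert (HPI := PI_RGT_0).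
  assert (Hth : PI / 2 < s * (PI - alpha)).
  { apply Rmult_lt_reg_r with (/ s); [apply Rinv_0_lt_compat; lra|].
    replace (PI / 2 * / s) with (PI / (2 * s)) by (field; lra).
    replace (s * (PI - alpha) * / s) with (PI - alpha) by (field; lra). lra. }
  exists (- cos (s * (PI - alpha))). split; [apply Cs_subharmonic; lra|]. split.
  { assert (cos (s * (PI - alpha)) < 0); [|lra]. apply cos_lt_0; nra. }
  intros [X Y]. simpl fst; simpl snd. rewrite Rmult_1_l. split.
  { eapply Rle_trans; [apply Rle_abs|]. eapply Rle_trans; [apply Cs_le|]. rewrite LL_opp. lra. }
  destruct (Rlt_dec alpha (al X Y)) as [H|H]; [right; now apply al_gt_cot|left].
  unfold Cs. rewrite LL_opp, al_opp. assert (Hb := al_bound X Y).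
  rewrite Rmult_comm. rewrite Ropp_involutive. apply Rmult_le_compat_r; [left; apply exp_pos|].
  apply cos_decr_1; try nra.
Qed.

(** The factor cos(s al) is positive for al < pi/(2s). With s = p/(2m) and W = w^m this is the angle
    pi/p for w. *)
Lemma sector_kernel_large s alpha : 1 <= s <= 2 -> 0 < alpha -> alpha < PI / (2 * s) ->
  exists kap, sector_kernel (fun x y => -1 * Cs s x y) 1 s alpha kap.
Proof.
  intros Hs Ha Ha2. assert (HPI := PI_RGT_0).
  assert (Hth : s * alpha < PI / 2).
  { apply Rmult_lt_reg_r with (/ s); [apply Rinv_0_lt_compat; lra|].
    replace (PI / 2 * / s) with (PI / (2 * s)) by (field; lra).
    replace (s * alpha * / s) with alpha by (field; lra). lra. }
  exists (cos (s * alpha)). split; [apply opp_Cs_subharmonic; lra|]. split.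
  { apply cos_gt_0; nra. }
  intros [X Y]. simpl fst; simpl snd. rewrite !Rmult_1_l. split.
  { eapply Rle_trans; [apply Rle_abs|]. rewrite Rabs_mult. replace (Rabs (-1)) with 1 by (rewrite Rabs_left; lra).
    rewrite Rmult_1_l. apply Cs_le. }
  destruct (Rlt_dec alpha (al X Y)) as [H|H]; [right; apply al_gt_cot; [nra|exact H]|left].
  unfold Cs. assert (Hb := al_bound X Y).
  assert (cos (s * alpha) <= cos (s * al X Y)).
  { apply cos_decr_1; nra. }
  assert (He := exp_pos (s / 2 * LL X Y)). nra.
Qed.

Lemma exp_LL_rpow s (W : C) : 0 < s ->
  rpow (Cmod W) s <= exp (s / 2 * LL (fst W) (snd W)) <= rpow 2 s * (rpow (Cmod W) s + 1).
Proof.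
  intro Hs. assert (HW := Cmod_sqr W). assert (Hm := Cmod_ge_0 W).
  set (m := exp (LL (fst W) (snd W) / 2)).
  assert (Hm2 : m * m = Cmod W * Cmod W + 1).
  { rewrite HW. apply LL_half_sqr. }
  assert (Hmp : 0 < m) by apply exp_pos.
  assert (E : exp (s / 2 * LL (fst W) (snd W)) = rpow m s).
  { rewrite rpow_pos_eq by exact Hmp. unfold m. rewrite ln_exp. f_equal. field. }
  rewrite E. split.
  - apply rpow_le; [exact Hs|]. split; [exact Hm|]. nra.
  - replace (rpow (Cmod W) s + 1) with (rpow (Cmod W) s + rpow 1 s) by now rewrite rpow_1.
    eapply Rle_trans; [|apply rpow_add; lra]. apply rpow_le; [exact Hs|]. split; [lra|]. nra.
Qed.

(** Three cases. In the sector with |a| and |b| comparable, the negative kernel absorbs |a|^p +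
    |b|^p. In the sector with one modulus less than half the other, the difference is at least ||a|
    - |b||. Off the sector, [off_sector] applies and the kernel is bounded by its growth. *)
Lemma pointwise_of_kernel (p s Theta alpha kap c0 : R) (m : nat) (psi : R -> R -> R) :
  1 < p -> 0 < s -> (0 < m)%nat -> INR m * s = p / 2 ->
  0 <= Theta -> INR m * Theta < alpha -> alpha <= PI / 2 ->
  sector_kernel psi c0 s alpha kap ->
  exists c A K, 0 < c /\ 0 < A /\ forall (a b : C) (phi : R), Rabs (2 * phi) <= Theta ->
  c * (rpow (Cmod a) p + rpow (Cmod b) p)
    + psi (c0 * fst ((a * b) ^ m)%C) (c0 * snd ((a * b) ^ m)%C) <=
  A * rpow (Cmod (cis (- phi) * a - cis phi * Cconj b)%C) p + K.
Proof.
  intros Hp Hs Hm Hms HT Ha1 Ha2 (Hsub & Hkap & Hker).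
  destruct (off_sector m Theta alpha Hm HT Ha1 Ha2) as (eta & K0 & Heta & HK0 & Hoff).
  (* If min(|a|, |b|) >= M/2, then |ab| >= M^2/2, and this [c] makes c (|a|^p + |b|^p) <= 2 c M^p at
     most kap |ab|^(p/2). *)
  set (c := kap * rpow (1 / 2) (p / 2) / 2).
  set (B1 := rpow 2 s).
  assert (Hh : 0 < rpow (1 / 2) (p / 2)) by (apply rpow_pos; lra).
  assert (Hh' : rpow (1 / 2) (p / 2) <= 1).
  { apply Rle_trans with (rpow 1 (p / 2)); [apply rpow_le; lra|]. rewrite rpow_1. lra. }
  assert (Hc : 0 < c) by (unfold c; nra).
  assert (HB1 : 0 < B1) by (apply rpow_pos; lra).
  assert (H2p : 0 < rpow 2 p) by (apply rpow_pos; lra).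
  set (ei := / sqrt eta).
  assert (Hei : 0 < ei) by (apply Rinv_0_lt_compat, sqrt_lt_R0; exact Heta).
  assert (Heip : 0 < rpow ei p) by now apply rpow_pos.
  set (L := rpow ei p * rpow 2 p).
  assert (HL : 0 < L) by (apply Rmult_lt_0_compat; lra).
  set (A := 2 * c * rpow 2 p + (2 * c + B1) * L).
  exists c, A, ((2 * c + B1) * L * rpow (sqrt K0) p + B1).
  assert (HA1 : 2 * c * rpow 2 p <= A) by (unfold A; nra).
  assert (HA2 : (2 * c + B1) * L <= A) by (unfold A; nra).
  assert (HA0 : 0 < A) by (unfold A; nra).
  split; [exact Hc|]. split; [exact HA0|].
  intros a b phi Hphi.
  destruct (Hker ((a * b) ^ m)%C) as [Hup Hdich].
  specialize (Hoff a b phi Hphi).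
  assert (Hlow := Cmod_twist_lower a b phi).
  set (D := Cmod (cis (- phi) * a - cis phi * Cconj b)%C) in *.
  assert (HD0 : 0 <= D) by apply Cmod_ge_0.
  set (ps := psi _ _) in *.
  destruct (exp_LL_rpow s ((a * b) ^ m)%C Hs) as [Ge Gu].
  set (G := exp _) in *.
  assert (EG : rpow (Cmod ((a * b) ^ m)%C) s = rpow (Cmod a * Cmod b) (p / 2)).
  { rewrite Cmod_pow, Cmod_mult.
    assert (H0 : 0 <= Cmod a * Cmod b) by (apply Rmult_le_pos; apply Cmod_ge_0).
    rewrite <- (rpow_pow _ m Hm) by exact H0. rewrite rpow_rpow by exact H0. f_equal. exact Hms. }
  rewrite EG in *.
  assert (Hx0 := Cmod_ge_0 a). assert (Hy0 := Cmod_ge_0 b).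
  set (x := Cmod a) in *. set (y := Cmod b) in *.
  set (M := Rmax x y).
  assert (HMx : x <= M) by apply Rmax_l. assert (HMy : y <= M) by apply Rmax_r.
  assert (HxM : rpow x p <= rpow M p) by (apply rpow_le; lra).
  assert (HyM : rpow y p <= rpow M p) by (apply rpow_le; lra).
  assert (HMM : rpow (M * M) (p / 2) = rpow M p).
  { rewrite rpow_mult by lra. destruct (Req_dec M 0) as [->|HM0].
    - rewrite !rpow_0; ring.
    - rewrite <- rpow_plus by lra. f_equal. field. }
  assert (HxyM : rpow (x * y) (p / 2) <= rpow M p).
  { rewrite <- HMM. apply rpow_le; [lra|]. split; nra. }
  assert (HDp := rpow_ge0 D p). assert (HMp := rpow_ge0 M p).
  assert (HKp := rpow_ge0 (sqrt K0) p).
  destruct Hdich as [Hneg|Hsec].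
  - assert (Hpsi : ps <= - kap * rpow (x * y) (p / 2)) by nra.
    assert (Hbig : 0 <= (2 * c + B1) * L * rpow (sqrt K0) p + B1).
    { apply Rplus_le_le_0_compat; [|lra]. repeat apply Rmult_le_pos; lra. }
    destruct (Rle_dec (M / 2) (Rmin x y)) as [Hmin|Hmin].
    + assert (Hxy : M / 2 * M <= x * y).
      { unfold M, Rmin, Rmax in *. destruct (Rle_dec x y); nra. }
      assert (H1 : rpow (1 / 2) (p / 2) * rpow M p <= rpow (x * y) (p / 2)).
      { rewrite <- HMM, <- rpow_mult by nra. apply rpow_le; [lra|]. split; nra. }
      assert (c * (rpow x p + rpow y p) <= kap * rpow (x * y) (p / 2)).
      { apply Rle_trans with (c * (2 * rpow M p)); [apply Rmult_le_compat_l; lra|].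
        unfold c. nra. }
      assert (0 <= A * rpow D p) by (apply Rmult_le_pos; lra). lra.
    + assert (HDM : M <= 2 * D).
      { assert (M / 2 <= Rabs (x - y)); [|lra].
        unfold M, Rmin, Rmax, Rabs in *.
        destruct (Rle_dec x y); destruct (Rcase_abs (x - y)); lra. }
      assert (H1 : rpow M p <= rpow 2 p * rpow D p).
      { rewrite <- rpow_mult by lra. apply rpow_le; lra. }
      assert (Hxyp := rpow_ge0 (x * y) (p / 2)).
      assert (ps <= 0) by nra.
      assert (H3 : c * (rpow x p + rpow y p) <= 2 * c * rpow 2 p * rpow D p).
      { apply Rle_trans with (c * (2 * (rpow 2 p * rpow D p))); [apply Rmult_le_compat_l; lra|].
        right; ring. }
      assert (2 * c * rpow 2 p * rpow D p <= A * rpow D p) by (apply Rmult_le_compat_r; lra). lra.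
  - assert (Hpsi : ps <= B1 * (rpow M p + 1)) by (fold B1 in Gu; nra).
    specialize (Hoff Hsec).
    assert (HM2 : eta * (M * M) <= (D + sqrt K0) * (D + sqrt K0)).
    { assert (HS := sqrt_sqrt K0 HK0). assert (HS0 := sqrt_pos K0).
      assert (eta * (M * M) <= eta * (x ^ 2 + y ^ 2)).
      { apply Rmult_le_compat_l; [lra|]. unfold M, Rmax. destruct (Rle_dec x y); nra. }
      nra. }
    assert (HMD : M <= ei * (D + sqrt K0)).
    { assert (HS0 := sqrt_pos K0).
      assert (Hse : 0 < sqrt eta) by now apply sqrt_lt_R0.
      assert (HSe := sqrt_sqrt eta (Rlt_le _ _ Heta)).
      assert (H1 : sqrt eta * M <= D + sqrt K0).
      { apply Rsqr_incr_0_var; [|lra]. unfold Rsqr. nra. }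
      apply Rmult_le_reg_l with (sqrt eta); [exact Hse|].
      unfold ei. rewrite <- Rmult_assoc, Rinv_r by lra. lra. }
    assert (H1 : rpow M p <= L * (rpow D p + rpow (sqrt K0) p)).
    { assert (HS0 := sqrt_pos K0).
      apply Rle_trans with (rpow (ei * (D + sqrt K0)) p); [apply rpow_le; lra|].
      rewrite rpow_mult by lra. unfold L. rewrite Rmult_assoc.
      apply Rmult_le_compat_l; [lra|]. apply rpow_add; lra. }
    assert (H2 : c * (rpow x p + rpow y p) + ps <= (2 * c + B1) * rpow M p + B1).
    { assert (c * (rpow x p + rpow y p) <= c * (2 * rpow M p)) by (apply Rmult_le_compat_l; lra). lra. }
    assert (H3 : (2 * c + B1) * rpow M p <= (2 * c + B1) * (L * (rpow D p + rpow (sqrt K0) p))).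
    { apply Rmult_le_compat_l; lra. }
    assert ((2 * c + B1) * L * rpow D p <= A * rpow D p) by (apply Rmult_le_compat_r; lra). lra.
Qed.

(** The integration rules with the operations of [R] in place of those of abstract modules, so that
    unification and [ring] act on them directly. *)
Lemma isR_plus (f g : R -> R) a b (If Ig : R) :
  is_RInt f a b If -> is_RInt g a b Ig -> is_RInt (fun t => f t + g t) a b (If + Ig).
Proof. exact (is_RInt_plus f g a b If Ig). Qed.

Lemma isR_scal (f : R -> R) (k : R) a b (If : R) :
  is_RInt f a b If -> is_RInt (fun t => k * f t) a b (k * If).
Proof. exact (is_RInt_scal f a b k If). Qed.

Lemma isR_const (k : R) a b : is_RInt (fun _ => k) a b ((b - a) * k).
Proof. exact (is_RInt_const a b k). Qed.

Lemma isR_correct (f : R -> R) a b : ex_RInt f a b -> is_RInt f a b (RInt f a b).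
Proof. exact (RInt_correct f a b). Qed.

Lemma isR_unique (f : R -> R) a b (l : R) : is_RInt f a b l -> RInt f a b = l.
Proof. exact (is_RInt_unique f a b l). Qed.

(** The exponent q enters here: the sector available to the kernel has half-opening pi - pi/p for p
    <= 2 and pi/p for p > 2, which is pi/q in both cases. *)
Lemma angle_pointwise (p Theta : R) : 1 < p -> 0 <= Theta < PI / Rmax p (p / (p - 1)) ->
  exists psi c0 m c A K, subharmonic psi /\ 0 < c /\ 0 < A /\
  forall (a b : C) (phi : R), Rabs (2 * phi) <= Theta ->
  c * (rpow (Cmod a) p + rpow (Cmod b) p)
    + psi (c0 * fst ((a * b) ^ m)%C) (c0 * snd ((a * b) ^ m)%C) <=
  A * rpow (Cmod (cis (- phi) * a - cis phi * Cconj b)%C) p + K.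
Proof.
  intros Hp HT. assert (HPI := PI_RGT_0).
  destruct (Rle_dec p 2) as [Hp2|Hp2].
  - assert (HT' : Theta < PI - PI / p).
    { eapply Rlt_le_trans; [apply HT|]. replace (PI - PI / p) with (PI / (p / (p - 1))) by (field; lra).
      apply Rmult_le_compat_l; [lra|]. apply Rinv_le_contravar; [|apply Rmax_r].
      apply Rdiv_lt_0_compat; lra. }
    set (alpha := (Theta + (PI - PI / p)) / 2).
    assert (HPp : PI / 2 <= PI / p) by (apply Rmult_le_compat_l; [lra|]; apply Rinv_le_contravar; lra).
    destruct (sector_kernel_small (p / 2) alpha) as [kap Hk]; try (unfold alpha; lra).
    { replace (2 * (p / 2)) with p by field. unfold alpha; lra. }
    destruct (pointwise_of_kernel p (p / 2) Theta alpha kap (-1) 1 _ Hp ltac:(lra) ltac:(lia)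
      ltac:(simpl; lra) ltac:(lra) ltac:(unfold alpha; simpl; lra) ltac:(unfold alpha; lra) Hk)
      as (c & A & K & Hc & HA & Hmain).
    exists (fun x y => 1 * Cs (p / 2) x y), (-1), 1%nat, c, A, K.
    split; [apply Hk|]. auto.
  (* With m the integer part of p/2, the exponent s = p/(2m) falls in [1, 2], where [-1 * Cs s] is
     subharmonic; the remaining power m is taken by the polynomial. *)
  - destruct (nfloor_ex (p / 2)) as [m [Hm1 Hm2]]; [lra|].
    assert (Hm : (1 <= m)%nat).
    { destruct m; [simpl in Hm2; lra|lia]. }
    assert (Hm' : 1 <= INR m) by (apply (le_INR 1); exact Hm).
    set (s := p / (2 * INR m)).
    assert (Hs1 : 1 <= s).
    { unfold s. apply Rmult_le_reg_r with (2 * INR m); [lra|].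
      replace (p / (2 * INR m) * (2 * INR m)) with p by (field; lra). lra. }
    assert (Hs2 : s <= 2).
    { unfold s. apply Rmult_le_reg_r with (2 * INR m); [lra|].
      replace (p / (2 * INR m) * (2 * INR m)) with p by (field; lra). lra. }
    assert (HT' : Theta < PI / p).
    { eapply Rlt_le_trans; [apply HT|].
      apply Rmult_le_compat_l; [lra|]. apply Rinv_le_contravar; [lra|apply Rmax_l]. }
    assert (HT2 : INR m * Theta < PI / (2 * s)).
    { replace (PI / (2 * s)) with (INR m * (PI / p)) by (unfold s; field; lra).
      apply Rmult_lt_compat_l; lra. }
    set (alpha := (INR m * Theta + PI / (2 * s)) / 2).
    assert (Has : PI / (2 * s) <= PI / 2).
    { apply Rmult_le_compat_l; [lra|]. apply Rinv_le_contravar; lra. }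
    assert (HmT : 0 <= INR m * Theta) by (apply Rmult_le_pos; lra).
    destruct (sector_kernel_large s alpha) as [kap Hk]; try (unfold alpha; lra).
    destruct (pointwise_of_kernel p s Theta alpha kap 1 m _ Hp ltac:(lra) ltac:(lia)
      ltac:(unfold s; field; lra) ltac:(lra) ltac:(unfold alpha; lra) ltac:(unfold alpha; lra) Hk)
      as (c & A & K & Hc & HA & Hmain).
    exists (fun x y => -1 * Cs s x y), 1, m, c, A, K.
    split; [apply Hk|]. auto.
Qed.

Lemma le_of_forall_scale x y K : (forall L, 0 < L -> L * x <= L * y + K) -> x <= y.
Proof.
  intro H. apply Rnot_lt_le. intro Hlt.
  assert (HK := Rabs_pos K). assert (HK1 := Rle_abs K).
  specialize (H ((Rabs K + 1) / (x - y)) ltac:(apply Rdiv_lt_0_compat; lra)).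
  assert (E : (Rabs K + 1) / (x - y) * x - (Rabs K + 1) / (x - y) * y = Rabs K + 1) by (field; lra).
  lra.
Qed.

(* Applying the inequality to multiples of (F, H) removes the additive constant. *)
Lemma sector_integral (p Theta : R) : 1 < p -> 0 <= Theta < PI / Rmax p (p / (p - 1)) ->
  exists C0, 0 < C0 /\ forall (n : nat) (F H : C -> C) (r : R) (phi U : R -> R),
  poly_le n F -> poly_le n H -> H 0%C = 0%C -> (forall t, Rabs (2 * phi t) <= Theta) ->
  ex_RInt U 0 (2 * PI) ->
  (forall t, rpow (Cmod (cis (- phi t) * F (RtoC (exp r) * cis t)
                        - cis (phi t) * Cconj (H (RtoC (exp r) * cis t)))%C) p <= U t) ->
  RInt (fun t => rpow (Cmod (F (RtoC (exp r) * cis t)%C)) p) 0 (2 * PI) +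
  RInt (fun t => rpow (Cmod (H (RtoC (exp r) * cis t)%C)) p) 0 (2 * PI) <=
  C0 * RInt U 0 (2 * PI).
Proof.
  intros Hp HT. assert (HPI := PI_RGT_0).
  destruct (angle_pointwise p Theta Hp HT) as (psi & c0 & m & c & A & K & Hsub & Hc & HA & Hpw).
  exists (A / c). split; [now apply Rdiv_lt_0_compat|].
  intros n F H r phi U HF HH H0 Hphi HU HD.
  set (fF := fun t => rpow (Cmod (F (RtoC (exp r) * cis t)%C)) p).
  set (fH := fun t => rpow (Cmod (H (RtoC (exp r) * cis t)%C)) p).
  assert (exF : ex_RInt fF 0 (2 * PI)).
  { apply ex_RInt_cont. intro t. apply poly_le_rpow_continuous with n; [lra|exact HF]. }
  assert (exH : ex_RInt fH 0 (2 * PI)).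
  { apply ex_RInt_cont. intro t. apply poly_le_rpow_continuous with n; [lra|exact HH]. }
  apply Rmult_le_reg_l with c; [exact Hc|].
  replace (c * (A / c * RInt U 0 (2 * PI))) with (A * RInt U 0 (2 * PI)) by (field; lra).
  apply (le_of_forall_scale _ _ (2 * PI * (K - psi (c0 * fst (0 ^ m)%C) (c0 * snd (0 ^ m)%C)))).
  intros L HL.
  (* Scaling both polynomials by L^(1/p) multiplies every p-th power by L. *)
  set (lam := rpow L (/ p)).
  assert (Hlam : 0 < lam) by now apply rpow_pos.
  assert (HlamL : rpow lam p = L).
  { unfold lam. rewrite rpow_rpow by lra. rewrite Rinv_l by lra. apply rpow_x1. lra. }
  set (W := fun w => (RtoC c0 * ((RtoC lam * F w) * (RtoC lam * H w)) ^ m)%C).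
  assert (HW : poly_le (m * (n + n)) W).
  { apply poly_le_scal. apply (poly_le_pow (n + n) m (fun w => (RtoC lam * F w) * (RtoC lam * H w))%C).
    apply (poly_le_mul n n (fun w => RtoC lam * F w)%C (fun w => RtoC lam * H w)%C); now apply poly_le_scal. }
  (* As [H] vanishes at the origin, the lower bound for the mean of [psi] does not depend on [lam];
     therefore the additive constant stays fixed while L grows. *)
  assert (HW0 : W 0%C = (RtoC c0 * 0 ^ m)%C).
  { unfold W. rewrite H0. f_equal. f_equal. ring. }
  assert (Efst : forall z : C, fst (RtoC c0 * z)%C = c0 * fst z) by (intro; simpl; ring).
  assert (Esnd : forall z : C, snd (RtoC c0 * z)%C = c0 * snd z) by (intro; simpl; ring).
  assert (Hsm := subharmonic_submean psi _ W r Hsub HW). rewrite HW0, Efst, Esnd in Hsm.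
  set (gW := fun t => psi (fst (W (logpolar r t))) (snd (W (logpolar r t)))) in *.
  destruct (poly_le_c2 _ W HW) as [KX KY].
  assert (Cpsi : continuous2 psi) by (destruct Hsub as (? & ? & ? & ? & ? & ? & ? & ? & ? & _); assumption).
  assert (exW : ex_RInt gW 0 (2 * PI)).
  { apply (c2_ex_RInt (fun r t => psi (fst (W (logpolar r t))) (snd (W (logpolar r t))))). now apply c2_comp. }
  set (left_ := fun t => c * L * (fF t + fH t) + gW t).
  set (right_ := fun t => A * L * U t + K).
  assert (isL : is_RInt left_ 0 (2 * PI)
    (c * L * (RInt fF 0 (2 * PI) + RInt fH 0 (2 * PI)) + RInt gW 0 (2 * PI))).
  { apply isR_plus; [|now apply isR_correct].
    apply isR_scal. apply isR_plus; now apply isR_correct. }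
  assert (isR : is_RInt right_ 0 (2 * PI) (A * L * RInt U 0 (2 * PI) + (2 * PI - 0) * K)).
  { apply isR_plus; [|apply isR_const]. apply isR_scal. now apply isR_correct. }
  assert (Hle : c * L * (RInt fF 0 (2 * PI) + RInt fH 0 (2 * PI)) + RInt gW 0 (2 * PI) <=
    A * L * RInt U 0 (2 * PI) + (2 * PI - 0) * K).
  { apply (is_RInt_le left_ right_ 0 (2 * PI)); [lra|exact isL|exact isR|].
    intros t _. unfold left_, right_.
    specialize (Hpw (RtoC lam * F (RtoC (exp r) * cis t))%C (RtoC lam * H (RtoC (exp r) * cis t))%C
      (phi t) (Hphi t)).
    rewrite !Cmod_mult, Cmod_R, Rabs_pos_eq in Hpw by lra.
    rewrite !rpow_mult, HlamL in Hpw by (try apply Cmod_ge_0; lra).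
    unfold gW. rewrite zp_eq. unfold W at 1 2. rewrite Efst, Esnd.
    fold (fF t) in Hpw. fold (fH t) in Hpw.
    assert (HDt : rpow (Cmod (cis (- phi t) * (RtoC lam * F (RtoC (exp r) * cis t))
        - cis (phi t) * Cconj (RtoC lam * H (RtoC (exp r) * cis t)))%C) p <= L * U t).
    { replace (cis (- phi t) * (RtoC lam * F (RtoC (exp r) * cis t))
        - cis (phi t) * Cconj (RtoC lam * H (RtoC (exp r) * cis t)))%C with
        (RtoC lam * (cis (- phi t) * F (RtoC (exp r) * cis t)
        - cis (phi t) * Cconj (H (RtoC (exp r) * cis t))))%C.
      2:{ rewrite Cmult_conj. replace (Cconj (RtoC lam)) with (RtoC lam) by (apply C_eq; simpl; ring). ring. }
      rewrite Cmod_mult, Cmod_R, Rabs_pos_eq by lra.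
      rewrite rpow_mult, HlamL by (try apply Cmod_ge_0; lra).
      apply Rmult_le_compat_l; [lra|apply HD]. }
    assert (A * rpow (Cmod (cis (- phi t) * (RtoC lam * F (RtoC (exp r) * cis t))
        - cis (phi t) * Cconj (RtoC lam * H (RtoC (exp r) * cis t)))%C) p <= A * (L * U t)).
    { apply Rmult_le_compat_l; lra. }
    lra. }
  lra.
Qed.

(** The radii are given by their logarithms. The factor 2^p is the price of comparing |F|^p with the
    smooth [Ep]; the additive constant of that comparison disappears by scaling [F]. *)
Lemma rpow_mean_mono (p : R) (n : nat) (F : C -> C) (r1 r2 : R) : 0 < p -> poly_le n F -> r1 <= r2 ->
  RInt (fun t => rpow (Cmod (F (RtoC (exp r1) * cis t)%C)) p) 0 (2 * PI) <=
  rpow 2 p * RInt (fun t => rpow (Cmod (F (RtoC (exp r2) * cis t)%C)) p) 0 (2 * PI).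
Proof.
  intros Hp HF H12. assert (HPI := PI_RGT_0).
  set (f1 := fun t => rpow (Cmod (F (RtoC (exp r1) * cis t)%C)) p).
  set (f2 := fun t => rpow (Cmod (F (RtoC (exp r2) * cis t)%C)) p).
  assert (ex1 : ex_RInt f1 0 (2 * PI)).
  { apply ex_RInt_cont. intro t. apply poly_le_rpow_continuous with n; [lra|exact HF]. }
  assert (ex2 : ex_RInt f2 0 (2 * PI)).
  { apply ex_RInt_cont. intro t. apply poly_le_rpow_continuous with n; [lra|exact HF]. }
  apply (le_of_forall_scale _ _ (rpow 2 p * (2 * PI))). intros L HL.
  set (lam := rpow L (/ p)).
  assert (Hlam : 0 < lam) by now apply rpow_pos.
  assert (HlamL : rpow lam p = L).
  { unfold lam. rewrite rpow_rpow by lra. rewrite Rinv_l by lra. apply rpow_x1. lra. }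
  set (W := fun w => (RtoC lam * F w)%C).
  assert (HW : poly_le n W) by now apply poly_le_scal.
  assert (Hm := subharmonic_mean_mono (Ep p) n W (Ep_subharmonic p ltac:(lra)) HW r1 r2 H12).
  destruct (poly_le_c2 _ W HW) as [KX KY].
  assert (exE : forall r, ex_RInt (fun t => Ep p (fst (W (logpolar r t))) (snd (W (logpolar r t)))) 0 (2 * PI)).
  { intro r. apply (c2_ex_RInt (fun r t => Ep p (fst (W (logpolar r t))) (snd (W (logpolar r t))))).
    apply c2_comp; [apply c2_Ep|assumption|assumption]. }
  assert (EW : forall r t, rpow (Cmod (W (logpolar r t))) p = L * rpow (Cmod (F (RtoC (exp r) * cis t)%C)) p).
  { intros r t. unfold W. rewrite Cmod_mult, Cmod_R, Rabs_pos_eq by lra.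
    rewrite rpow_mult, HlamL by (try apply Cmod_ge_0; lra). now rewrite zp_eq. }
  assert (H1 : L * RInt f1 0 (2 * PI) <=
    RInt (fun t => Ep p (fst (W (logpolar r1 t))) (snd (W (logpolar r1 t)))) 0 (2 * PI)).
  { apply (is_RInt_le (fun t => L * f1 t) (fun t => Ep p (fst (W (logpolar r1 t))) (snd (W (logpolar r1 t)))) 0 (2 * PI)).
    - lra.
    - apply isR_scal. now apply isR_correct.
    - now apply isR_correct.
    - intros t _. unfold f1. rewrite <- EW. apply exp_LL_rpow. exact Hp. }
  assert (H2 : RInt (fun t => Ep p (fst (W (logpolar r2 t))) (snd (W (logpolar r2 t)))) 0 (2 * PI) <=
    rpow 2 p * (L * RInt f2 0 (2 * PI) + (2 * PI - 0) * 1)).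
  { apply (is_RInt_le (fun t => Ep p (fst (W (logpolar r2 t))) (snd (W (logpolar r2 t))))
      (fun t => rpow 2 p * (L * f2 t + 1)) 0 (2 * PI)).
    - lra.
    - now apply isR_correct.
    - apply isR_scal. apply isR_plus; [apply isR_scal; now apply isR_correct|apply isR_const].
    - intros t _. unfold f2. rewrite <- EW. apply exp_LL_rpow. exact Hp. }
  lra.
Qed.

(** * The Poisson kernel *)

Definition poisson (r x : R) : R := (1 - r * r) / (1 - 2 * r * cos x + r * r).

Lemma poisson_den r x : 1 - 2 * r * cos x + r * r = Cmod (1 - RtoC r * cis x)%C ^ 2.
Proof.
  rewrite Cmod2_alt. unfold Re, Im. simpl. generalize (sin2_cos2 x). unfold Rsqr. intro H.
  replace (r * r) with (r * r * (sin x * sin x + cos x * cos x)) at 1 by (rewrite H; ring). ring.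
Qed.

Lemma Cmod_one_minus r x : 0 <= r < 1 -> 1 - r <= Cmod (1 - RtoC r * cis x)%C <= 1 + r.
Proof.
  intro Hr. assert (E : Cmod (RtoC r * cis x)%C = r).
  { rewrite Cmod_mult, cis_mod, Cmod_R, Rabs_pos_eq by lra. ring. }
  split.
  - generalize (Cmod_triangle (1 - RtoC r * cis x)%C (RtoC r * cis x)%C).
    replace (1 - RtoC r * cis x + RtoC r * cis x)%C with (RtoC 1) by ring.
    rewrite Cmod_1, E. lra.
  - generalize (Cmod_triangle 1 (- (RtoC r * cis x))%C). rewrite Cmod_opp, E, Cmod_1.
    unfold Cminus. lra.
Qed.

Lemma poisson_den_pos r x : 0 <= r < 1 -> 0 < 1 - 2 * r * cos x + r * r.
Proof.
  intro Hr. rewrite poisson_den. apply pow_lt. generalize (Cmod_one_minus r x Hr). lra.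
Qed.

Lemma poisson_pos r x : 0 <= r < 1 -> 0 < poisson r x.
Proof. intro Hr. apply Rdiv_lt_0_compat; [nra|now apply poisson_den_pos]. Qed.

Lemma poisson_le r x : 0 <= r < 1 -> poisson r x <= (1 + r) / (1 - r).
Proof.
  intro Hr. assert (HD := poisson_den_pos r x Hr). unfold poisson.
  replace ((1 + r) / (1 - r)) with ((1 - r * r) / ((1 - r) * (1 - r))) by (field; lra).
  apply Rmult_le_compat_l; [nra|]. apply Rinv_le_contravar; [nra|].
  generalize (COS_bound x). nra.
Qed.

Lemma cis_minus_1_le u : Cmod (cis u - 1)%C <= Rabs u.
Proof.
  apply Rsqr_incr_0_var; [|apply Rabs_pos]. unfold Rsqr.
  rewrite <- Rabs_mult, (Rabs_pos_eq (u * u)) by nra. rewrite Cmod_sqr. simpl.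
  assert (Hs : sin (u / 2) * sin (u / 2) <= u / 2 * (u / 2)).
  { assert (Rabs (sin (u / 2)) <= Rabs (u / 2)).
    { assert (Hpos : forall v, 0 <= v -> Rabs (sin v) <= v).
      { intros v [Hv| <-]; [|rewrite sin_0, Rabs_R0; lra].
        destruct (Rle_dec v 1) as [H1|H1].
        - rewrite Rabs_pos_eq. left; now apply sin_lt_x. apply sin_ge_0; [lra|].
          generalize PI2_1. lra.
        - assert (Rabs (sin v) <= 1) by (apply Rabs_le, SIN_bound). lra. }
      destruct (Rle_dec 0 (u / 2)) as [H|H].
      - rewrite (Rabs_pos_eq (u / 2)) by exact H. now apply Hpos.
      - rewrite <- (Rabs_Ropp (sin (u / 2))), <- sin_neg.
        rewrite <- (Rabs_Ropp (u / 2)), (Rabs_pos_eq (- (u / 2))) by lra. apply Hpos. lra. }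
    assert (0 <= Rabs (sin (u / 2))) by apply Rabs_pos.
    replace (sin (u / 2) * sin (u / 2)) with (Rabs (sin (u / 2)) * Rabs (sin (u / 2))).
    2:{ rewrite <- Rabs_mult. apply Rabs_pos_eq. nra. }
    replace (u / 2 * (u / 2)) with (Rabs (u / 2) * Rabs (u / 2)).
    2:{ rewrite <- Rabs_mult. apply Rabs_pos_eq. nra. }
    nra. }
  replace u with (2 * (u / 2)) at 1 2 3 4 by field.
  rewrite cos_2a, sin_2a. generalize (sin2_cos2 (u / 2)). unfold Rsqr.
  set (s := sin (u / 2)) in *. set (c := cos (u / 2)). intro H.
  replace (c * c - s * s + - (1)) with (- 2 * (s * s)) by lra.
  replace (2 * s * c + - 0) with (2 * s * c) by ring.
  assert (H2 : - 2 * (s * s) * (- 2 * (s * s)) + 2 * s * c * (2 * s * c) = 4 * (s * s) * (s * s + c * c)) by ring.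
  rewrite H2, H. nra.
Qed.

(** A shift by u changes |1 - r e^(ix)| by at most r a, and that modulus is at least 1 - r; so the
    kernel changes by a bounded factor under shifts of order 1 - r. *)
Lemma poisson_slow r x u a : 0 < r < 1 -> Rabs u <= a ->
  poisson r (x + u) <= (1 + r * a / (1 - r)) ^ 2 * poisson r x.
Proof.
  intros Hr Hu. assert (Ha : 0 <= a) by (eapply Rle_trans; [apply Rabs_pos|exact Hu]).
  assert (Hr' : 0 <= r < 1) by lra.
  assert (H1 := Cmod_one_minus r x Hr'). assert (H2 := Cmod_one_minus r (x + u) Hr').
  unfold poisson. rewrite !poisson_den.
  set (m1 := Cmod (1 - RtoC r * cis x)%C) in *. set (m2 := Cmod (1 - RtoC r * cis (x + u))%C) in *.
  assert (H3 : m1 <= m2 * (1 + r * a / (1 - r))).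
  { assert (H4 : m1 <= m2 + r * a).
    { unfold m1. replace (1 - RtoC r * cis x)%C with
        ((1 - RtoC r * cis (x + u)) + RtoC r * (cis x * (cis u - 1)))%C by (rewrite cis_add; ring).
      eapply Rle_trans; [apply Cmod_triangle|]. apply Rplus_le_compat_l.
      rewrite !Cmod_mult, cis_mod, Cmod_R, Rabs_pos_eq by lra.
      generalize (cis_minus_1_le u). nra. }
    assert (0 <= r * a / (1 - r)).
    { apply Rmult_le_pos; [nra|]. left. apply Rinv_0_lt_compat. lra. }
    assert (r * a = (1 - r) * (r * a / (1 - r))) by (field; lra). nra. }
  apply Rmult_le_reg_r with (m2 ^ 2 * m1 ^ 2); [apply Rmult_lt_0_compat; apply pow_lt; lra|].
  replace ((1 - r * r) / m2 ^ 2 * (m2 ^ 2 * m1 ^ 2)) with ((1 - r * r) * m1 ^ 2) by (field; lra).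
  replace ((1 + r * a / (1 - r)) ^ 2 * ((1 - r * r) / m1 ^ 2) * (m2 ^ 2 * m1 ^ 2)) with
    ((1 - r * r) * (m2 * (1 + r * a / (1 - r))) ^ 2) by (field; lra).
  apply Rmult_le_compat_l; [nra|]. apply pow_incr. lra.
Qed.

Lemma poisson_continuous r t0 t : 0 <= r < 1 -> continuous (fun t => poisson r (t - t0)) t.
Proof.
  intro Hr. unfold poisson. apply continuity_pt_filterlim.
  assert (HD := poisson_den_pos r (t - t0) Hr).
  apply continuity_pt_div; [apply continuity_pt_const; intros ? ?; reflexivity| |lra].
  apply derivable_continuous_pt. reg.
Qed.

(** The characteristic roots of the recurrence are r and 1/r; boundedness excludes the growing
    solution. The quantity [d] isolates the component along 1/r. *)
Lemma bounded_rec_geometric (r M : R) (X : nat -> R) : 0 < r < 1 ->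
  (forall k, (1 + r * r) * X (S k) = r * (X (S (S k)) + X k)) ->
  (forall k, Rabs (X k) <= M) -> forall k, X k = r ^ k * X O.
Proof.
  intros Hr Hrec HM.
  set (d := fun k => X (S k) - r * X k).
  assert (Hd : forall k, r * d (S k) = d k).
  { intro k. unfold d. specialize (Hrec k). lra. }
  assert (Hdk : forall k, d O = r ^ k * d k).
  { induction k; simpl; [ring|]. rewrite IHk, <- Hd. ring. }
  assert (Hd0 : d O = 0).
  { destruct (Req_dec (d O) 0) as [H|H]; [exact H|exfalso].
    assert (HM0 : 0 <= M) by (eapply Rle_trans; [apply Rabs_pos|apply (HM O)]).
    destruct (pow_lt_1_zero r ltac:(rewrite Rabs_pos_eq; lra) (Rabs (d O) / (2 * M + 1))) as [k Hk].
    { apply Rdiv_lt_0_compat; [now apply Rabs_pos_lt|lra]. }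
    specialize (Hk k (le_n _)). rewrite Rabs_pos_eq in Hk by (apply pow_le; lra).
    assert (Hb : Rabs (d k) <= 2 * M).
    { unfold d, Rminus. eapply Rle_trans; [apply Rabs_triang|].
      rewrite Rabs_Ropp, Rabs_mult, (Rabs_pos_eq r) by lra.
      generalize (HM (S k)) (HM k) (Rabs_pos (X k)). nra. }
    assert (Hz : Rabs (d O) = r ^ k * Rabs (d k)).
    { rewrite (Hdk k), Rabs_mult, (Rabs_pos_eq (r ^ k)); [reflexivity|apply pow_le; lra]. }
    assert (Hp : 0 <= r ^ k) by (apply pow_le; lra).
    assert (r ^ k * (2 * M + 1) < Rabs (d O)).
    { apply Rmult_lt_reg_r with (/ (2 * M + 1)); [apply Rinv_0_lt_compat; lra|].
      replace (r ^ k * (2 * M + 1) * / (2 * M + 1)) with (r ^ k) by (field; lra). exact Hk. }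
    nra. }
  induction k; simpl; [ring|].
  assert (Hk : d k = 0).
  { assert (Hp : r ^ k <> 0) by (apply pow_nonzero; lra).
    apply Rmult_eq_reg_l with (r ^ k); [|exact Hp]. rewrite <- Hdk, Hd0. ring. }
  unfold d in Hk. rewrite IHk in Hk. lra.
Qed.

Lemma int_cos_k (k : nat) t0 : (0 < k)%nat ->
  is_RInt (fun t => cos (INR k * (t - t0))) 0 (2 * PI) 0.
Proof.
  intro Hk. assert (HK : 0 < INR k) by (apply lt_0_INR; lia).
  replace 0 with (minus (sin (INR k * (2 * PI - t0)) / INR k) (sin (INR k * (0 - t0)) / INR k)) at 2.
  - apply (is_RInt_derive (fun t => sin (INR k * (t - t0)) / INR k)).
    + intros x _. auto_derive; [lra|]. unfold Rminus. field. lra.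
    + intros x _. apply continuity_pt_filterlim. apply derivable_continuous_pt. reg.
  - replace (INR k * (2 * PI - t0)) with (INR k * (0 - t0) + 2 * INR k * PI) by ring.
    rewrite sin_period. unfold minus, plus, opp; simpl. ring.
Qed.

Lemma int_sin_k (k : nat) t0 : (0 < k)%nat ->
  is_RInt (fun t => sin (INR k * (t - t0))) 0 (2 * PI) 0.
Proof.
  intro Hk. assert (HK : 0 < INR k) by (apply lt_0_INR; lia).
  replace 0 with (minus (- cos (INR k * (2 * PI - t0)) / INR k) (- cos (INR k * (0 - t0)) / INR k)) at 2.
  - apply (is_RInt_derive (fun t => - cos (INR k * (t - t0)) / INR k)).
    + intros x _. auto_derive; [lra|]. unfold Rminus. field. lra.
    + intros x _. apply continuity_pt_filterlim. apply derivable_continuous_pt. reg.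
  - replace (INR k * (2 * PI - t0)) with (INR k * (0 - t0) + 2 * INR k * PI) by ring.
    rewrite cos_period. unfold minus, plus, opp; simpl. ring.
Qed.

Lemma contR_mult (f g : R -> R) t : continuous f t -> continuous g t ->
  continuous (fun t => f t * g t) t.
Proof. exact (continuous_mult f g t). Qed.

Lemma poisson_cos_sin_continuous r k t0 t : 0 <= r < 1 ->
  continuous (fun t => poisson r (t - t0) * cos (INR k * (t - t0))) t /\
  continuous (fun t => poisson r (t - t0) * sin (INR k * (t - t0))) t.
Proof.
  intro Hr.
  assert (Hlin : is_derive (fun t => INR k * (t - t0)) t (INR k)) by (auto_derive; [easy|ring]).
  assert (Hc : continuous (fun t => INR k * (t - t0)) t).
  { apply (ex_derive_continuous (fun t => INR k * (t - t0))). now exists (INR k). }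
  split; apply contR_mult; try exact (poisson_continuous r t0 t Hr).
  - apply (continuous_comp (fun t => INR k * (t - t0)) cos); [exact Hc|apply continuous_cos].
  - apply (continuous_comp (fun t => INR k * (t - t0)) sin); [exact Hc|apply continuous_sin].
Qed.

(** Multiplying the kernel by its denominator leaves the constant 1 - r^2, which turns into a
    recurrence between consecutive moments. The moments are bounded, hence geometric, and no series
    has to be integrated term by term. *)
Lemma poisson_moments r t0 : 0 < r < 1 -> forall k,
  is_RInt (fun t => poisson r (t - t0) * cos (INR k * (t - t0))) 0 (2 * PI) (2 * PI * r ^ k) /\
  is_RInt (fun t => poisson r (t - t0) * sin (INR k * (t - t0))) 0 (2 * PI) 0.
Proof.
  intros Hr. assert (HPI := PI_RGT_0). assert (Hr' : 0 <= r < 1) by lra.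
  set (f := fun k t => poisson r (t - t0) * cos (INR k * (t - t0))).
  set (g := fun k t => poisson r (t - t0) * sin (INR k * (t - t0))).
  set (X := fun k => RInt (f k) 0 (2 * PI)). set (Y := fun k => RInt (g k) 0 (2 * PI)).
  assert (isX : forall k, is_RInt (f k) 0 (2 * PI) (X k)).
  { intro k. apply isR_correct, ex_RInt_cont. intro t. exact (proj1 (poisson_cos_sin_continuous r k t0 t Hr')). }
  assert (isY : forall k, is_RInt (g k) 0 (2 * PI) (Y k)).
  { intro k. apply isR_correct, ex_RInt_cont. intro t. exact (proj2 (poisson_cos_sin_continuous r k t0 t Hr')). }
  assert (HPo : forall t, poisson r (t - t0) * (1 + r * r) - 2 * r * (poisson r (t - t0) * cos (t - t0)) = 1 - r * r).
  { intro t. unfold poisson. assert (H := poisson_den_pos r (t - t0) Hr'). field. lra. }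
  assert (recX : forall k, (1 + r * r) * X (S k) = r * (X (S (S k)) + X k)).
  { intro k.
    assert (H1 : is_RInt (fun t => (1 + r * r) * f (S k) t + - r * (f (S (S k)) t + f k t)) 0 (2 * PI)
      ((1 + r * r) * X (S k) + - r * (X (S (S k)) + X k))).
    { apply isR_plus; apply isR_scal; [apply isX|apply isR_plus; apply isX]. }
    assert (H2 : is_RInt (fun t => (1 - r * r) * cos (INR (S k) * (t - t0))) 0 (2 * PI) ((1 - r * r) * 0)).
    { apply isR_scal. apply int_cos_k. lia. }
    apply isR_unique in H1. apply isR_unique in H2.
    enough (E : RInt (fun t => (1 + r * r) * f (S k) t + - r * (f (S (S k)) t + f k t)) 0 (2 * PI) =
      RInt (fun t => (1 - r * r) * cos (INR (S k) * (t - t0))) 0 (2 * PI)) by lra.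
    apply RInt_ext. intros t _. unfold f. rewrite <- (HPo t).
    rewrite !S_INR. 
    replace ((INR k + 1 + 1) * (t - t0)) with ((INR k + 1) * (t - t0) + (t - t0)) by ring.
    replace (INR k * (t - t0)) with ((INR k + 1) * (t - t0) - (t - t0)) by ring.
    rewrite (cos_plus ((INR k + 1) * (t - t0))), (cos_minus ((INR k + 1) * (t - t0))). match goal with |- ?x = ?y => change (@eq R x y) end. ring. }
  assert (recY : forall k, (1 + r * r) * Y (S k) = r * (Y (S (S k)) + Y k)).
  { intro k.
    assert (H1 : is_RInt (fun t => (1 + r * r) * g (S k) t + - r * (g (S (S k)) t + g k t)) 0 (2 * PI)
      ((1 + r * r) * Y (S k) + - r * (Y (S (S k)) + Y k))).
    { apply isR_plus; apply isR_scal; [apply isY|apply isR_plus; apply isY]. }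
    assert (H2 : is_RInt (fun t => (1 - r * r) * sin (INR (S k) * (t - t0))) 0 (2 * PI) ((1 - r * r) * 0)).
    { apply isR_scal. apply int_sin_k. lia. }
    apply isR_unique in H1. apply isR_unique in H2.
    enough (E : RInt (fun t => (1 + r * r) * g (S k) t + - r * (g (S (S k)) t + g k t)) 0 (2 * PI) =
      RInt (fun t => (1 - r * r) * sin (INR (S k) * (t - t0))) 0 (2 * PI)) by lra.
    apply RInt_ext. intros t _. unfold g. rewrite <- (HPo t).
    rewrite !S_INR. 
    replace ((INR k + 1 + 1) * (t - t0)) with ((INR k + 1) * (t - t0) + (t - t0)) by ring.
    replace (INR k * (t - t0)) with ((INR k + 1) * (t - t0) - (t - t0)) by ring.
    rewrite (sin_plus ((INR k + 1) * (t - t0))), (sin_minus ((INR k + 1) * (t - t0))). match goal with |- ?x = ?y => change (@eq R x y) end. ring. }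
  set (M := (2 * PI - 0) * ((1 + r) / (1 - r))).
  assert (HX : forall k, Rabs (X k) <= M).
  { intro k. apply abs_RInt_le_const; [lra|eexists; apply isX|].
    intros t _. unfold f. rewrite Rabs_mult, (Rabs_pos_eq (poisson _ _)) by (left; now apply poisson_pos).
    assert (Rabs (cos (INR k * (t - t0))) <= 1) by (apply Rabs_le, COS_bound).
    generalize (poisson_le r (t - t0) Hr') (poisson_pos r (t - t0) Hr'). nra. }
  assert (HY : forall k, Rabs (Y k) <= M).
  { intro k. apply abs_RInt_le_const; [lra|eexists; apply isY|].
    intros t _. unfold g. rewrite Rabs_mult, (Rabs_pos_eq (poisson _ _)) by (left; now apply poisson_pos).
    assert (Rabs (sin (INR k * (t - t0))) <= 1) by (apply Rabs_le, SIN_bound).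
    generalize (poisson_le r (t - t0) Hr') (poisson_pos r (t - t0) Hr'). nra. }
  assert (GX := bounded_rec_geometric r M X Hr recX HX).
  assert (GY := bounded_rec_geometric r M Y Hr recY HY).
  assert (Y0 : Y O = 0).
  { apply isR_unique. apply (is_RInt_ext (fun _ => 0)).
    - intros t _. unfold g. simpl. rewrite Rmult_0_l, sin_0.
      match goal with |- ?x = ?y => change (@eq R x y) end. ring.
    - evar_last; [apply isR_const|ring]. }
  assert (X0 : X O = 2 * PI).
  { assert (H1 : is_RInt (fun t => (1 + r * r) * f O t + - (2 * r) * f 1%nat t) 0 (2 * PI)
      ((1 + r * r) * X O + - (2 * r) * X 1%nat)).
    { apply isR_plus; apply isR_scal; apply isX. }
    apply isR_unique in H1.
    assert (H2 : RInt (fun t => (1 + r * r) * f O t + - (2 * r) * f 1%nat t) 0 (2 * PI) =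
      (2 * PI - 0) * (1 - r * r)).
    { rewrite <- (isR_unique (fun _ => 1 - r * r) 0 (2 * PI) _ (isR_const _ _ _)).
      apply RInt_ext. intros t _. unfold f. simpl. rewrite Rmult_0_l, cos_0, Rmult_1_l.
      rewrite <- (HPo t). match goal with |- ?x = ?y => change (@eq R x y) end. ring. }
    rewrite H1, (GX 1%nat) in H2. simpl in H2.
    apply Rmult_eq_reg_r with (1 - r * r); [|nra]. lra. }
  intro k. split.
  - assert (E : X k = 2 * PI * r ^ k) by (rewrite GX, X0; apply Rmult_comm).
    rewrite <- E. exact (isX k).
  - assert (E : Y k = 0) by (rewrite GY, Y0; apply Rmult_0_r).
    generalize (isY k). rewrite E. exact (fun h => h).
Qed.

(** By linearity from the moments, one monomial at a time. The real part is enough: in the uses [F]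
    is first multiplied by a unimodular constant that makes the wanted quantity real or nearly
    so. *)
Lemma Poisson_formula r rho t0 (n : nat) F : 0 < r < 1 -> poly_le n F ->
  is_RInt (fun t => poisson r (t - t0) * fst (F (RtoC rho * cis t)%C)) 0 (2 * PI)
    (2 * PI * fst (F (RtoC (rho * r) * cis t0)%C)).
Proof.
  intros Hr HF. destruct (Peval_of_pd n F HF) as [a Ha].
  apply (is_RInt_ext (fun t => poisson r (t - t0) * fst (Peval a n (RtoC rho * cis t)%C))).
  { intros t _. now rewrite Ha. }
  rewrite Ha. clear F HF Ha.
  assert (Hmono : forall c k, is_RInt (fun t => poisson r (t - t0) * fst (c * (RtoC rho * cis t) ^ k)%C) 0 (2 * PI)
    (2 * PI * fst (c * (RtoC (rho * r) * cis t0) ^ k)%C)).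
  { intros c k. set (d := (c * (RtoC (rho ^ k) * cis (INR k * t0)))%C).
    destruct (poisson_moments r t0 Hr k) as [H1 H2].
    assert (H3 := isR_plus _ _ _ _ _ _ (isR_scal _ (fst d) _ _ _ H1) (isR_scal _ (- snd d) _ _ _ H2)).
    evar_last.
    - eapply is_RInt_ext; [|exact H3]. intros t _. cbv beta.
      assert (E : (c * (RtoC rho * cis t) ^ k)%C = (d * cis (INR k * (t - t0)))%C).
      { rewrite Cpow_mult_l, cis_pow, <- RtoC_pow. unfold d.
        replace (INR k * t) with (INR k * t0 + INR k * (t - t0)) by ring. rewrite cis_add. ring. }
      rewrite E. simpl. ring.
    - assert (E : (c * (RtoC (rho * r) * cis t0) ^ k)%C = (RtoC (r ^ k) * d)%C).
      { rewrite Cpow_mult_l, cis_pow, <- RtoC_pow, Rpow_mult_distr, RtoC_mult. unfold d. ring. }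
      rewrite E. simpl. ring. }
  assert (Hp : forall z k, Defs.Cpow z k = (z ^ k)%C)
    by (induction k as [|k IHk]; [reflexivity | simpl; rewrite IHk; reflexivity]).
  induction n as [|n IH].
  - generalize (Hmono (a O) O). apply is_RInt_ext. reflexivity.
  - assert (H := isR_plus _ _ _ _ _ _ IH (Hmono (a (S n)) (S n))).
    evar_last.
    + eapply is_RInt_ext; [|exact H]. intros t _. cbv beta. rewrite <- Hp.
      change (Peval a (S n) (RtoC rho * cis t)%C) with
        (Peval a n (RtoC rho * cis t) + a (S n) * Defs.Cpow (RtoC rho * cis t) (S n))%C.
      rewrite <- Rmult_plus_distr_l. reflexivity.
    + rewrite <- Hp, <- Rmult_plus_distr_l. reflexivity.
Qed.

(** * Sums and products over the nodes *)

Fixpoint csum (f : nat -> C) (n : nat) : C :=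
  match n with O => f O | S m => (csum f m + f (S m))%C end.
Fixpoint cprod (f : nat -> C) (n : nat) : C :=
  match n with O => f O | S m => (cprod f m * f (S m))%C end.

Lemma csum_ext f g n : (forall j, (j <= n)%nat -> f j = g j) -> csum f n = csum g n.
Proof.
  induction n as [|n IH]; simpl; intro H; [now apply H|].
  rewrite IH, H by (intros; auto). reflexivity.
Qed.

Lemma csum_plus f g n : csum (fun j => f j + g j)%C n = (csum f n + csum g n)%C.
Proof. induction n; simpl; [reflexivity|]. rewrite IHn. ring. Qed.

Lemma csum_scal c f n : csum (fun j => c * f j)%C n = (c * csum f n)%C.
Proof. induction n; simpl; [reflexivity|]. rewrite IHn. ring. Qed.

Lemma csum_const c n : csum (fun _ => c) n = (RtoC (INR (S n)) * c)%C.
Proof.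
  induction n as [|n IH].
  - simpl. ring.
  - change (csum (fun _ => c) (S n)) with (csum (fun _ => c) n + c)%C. rewrite IH.
    rewrite (S_INR (S n)), RtoC_plus. ring.
Qed.

Lemma csum_swap f n m :
  csum (fun j => csum (fun k => f j k) m) n = csum (fun k => csum (fun j => f j k) n) m.
Proof.
  induction n as [|n IH]; simpl; [reflexivity|]. rewrite IH, <- csum_plus. reflexivity.
Qed.

Lemma fst_csum f n : fst (csum f n) = sum_f_R0 (fun j => fst (f j)) n.
Proof. induction n; simpl; [reflexivity|]. now rewrite IHn. Qed.

Lemma csum_triangle f n : Cmod (csum f n) <= sum_f_R0 (fun j => Cmod (f j)) n.
Proof.
  induction n as [|n IH]; simpl; [lra|]. eapply Rle_trans; [apply Cmod_triangle|]. lra.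
Qed.

Lemma csum_geom u n : ((1 - u) * csum (fun k => u ^ k)%C n = 1 - u ^ S n)%C.
Proof.
  induction n as [|n IH].
  - simpl. ring.
  - change (csum (fun k => u ^ k)%C (S n)) with (csum (fun k => u ^ k)%C n + u ^ S n)%C.
    rewrite Cmult_plus_distr_l, IH. rewrite (Cpow_S u (S n)). ring.
Qed.

Definition tau (n j : nat) : R := 2 * PI * INR j / INR (S n).

Lemma SINR_pos n : 0 < INR (S n).
Proof. apply lt_0_INR; lia. Qed.

Lemma pow_Sn_bound r n : 0 <= r < 1 -> 0 <= r ^ S n < 1.
Proof.
  intro Hr. split; [apply pow_le; lra|]. simpl.
  assert (r ^ n <= 1) by (rewrite <- (pow1 n); apply pow_incr; lra).
  assert (0 <= r ^ n) by (apply pow_le; lra). nra.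
Qed.

Lemma cis_neq_1 x : 0 < x < 2 * PI -> cis x <> 1%C.
Proof.
  intros Hx E. assert (Hc : cos x = 1) by (apply (f_equal fst) in E; exact E).
  replace x with (2 * (x / 2)) in Hc by field. rewrite cos_2a_sin in Hc.
  assert (0 < sin (x / 2)) by (apply sin_gt_0; lra). nra.
Qed.

Lemma cis_opp_2kPI (k : nat) : cis (- (2 * INR k * PI)) = 1%C.
Proof.
  rewrite <- cis_conj. replace (2 * INR k * PI) with (0 + 2 * INR k * PI) by ring.
  rewrite cis_period, cis_conj, Ropp_0. apply cis_0.
Qed.

Lemma roots_power_sum n k : (0 < k <= n)%nat ->
  csum (fun j => cis (- tau n j) ^ k)%C n = 0%C.
Proof.
  intro Hk. assert (HN := SINR_pos n). assert (HPI := PI_RGT_0).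
  set (u := cis (- (2 * PI * INR k / INR (S n)))).
  rewrite (csum_ext _ (fun j => u ^ j)%C).
  2:{ intros j _. unfold u. rewrite !cis_pow. f_equal. unfold tau. field. lra. }
  assert (Hu : (1 - u)%C <> 0%C).
  { intro E. assert (Eu : u = 1%C) by (replace u with (1 - (1 - u))%C by ring; rewrite E; ring).
    apply (cis_neq_1 (2 * PI * INR k / INR (S n))).
    - assert (0 < INR k) by (apply lt_0_INR; lia).
      assert (INR k < INR (S n)) by (apply lt_INR; lia).
      split; [apply Rdiv_lt_0_compat; nra|].
      apply Rmult_lt_reg_r with (INR (S n)); [lra|].
      replace (2 * PI * INR k / INR (S n) * INR (S n)) with (2 * PI * INR k) by (field; lra). nra.
    - replace (cis (2 * PI * INR k / INR (S n))) with
        (cis (2 * PI * INR k / INR (S n)) * u)%C by (rewrite Eu; ring).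
      unfold u. rewrite <- cis_add, Rplus_opp_r. apply cis_0. }
  assert (HG := csum_geom u n).
  assert (Hu1 : (u ^ S n)%C = 1%C).
  { unfold u. rewrite cis_pow.
    replace (INR (S n) * - (2 * PI * INR k / INR (S n))) with (- (2 * INR k * PI)) by (field; lra).
    apply cis_opp_2kPI. }
  rewrite Hu1 in HG.
  destruct (Ceq_dec (csum (fun k => u ^ k)%C n) 0) as [H0|H0]; [exact H0|].
  exfalso. apply (Cmult_neq_0 _ _ Hu H0). rewrite HG. ring.
Qed.

Lemma one_minus_neq_0 (w : C) : Cmod w < 1 -> (1 - w)%C <> 0%C.
Proof.
  intros H E. replace w with (1 - (1 - w))%C in H by ring. rewrite E in H.
  replace (1 - 0)%C with (RtoC 1) in H by ring. rewrite Cmod_1 in H. lra.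
Qed.

(** Since (w conj omega)^N = w^N, each term is a finite geometric sum over the common denominator 1
    - w^N; summation over the roots leaves only the power k = 0. *)
Lemma roots_resolvent_sum n w : Cmod w < 1 ->
  csum (fun j => / (1 - w * cis (- tau n j)))%C n = (RtoC (INR (S n)) / (1 - w ^ S n))%C.
Proof.
  intro Hw. assert (HN := SINR_pos n).
  assert (HwN : (1 - w ^ S n)%C <> 0%C).
  { apply one_minus_neq_0. rewrite Cmod_pow. apply pow_Sn_bound.
    generalize (Cmod_ge_0 w). lra. }
  rewrite (csum_ext _ (fun j => / (1 - w ^ S n) * csum (fun k => w ^ k * cis (- tau n j) ^ k) n)%C).
  2:{ intros j _.
      assert (Hu : Cmod (w * cis (- tau n j)) < 1) by (rewrite Cmod_mult, cis_mod; lra).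
      assert (HG := csum_geom (w * cis (- tau n j)) n).
      assert (Eu : ((w * cis (- tau n j)) ^ S n = w ^ S n)%C).
      { rewrite Cpow_mult_l, cis_pow.
        replace (INR (S n) * - tau n j) with (- (2 * INR j * PI)) by (unfold tau; field; lra).
        rewrite cis_opp_2kPI. ring. }
      rewrite Eu in HG. apply one_minus_neq_0 in Hu.
      rewrite (csum_ext _ (fun k => (w * cis (- tau n j)) ^ k)%C) by (intros; now rewrite Cpow_mult_l).
      rewrite <- HG. field. split; [|exact Hu]. intro E. rewrite E in HG.
      apply HwN. rewrite <- HG. ring. }
  rewrite csum_scal, csum_swap.
  rewrite (csum_ext _ (fun k => w ^ k * csum (fun j => cis (- tau n j) ^ k) n)%C)
    by (intros; apply csum_scal).
  assert (E : forall m, (m <= n)%nat ->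
    csum (fun k => w ^ k * csum (fun j => cis (- tau n j) ^ k) n)%C m = RtoC (INR (S n))).
  { induction m as [|m IH]; intro Hm.
    - change (1 * csum (fun _ => 1%C) n = RtoC (INR (S n)))%C.
      rewrite csum_const. ring.
    - change (csum (fun k => w ^ k * csum (fun j => cis (- tau n j) ^ k) n)%C (S m)) with
        (csum (fun k => w ^ k * csum (fun j => cis (- tau n j) ^ k) n)%C m
          + w ^ S m * csum (fun j => cis (- tau n j) ^ S m) n)%C.
      rewrite IH, roots_power_sum by lia. ring. }
  rewrite E by lia. unfold Cdiv. ring.
Qed.

Lemma poisson_resolvent r x : 0 <= r < 1 -> poisson r x = 2 * fst (/ (1 - RtoC r * cis x))%C - 1.
Proof.
  intro Hr. assert (H := poisson_den_pos r x Hr). unfold poisson. simpl.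
  generalize (sin2_cos2 x). unfold Rsqr. intro Hsc.
  replace ((1 + - (r * cos x - 0 * sin x)) * ((1 + - (r * cos x - 0 * sin x)) * 1) +
    (0 + - (r * sin x + 0 * cos x)) * ((0 + - (r * sin x + 0 * cos x)) * 1)) with
    (1 - 2 * r * cos x + r * r * (sin x * sin x + cos x * cos x)) by ring.
  rewrite Hsc, Rmult_1_r. field. lra.
Qed.

(** Averaging over the roots of unity replaces r by r^N. Once r^N is small the average is close to
    1, whatever x is. *)
Lemma poisson_roots_sum n r x : 0 <= r < 1 ->
  sum_f_R0 (fun j => poisson r (x - tau n j)) n = INR (S n) * poisson (r ^ S n) (INR (S n) * x).
Proof.
  intro Hr. assert (HN := SINR_pos n). assert (Hr' := pow_Sn_bound r n Hr).
  assert (Hw : Cmod (RtoC r * cis x)%C < 1) by (rewrite Cmod_mult, cis_mod, Cmod_R, Rabs_pos_eq; lra).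
  assert (H := roots_resolvent_sum n _ Hw). apply (f_equal fst) in H.
  rewrite fst_csum in H.
  rewrite (sum_eq _ (fun j => fst (/ (1 - RtoC r * cis x * cis (- tau n j)))%C * 2 - 1)).
  2:{ intros j _. rewrite poisson_resolvent by exact Hr.
      replace (RtoC r * cis x * cis (- tau n j))%C with (RtoC r * cis (x - tau n j))%C; [ring|].
      unfold Rminus. rewrite cis_add. ring. }
  rewrite minus_sum, <- scal_sum, H, sum_cte.
  rewrite (poisson_resolvent _ _ Hr'). rewrite Cpow_mult_l, cis_pow, <- RtoC_pow.
  unfold Cdiv.
  assert (Ef : forall z : C, fst (RtoC (INR (S n)) * z)%C = INR (S n) * fst z)
    by (intro; cbn [fst Cmult RtoC snd]; ring).
  rewrite Ef. ring.
Qed.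

(** * The argument of the nodal polynomial on a slightly smaller circle *)

(** Minus the argument of 1 - r e^(ix); the argument of the nodal polynomial is minus a sum of such
    terms. *)
Definition cauchy_arg (r x : R) : R := atan (r * sin x / (1 - r * cos x)).

Lemma Aa_den r x : 0 <= r < 1 -> 0 < 1 - r * cos x.
Proof. intro Hr. generalize (COS_bound x). nra. Qed.

Lemma Aa_derive r x : 0 <= r < 1 -> is_derive (cauchy_arg r) x ((poisson r x - 1) / 2).
Proof.
  intro Hr. assert (H := Aa_den r x Hr). assert (HD := poisson_den_pos r x Hr).
  evar_last.
  - apply (is_derive_comp atan (fun x => r * sin x / (1 - r * cos x))).
    + apply is_derive_Reals, derivable_pt_lim_atan.
    + apply (is_derive_div (fun x => r * sin x) (fun x => 1 - r * cos x) x (r * cos x) (r * sin x)).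
      auto_derive; [easy|ring]. auto_derive; [easy|ring]. lra.
  - unfold minus, plus, opp, scal; simpl; unfold mult; simpl. unfold poisson, Rsqr.
    generalize (sin2_cos2 x). unfold Rsqr. set (c := cos x) in *. set (s := sin x). intro Hsc.
    assert (Hs2 : s * s = 1 - c * c) by lra.
    replace (1 + r * s / (1 - r * c) * (r * s / (1 - r * c) * 1)) with
      ((1 - 2 * r * c + r * r) / ((1 - r * c) * (1 - r * c))).
    2:{ replace (1 - 2 * r * c + r * r) with ((1 - r * c) * (1 - r * c) + r * r * (s * s))
          by (rewrite Hs2; ring). field. lra. }
    replace (r * c * (1 - r * c) - r * s * (r * s)) with (r * c - r * r * (c * c + s * s)) by ring.
    rewrite Hs2. field. lra.
Qed.

Lemma Aa_polar r x : 0 <= r < 1 ->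
  (1 - RtoC r * cis x)%C = (RtoC (Cmod (1 - RtoC r * cis x)) * cis (- cauchy_arg r x))%C.
Proof.
  intro Hr. assert (Hc := Aa_den r x Hr). assert (Hm := Cmod_one_minus r x Hr).
  set (m := Cmod (1 - RtoC r * cis x)%C) in *.
  assert (Hm2 : m * m = (1 - r * cos x) * (1 - r * cos x) + r * sin x * (r * sin x)).
  { unfold m. rewrite Cmod_sqr. simpl. ring. }
  assert (Hs : sqrt (1 + (r * sin x / (1 - r * cos x))²) = m / (1 - r * cos x)).
  { apply sqrt_lem_1.
    - generalize (Rle_0_sqr (r * sin x / (1 - r * cos x))); lra.
    - apply Rlt_le, Rdiv_lt_0_compat; lra.
    - unfold Rsqr. replace (m / (1 - r * cos x) * (m / (1 - r * cos x))) with
        (m * m / ((1 - r * cos x) * (1 - r * cos x))) by (field; lra).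
      rewrite Hm2. field. lra. }
  unfold cauchy_arg. apply C_eq; cbn [fst snd Cmult RtoC cis Cminus Cplus Copp].
  - rewrite cos_neg, sin_neg, cos_atan, sin_atan, Hs. field. lra.
  - rewrite cos_neg, sin_neg, sin_atan, cos_atan, Hs. field. lra.
Qed.

Lemma Rabs_atan_le x : Rabs (atan x) <= Rabs x.
Proof.
  assert (Hpos : forall y, 0 <= y -> 0 <= atan y <= y).
  { intros y [Hy| <-]; [|rewrite atan_0; lra].
    destruct (MVT_is_derive (fun t => t - atan t) (fun t => 1 - / (1 + t²)) 0 y Hy) as (c & Hc & E).
    - intro t. auto_derive; [easy|]. unfold Rsqr. field. nra.
    - rewrite atan_0 in E. assert (H1 : / (1 + c²) <= 1).
      { rewrite <- Rinv_1. apply Rinv_le_contravar; [lra|]. generalize (Rle_0_sqr c); lra. }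
      assert (H2 : 0 < atan y) by (rewrite <- atan_0; now apply atan_increasing).
      split; [lra|]. nra. }
  unfold Rabs at 2. destruct (Rcase_abs x) as [H|H].
  - rewrite <- Rabs_Ropp, <- atan_opp. destruct (Hpos (- x)) as [H1 H2]; [lra|].
    rewrite Rabs_pos_eq; lra.
  - destruct (Hpos x) as [H1 H2]; [lra|]. rewrite Rabs_pos_eq; lra.
Qed.

Lemma Aa_bound r x : 0 <= r < 1 -> Rabs (cauchy_arg r x) <= r / (1 - r).
Proof.
  intro Hr. assert (Hc := Aa_den r x Hr). eapply Rle_trans; [apply Rabs_atan_le|].
  unfold Rdiv. rewrite Rabs_mult, (Rabs_mult r), (Rabs_pos_eq r), Rabs_inv, (Rabs_pos_eq (1 - _)) by lra.
  assert (H1 : Rabs (sin x) <= 1) by (apply Rabs_le, SIN_bound). assert (H0 := Rabs_pos (sin x)).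
  apply Rmult_le_compat; [nra|left; now apply Rinv_0_lt_compat|nra|].
  apply Rinv_le_contravar; [lra|]. generalize (COS_bound x). nra.
Qed.

Lemma Aa_shift_derive r a y : 0 <= r < 1 -> is_derive (fun x => cauchy_arg r (x - a)) y ((poisson r (y - a) - 1) / 2).
Proof.
  intro Hr. evar_last.
  - apply (is_derive_comp (cauchy_arg r) (fun x => x - a)); [apply Aa_derive; exact Hr|].
    auto_derive; [easy|reflexivity].
  - unfold scal; simpl; unfold mult; simpl. apply Rmult_1_l.
Qed.

Lemma sum_derive (f : nat -> R -> R) (f' : nat -> R) y m :
  (forall j, is_derive (f j) y (f' j)) ->
  is_derive (fun x => sum_f_R0 (fun j => f j x) m) y (sum_f_R0 f' m).
Proof.
  intro H. induction m as [|m IH]; simpl; [apply H|].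
  apply (is_derive_plus (fun x => sum_f_R0 (fun j => f j x) m) (f (S m))); [exact IH|apply H].
Qed.

(** Both sides have the same derivative in x, by [poisson_roots_sum]. The values at 0 are left as
    they are, since they only shift the reference angle. *)
Lemma Aa_roots_sum n r x : 0 <= r < 1 ->
  sum_f_R0 (fun j => cauchy_arg r (x - tau n j)) n =
  sum_f_R0 (fun j => cauchy_arg r (0 - tau n j)) n + cauchy_arg (r ^ S n) (INR (S n) * x) - cauchy_arg (r ^ S n) (INR (S n) * 0).
Proof.
  intro Hr. assert (HN := SINR_pos n). assert (Hr' := pow_Sn_bound r n Hr).
  set (f := fun x => sum_f_R0 (fun j => cauchy_arg r (x - tau n j)) n - cauchy_arg (r ^ S n) (INR (S n) * x)).
  assert (Df : forall y, is_derive f y 0).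
  { intro y. evar_last.
    - apply (is_derive_minus (fun x => sum_f_R0 (fun j => cauchy_arg r (x - tau n j)) n)
        (fun x => cauchy_arg (r ^ S n) (INR (S n) * x)) y
        (sum_f_R0 (fun j => (poisson r (y - tau n j) - 1) / 2) n)
        (INR (S n) * ((poisson (r ^ S n) (INR (S n) * y) - 1) / 2))).
      + apply (sum_derive (fun j x => cauchy_arg r (x - tau n j))). intro j. now apply Aa_shift_derive.
      + apply (is_derive_comp (cauchy_arg (r ^ S n)) (fun x => INR (S n) * x)); [apply Aa_derive; exact Hr'|].
        evar_last; [apply is_derive_scal; apply is_derive_id|]. unfold one; simpl. apply Rmult_1_r.
    - unfold minus, plus, opp. cbn.
      rewrite (sum_eq _ (fun j => poisson r (y - tau n j) * / 2 - / 2)) by (intros; field).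
      rewrite minus_sum, <- scal_sum, poisson_roots_sum, sum_cte by exact Hr.
      cbn. field. }
  assert (Hconst : f x = f 0).
  { destruct (Rtotal_order x 0) as [H|[->|H]]; [| reflexivity |].
    - destruct (MVT_is_derive f (fun _ => 0) x 0 H Df) as (c & _ & E). lra.
    - destruct (MVT_is_derive f (fun _ => 0) 0 x H Df) as (c & _ & E). lra. }
  unfold f in Hconst. lra.
Qed.

Definition slow (r a : R) : R := (1 + r * a / (1 - r)) ^ 2.

(** By the mean value theorem a displacement s changes the argument by s (P - 1)/2, with P the
    Poisson kernel at an intermediate point. The part -s/2 is independent of x and joins the
    reference angle; only s P/2 remains. *)
Lemma Aa_shift r a x s : 0 < r < 1 -> Rabs s <= a ->
  Rabs (cauchy_arg r x - cauchy_arg r (x - s) + s / 2) <= / 2 * a * slow r a * poisson r x.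
Proof.
  intros Hr Hs. assert (Hr' : 0 <= r < 1) by lra.
  assert (Hmvt : exists c, Rabs c <= Rabs s /\ cauchy_arg r x - cauchy_arg r (x - s) = (poisson r (x + c) - 1) / 2 * s).
  { destruct (Rtotal_order s 0) as [H|[->|H]].
    - destruct (MVT_is_derive (cauchy_arg r) (fun y => (poisson r y - 1) / 2) x (x - s) ltac:(lra)) as (c & Hc & E).
      { intro y. now apply Aa_derive. }
      exists (c - x). split; [rewrite (Rabs_left s) by exact H; rewrite Rabs_pos_eq; lra|].
      replace (x + (c - x)) with c by ring. lra.
    - exists 0. split; [lra|]. rewrite Rminus_0_r. ring.
    - destruct (MVT_is_derive (cauchy_arg r) (fun y => (poisson r y - 1) / 2) (x - s) x ltac:(lra)) as (c & Hc & E).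
      { intro y. now apply Aa_derive. }
      exists (c - x). split; [rewrite (Rabs_pos_eq s) by lra; apply Rabs_le; lra|].
      replace (x + (c - x)) with c by ring. lra. }
  destruct Hmvt as (c & Hc & ->).
  replace ((poisson r (x + c) - 1) / 2 * s + s / 2) with (/ 2 * (s * poisson r (x + c))) by field.
  assert (HP := poisson_pos r (x + c) Hr'). assert (HPx := poisson_pos r x Hr').
  assert (Hsl := poisson_slow r x c a Hr ltac:(lra)). fold (slow r a) in Hsl.
  rewrite Rabs_mult, Rabs_mult, (Rabs_pos_eq (/ 2)), (Rabs_pos_eq (poisson _ _)) by lra.
  rewrite !Rmult_assoc. apply Rmult_le_compat_l; [lra|].
  apply Rmult_le_compat; [apply Rabs_pos|lra|lra|lra].
Qed.

(** Summing the one-node estimates gives a N / 2 times factors that tend to 1 as c grows. For a = 2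
    pi delta / N this is pi delta, uniformly in n. *)
Lemma sector_argument n r a (t : nat -> R) : 0 < r < 1 -> 0 <= a ->
  (forall j, (j <= n)%nat -> Rabs (t j - tau n j) <= a) ->
  exists C1, forall x, Rabs (- sum_f_R0 (fun j => cauchy_arg r (x - t j)) n - C1) <=
    r ^ S n / (1 - r ^ S n) + / 2 * a * slow r a * (INR (S n) * ((1 + r ^ S n) / (1 - r ^ S n))).
Proof.
  intros Hr Ha Ht. assert (Hr' : 0 <= r < 1) by lra. assert (HN := SINR_pos n).
  assert (Hrn := pow_Sn_bound r n Hr').
  exists (- sum_f_R0 (fun j => (t j - tau n j) / 2) n
     - (sum_f_R0 (fun j => cauchy_arg r (0 - tau n j)) n - cauchy_arg (r ^ S n) (INR (S n) * 0))).
  intro x.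
  assert (E : - sum_f_R0 (fun j => cauchy_arg r (x - t j)) n -
    (- sum_f_R0 (fun j => (t j - tau n j) / 2) n
     - (sum_f_R0 (fun j => cauchy_arg r (0 - tau n j)) n - cauchy_arg (r ^ S n) (INR (S n) * 0))) =
    sum_f_R0 (fun j => cauchy_arg r (x - tau n j) - cauchy_arg r (x - tau n j - (t j - tau n j)) + (t j - tau n j) / 2) n
    - cauchy_arg (r ^ S n) (INR (S n) * x)).
  { rewrite sum_plus, minus_sum, (Aa_roots_sum n r x Hr').
    rewrite (sum_eq (fun j => cauchy_arg r (x - tau n j - (t j - tau n j))) (fun j => cauchy_arg r (x - t j))).
    ring. intros j _. f_equal. ring. }
  rewrite E. unfold Rminus at 1. eapply Rle_trans; [apply Rabs_triang|]. rewrite Rabs_Ropp, Rplus_comm.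
  apply Rplus_le_compat; [now apply Aa_bound|].
  eapply Rle_trans; [apply Rsum_abs|].
  apply Rle_trans with (sum_f_R0 (fun j => poisson r (x - tau n j) * (/ 2 * a * slow r a)) n).
  { apply sum_Rle. intros j Hj. rewrite (Rmult_comm (poisson _ _)).
    apply Aa_shift; [exact Hr|now apply Ht]. }
  rewrite <- scal_sum, poisson_roots_sum by exact Hr'.
  assert (Hsl : 0 <= slow r a) by apply pow2_ge_0.
  apply Rmult_le_compat_l; [apply Rmult_le_pos; lra|].
  apply Rmult_le_compat_l; [lra|]. now apply poisson_le.
Qed.

Lemma poisson_nodes_sum n r a (t : nat -> R) x : 0 < r < 1 ->
  (forall j, (j <= n)%nat -> Rabs (t j - tau n j) <= a) ->
  sum_f_R0 (fun j => poisson r (x - t j)) n <= slow r a * (INR (S n) * ((1 + r ^ S n) / (1 - r ^ S n))).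
Proof.
  intros Hr Ht. assert (Hr' : 0 <= r < 1) by lra. assert (HN := SINR_pos n).
  assert (Hrn := pow_Sn_bound r n Hr').
  apply Rle_trans with (sum_f_R0 (fun j => poisson r (x - tau n j) * slow r a) n).
  { apply sum_Rle. intros j Hj. rewrite Rmult_comm.
    replace (x - t j) with (x - tau n j + (tau n j - t j)) by ring.
    apply poisson_slow; [exact Hr|]. rewrite Rabs_minus_sym. now apply Ht. }
  rewrite <- scal_sum, poisson_roots_sum by exact Hr'.
  apply Rmult_le_compat_l; [apply pow2_ge_0|].
  apply Rmult_le_compat_l; [lra|]. now apply poisson_le.
Qed.

Lemma cprod_ext f g n : (forall j, (j <= n)%nat -> f j = g j) -> cprod f n = cprod g n.
Proof.
  induction n as [|n IH]; simpl; intro H; [now apply H|].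
  rewrite IH, H by (intros; auto). reflexivity.
Qed.

Lemma cprod_mult f g n : cprod (fun j => f j * g j)%C n = (cprod f n * cprod g n)%C.
Proof. induction n; simpl; [reflexivity|]. rewrite IHn. ring. Qed.

Lemma cprod_const c n : cprod (fun _ => c) n = (c ^ S n)%C.
Proof.
  induction n as [|n IH]; [simpl; ring|].
  change (cprod (fun _ => c) (S n)) with (cprod (fun _ => c) n * c)%C.
  rewrite IH, (Cpow_S c (S n)). ring.
Qed.

Lemma cprod_conj f n : Cconj (cprod f n) = cprod (fun j => Cconj (f j)) n.
Proof. induction n; simpl; [reflexivity|]. rewrite Cmult_conj, IHn. reflexivity. Qed.

Lemma cprod_neq_0 (f : nat -> C) n : (forall j, (j <= n)%nat -> f j <> 0%C) -> cprod f n <> 0%C.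
Proof.
  induction n as [|n IH]; simpl; intro H; [now apply H|].
  apply Cmult_neq_0; [apply IH; intros; apply H; lia|apply H; lia].
Qed.

Lemma cprod_eq_0 (f : nat -> C) n j : (j <= n)%nat -> f j = 0%C -> cprod f n = 0%C.
Proof.
  induction n as [|n IH]; simpl; intros Hj H.
  - replace j with O in H by lia. exact H.
  - destruct (Nat.eq_dec j (S n)) as [->|Hne]; [rewrite H; ring|].
    rewrite IH; [ring|lia|exact H].
Qed.

Lemma cprod_polar (f : nat -> C) (x : nat -> R) n :
  (forall j, (j <= n)%nat -> f j = (RtoC (Cmod (f j)) * cis (x j))%C) ->
  cprod f n = (RtoC (Cmod (cprod f n)) * cis (sum_f_R0 x n))%C.
Proof.
  induction n as [|n IH]; intro H; simpl; [now apply H|].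
  rewrite IH at 1 by (intros; auto). rewrite (H (S n)) at 1 by lia.
  rewrite Cmod_mult, RtoC_mult, cis_add. ring.
Qed.

Lemma csum_single (f : nat -> C) n j : (j <= n)%nat -> (forall k, (k <= n)%nat -> k <> j -> f k = 0%C) ->
  csum f n = f j.
Proof.
  induction n as [|n IH]; intros Hj H.
  - replace j with O by lia. reflexivity.
  - simpl. destruct (Nat.eq_dec j (S n)) as [->|Hne].
    + replace (csum f n) with (RtoC 0); [ring|]. symmetry.
      transitivity (csum (fun _ => RtoC 0) n); [apply csum_ext; intros; apply H; lia|].
      rewrite csum_const. ring.
    + rewrite (IH ltac:(lia)) by (intros; apply H; lia). rewrite (H (S n)) by lia. ring.
Qed.

(** * Lagrange interpolation at the nodes *)

Section Nodes.
Variables (n : nat) (t : nat -> R).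

(* The nodes are e^(i t_j); [nodal_poly] vanishes exactly there and is normalized by [nodal_poly 0 = 1]. *)
Definition nodal_poly (w : C) : C := cprod (fun j => 1 - w * cis (- t j))%C n.
Definition nodal_except (j : nat) (w : C) : C :=
  cprod (fun k => if Nat.eq_dec k j then 1 else 1 - w * cis (- t k))%C n.
(** The derivative of the nodal polynomial at the j-th node, up to the factor - conj z_j. *)
Definition nodal_at_node (j : nat) : C := nodal_except j (cis (t j)).

Lemma EN_factor j w : (j <= n)%nat -> nodal_poly w = ((1 - w * cis (- t j)) * nodal_except j w)%C.
Proof.
  intro Hj. unfold nodal_poly, nodal_except.
  transitivity (cprod (fun k => (if Nat.eq_dec k j then 1 - w * cis (- t j) else 1)
    * (if Nat.eq_dec k j then 1 else 1 - w * cis (- t k)))%C n).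
  - apply cprod_ext. intros k _. destruct (Nat.eq_dec k j) as [->|_]; ring.
  - rewrite cprod_mult. f_equal. clear - Hj. revert Hj. generalize n as m.
    induction m as [|m IH]; intro Hj; cbn [cprod].
    + destruct (Nat.eq_dec 0 j); [reflexivity|lia].
    + destruct (Nat.eq_dec (S m) j) as [E|E].
      * transitivity (cprod (fun _ => 1%C) m * (1 - w * cis (- t j)))%C.
        { f_equal. apply cprod_ext. intros k Hk. destruct (Nat.eq_dec k j); [lia|reflexivity]. }
        rewrite cprod_const, Cpow_1_l. ring.
      * rewrite IH by lia. ring.
Qed.

Lemma poly_le_lin a : poly_le 1 (fun w => 1 - w * a)%C.
Proof.
  exists 1%C, (fun _ => (- a)%C). split; [apply poly_le_const|]. intro; ring.
Qed.

Lemma poly_le_EN : poly_le (S n) nodal_poly.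
Proof.
  unfold nodal_poly. generalize n as m. induction m as [|m IH]; cbn [cprod]; [apply poly_le_lin|].
  replace (S (S m)) with (S m + 1)%nat by lia.
  apply (poly_le_mul (S m) 1 (fun w => cprod (fun j => 1 - w * cis (- t j))%C m)); [exact IH|apply poly_le_lin].
Qed.

Lemma poly_le_ENj j : (j <= n)%nat -> poly_le n (nodal_except j).
Proof.
  intro Hj. unfold nodal_except.
  (* The partial product up to m has degree bound m + 1 until the omitted index is passed, and m
     from then on. *)
  assert (H : forall m, poly_le (if le_dec j m then m else S m)
    (fun w => cprod (fun k => if Nat.eq_dec k j then 1 else 1 - w * cis (- t k))%C m)).
  { induction m as [|m IH]; cbn [cprod].
    - destruct (Nat.eq_dec 0 j); destruct (le_dec j 0); try lia.
      + apply poly_le_const.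
      + apply poly_le_lin.
    - destruct (Nat.eq_dec (S m) j) as [E|E]; destruct (le_dec j (S m)); try lia;
      destruct (le_dec j m); try lia.
      + apply (poly_le_ext _ (fun w => cprod (fun k => if Nat.eq_dec k j then 1 else 1 - w * cis (- t k))%C m)).
        intro; ring. exact IH.
      + replace (S m) with (m + 1)%nat at 1 by lia.
        apply (poly_le_mul m 1 (fun w => cprod (fun k => if Nat.eq_dec k j then 1 else 1 - w * cis (- t k))%C m)).
        exact IH. apply poly_le_lin.
      + replace (S (S m)) with (S m + 1)%nat by lia.
        apply (poly_le_mul (S m) 1 (fun w => cprod (fun k => if Nat.eq_dec k j then 1 else 1 - w * cis (- t k))%C m)).
        exact IH. apply poly_le_lin. }
  generalize (H n). destruct (le_dec j n); [tauto|lia].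
Qed.

Lemma poly_le_csum m (F : nat -> C -> C) k : (forall j, (j <= k)%nat -> poly_le m (F j)) ->
  poly_le m (fun w => csum (fun j => F j w) k).
Proof.
  induction k as [|k IH]; intro H; simpl.
  - apply (H O). lia.
  - apply (poly_le_add m (fun w => csum (fun j => F j w) k) (F (S k))); [apply IH; intros; apply H; lia|apply H; lia].
Qed.

Hypothesis distinct : forall j k, (j <= n)%nat -> (k <= n)%nat -> j <> k -> cis (t j) <> cis (t k).

Lemma node_diff_neq_0 j k : (j <= n)%nat -> (k <= n)%nat -> j <> k ->
  (1 - cis (t j) * cis (- t k))%C <> 0%C.
Proof.
  intros Hj Hk Hne E. apply (distinct j k Hj Hk Hne).
  assert (Hp : (cis (t j) * cis (- t k))%C = 1%C).
  { replace (cis (t j) * cis (- t k))%C with (1 - (1 - cis (t j) * cis (- t k)))%C by ring.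
    rewrite E. ring. }
  transitivity (cis (t j) * (cis (- t k) * cis (t k)))%C.
  { rewrite cis_inv_l. ring. }
  rewrite Cmult_assoc, Hp. ring.
Qed.

Lemma ej_neq_0 j : (j <= n)%nat -> nodal_at_node j <> 0%C.
Proof.
  intro Hj. apply cprod_neq_0. intros k Hk. destruct (Nat.eq_dec k j) as [->|Hne].
  - apply C1_nz.
  - apply node_diff_neq_0; auto.
Qed.

Lemma ENj_other j k : (j <= n)%nat -> (k <= n)%nat -> j <> k -> nodal_except j (cis (t k)) = 0%C.
Proof.
  intros Hj Hk Hne. apply (cprod_eq_0 _ n k Hk). destruct (Nat.eq_dec k j); [congruence|].
  rewrite <- cis_add, Rplus_opp_r, cis_0. ring.
Qed.

Lemma lagrange P : poly_le n P -> forall w,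
  P w = csum (fun j => P (cis (t j)) / nodal_at_node j * nodal_except j w)%C n.
Proof.
  intros HP w.
  set (L := fun w => csum (fun j => P (cis (t j)) / nodal_at_node j * nodal_except j w)%C n).
  assert (HL : poly_le n L).
  { apply (poly_le_csum n (fun j w => P (cis (t j)) / nodal_at_node j * nodal_except j w)%C n).
    intros j Hj. apply poly_le_scal. now apply poly_le_ENj. }
  assert (H0 : (P w + (-1) * L w)%C = 0%C).
  { apply (poly_le_roots n (fun w => P w + (-1) * L w)%C (fun j => cis (t j))).
    - apply (poly_le_add n P (fun w => (-1) * L w)%C HP). now apply poly_le_scal.
    - intros i j Hi Hj Hne. now apply distinct.
    - intros i Hi. unfold L. rewrite (csum_single _ n i Hi).
      + change (nodal_except i (cis (t i))) with (nodal_at_node i). field. now apply ej_neq_0.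
      + intros k Hk Hne. rewrite ENj_other by auto. ring. }
  fold (L w). replace (P w) with ((P w + (-1) * L w) + L w)%C by ring. rewrite H0. ring.
Qed.

Lemma partial_fractions P w : poly_le n P -> nodal_poly w <> 0%C ->
  (P w / nodal_poly w)%C = csum (fun j => P (cis (t j)) / nodal_at_node j * / (1 - w * cis (- t j)))%C n.
Proof.
  intros HP Hw. rewrite (lagrange P HP w). unfold Cdiv at 1. rewrite Cmult_comm, <- csum_scal.
  apply csum_ext. intros j Hj.
  assert (HE := EN_factor j w Hj). rewrite HE in Hw |- *.
  assert (H1 : (1 - w * cis (- t j))%C <> 0%C).
  { intro E. apply Hw. rewrite E. ring. }
  assert (H2 : nodal_except j w <> 0%C).
  { intro E. apply Hw. rewrite E. ring. }
  assert (H3 := ej_neq_0 j Hj). field. auto.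
Qed.

End Nodes.

(* Difference of the Cauchy kernels at the points w and 1/conj w. *)
Lemma poisson_jump r y : 0 < r < 1 ->
  RtoC (poisson r y) = (/ (1 - RtoC r * cis y) - / (1 - RtoC (/ r) * cis y))%C.
Proof.
  intro Hr. assert (Hr' : 0 <= r < 1) by lra.
  set (u := (RtoC r * cis y)%C). set (v := (RtoC r * cis (- y))%C).
  assert (Hri : (RtoC r <> 0)%C) by (intro E; apply (f_equal fst) in E; simpl in E; lra).
  assert (Hv : v <> 0%C) by (apply Cmult_neq_0; [exact Hri|apply cis_neq_0]).
  assert (Hcc : (cis (- y) * cis y)%C = 1%C) by apply cis_inv_l.
  assert (Euv : (RtoC (/ r) * cis y)%C = (/ v)%C).
  { unfold v. rewrite RtoC_inv by lra. 
    transitivity (/ RtoC r * / cis (- y) * (cis (- y) * cis y))%C.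
    - field. split; [apply cis_neq_0|exact Hri].
    - rewrite Hcc. field. split; [apply cis_neq_0|exact Hri]. }
  assert (Hmu : Cmod u < 1) by (unfold u; rewrite Cmod_mult, cis_mod, Cmod_R, Rabs_pos_eq; lra).
  assert (Hmv : Cmod v < 1) by (unfold v; rewrite Cmod_mult, cis_mod, Cmod_R, Rabs_pos_eq; lra).
  assert (H1 := one_minus_neq_0 _ Hmu). assert (H2 := one_minus_neq_0 _ Hmv).
  rewrite Euv.
  assert (H3 : (v - 1)%C <> 0%C).
  { intro E. apply H2. replace (1 - v)%C with (- (v - 1))%C by ring. rewrite E. ring. }
  assert (Huv : (u * v)%C = RtoC (r * r)).
  { unfold u, v. rewrite RtoC_mult.
    transitivity (RtoC r * RtoC r * (cis (- y) * cis y))%C; [ring|rewrite Hcc; ring]. }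
  assert (Hden : ((1 - u) * (1 - v))%C = RtoC (1 - 2 * r * cos y + r * r)).
  { unfold u, v. apply C_eq; simpl; rewrite cos_neg, sin_neg; [|ring].
    generalize (sin2_cos2 y); unfold Rsqr; intro H.
    replace (r * r) with (r * r * (sin y * sin y + cos y * cos y)) by (rewrite H; ring). ring. }
  unfold poisson. rewrite RtoC_div, <- Hden.
  2:{ apply Rgt_not_eq. now apply poisson_den_pos. }
  rewrite RtoC_minus, <- Huv. field. auto.
Qed.

(** * Estimates for the interpolation kernel *)

(** The sign of j - k. The argument of 1 - e^(i (t_j - t_k)) is (t_j - t_k)/2 minus pi/2 times this
    sign, because the sine factor changes sign with j - k. *)
Definition sg (j k : nat) : R := if lt_dec k j then 1 else if Nat.eq_dec k j then 0 else -1.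

Lemma sg_sum j m : sum_f_R0 (sg j) m = if lt_dec m j then INR m + 1 else 2 * INR j - INR m.
Proof.
  induction m as [|m IH].
  - unfold sum_f_R0, sg. destruct (lt_dec 0 j); [simpl; lra|].
    destruct (Nat.eq_dec 0 j) as [<-|]; [simpl; lra|lia].
  - change (sum_f_R0 (sg j) (S m)) with (sum_f_R0 (sg j) m + sg j (S m)). rewrite IH.
    unfold sg. rewrite S_INR.
    destruct (lt_dec m j); destruct (lt_dec (S m) j); try lia; try lra;
    destruct (Nat.eq_dec (S m) j) as [E|E]; try lia; try lra.
    rewrite <- E, S_INR. lra.
Qed.

Lemma one_minus_cis x : (1 - cis x)%C = (RtoC (2 * sin (x / 2)) * cis (x / 2 - PI / 2))%C.
Proof.
  replace x with (2 * (x / 2)) at 1 by field.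
  apply C_eq; simpl; rewrite ?cos_2a_sin, ?sin_2a.
  - replace (x / 2 - PI / 2) with (- (PI / 2 - x / 2)) by ring.
    rewrite cos_neg, sin_neg, cos_shift. ring.
  - replace (x / 2 - PI / 2) with (- (PI / 2 - x / 2)) by ring.
    rewrite cos_neg, sin_neg, sin_shift. ring.
Qed.

Lemma Cmod_one_minus_cis x : Cmod (1 - cis x)%C = 2 * Rabs (sin (x / 2)).
Proof.
  rewrite one_minus_cis, Cmod_mult, cis_mod, Cmod_R, Rabs_mult, (Rabs_pos_eq 2) by lra. ring.
Qed.

Section Nodes.
Variables (n : nat) (t : nat -> R) (a : R).
Hypothesis Ha : a <= PI / (2 * INR (S n)).
Hypothesis Ht : forall j, (j <= n)%nat -> Rabs (t j - tau n j) <= a.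
Let N := INR (S n).

(** Adjacent roots of unity are 2 pi/N apart and each node moves by at most pi/(2N), so gaps stay at
    least pi/N. The upper bound is the same estimate the other way round the circle. *)
Lemma half_gap j k : (k < j)%nat -> (j <= n)%nat ->
  PI / (2 * N) <= (t j - t k) / 2 <= PI - PI / (2 * N).
Proof.
  intros Hk Hj. assert (HN := SINR_pos n). fold N in HN. assert (HPI := PI_RGT_0).
  assert (H1 := Ht j Hj). assert (H2 := Ht k ltac:(lia)).
  apply Rabs_le_between in H1. apply Rabs_le_between in H2. fold N in Ha.
  assert (E : tau n j - tau n k = 2 * (PI / N) * (INR j - INR k)) by (unfold tau; fold N; field; lra).
  assert (E2 : PI / (2 * N) = PI / N / 2) by (field; lra). rewrite E2 in *.
  set (q := PI / N) in *. assert (Hq : 0 < q) by (apply Rdiv_lt_0_compat; lra).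
  assert (nodal_poly : q * N = PI) by (unfold q; field; lra).
  assert (INR k + 1 <= INR j) by (rewrite <- S_INR; apply le_INR; lia).
  assert (INR j <= N - 1) by (unfold N; rewrite S_INR; assert (INR j <= INR n) by (apply le_INR; lia); lra).
  assert (0 <= INR k) by apply pos_INR.
  assert (q <= q * (INR j - INR k)) by nra.
  assert (q * (INR j - INR k) <= PI - q) by nra.
  lra.
Qed.

Lemma sin_half_gap j k : (k <= n)%nat -> (j <= n)%nat -> j <> k ->
  / N <= Rabs (sin ((t j - t k) / 2)).
Proof.
  assert (HN := SINR_pos n). fold N in HN. assert (HPI := PI_RGT_0).
  assert (HN1 : 1 <= N) by (unfold N; rewrite S_INR; generalize (pos_INR n); lra).
  assert (Hlow : / N <= sin (PI / (2 * N))).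
  { assert (Hi : 0 <= / N <= 1).
    { split; [left; now apply Rinv_0_lt_compat|]. rewrite <- Rinv_1. apply Rinv_le_contravar; lra. }
    assert (H := sin_concave (/ N) (PI / 2) Hi ltac:(lra)). rewrite sin_PI2 in H.
    replace (PI / (2 * N)) with (/ N * (PI / 2)) by (field; lra). lra. }
  assert (Hq : 0 < PI / (2 * N)) by (apply Rdiv_lt_0_compat; lra).
  assert (Hq2 : PI / (2 * N) <= PI / 2) by (apply Rmult_le_compat_l; [lra|apply Rinv_le_contravar; lra]).
  assert (Hmain : forall x, PI / (2 * N) <= x <= PI - PI / (2 * N) -> / N <= sin x).
  { intros x Hx. eapply Rle_trans; [exact Hlow|].
    destruct (Rle_dec x (PI / 2)).
    - apply sin_incr_1; lra.
    - rewrite <- (sin_PI_x x). apply sin_incr_1; lra. }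
  intros Hk Hj Hne. destruct (lt_dec k j) as [H|H].
  - eapply Rle_trans; [apply Hmain, half_gap; [exact H|exact Hj]|apply Rle_abs].
  - replace ((t j - t k) / 2) with (- ((t k - t j) / 2)) by field. rewrite sin_neg, Rabs_Ropp.
    apply Rle_trans with (sin ((t k - t j) / 2)); [apply Hmain, half_gap; [lia|exact Hk]|apply Rle_abs].
Qed.

Lemma node_gap j k : (k <= n)%nat -> (j <= n)%nat -> j <> k ->
  2 / N <= Cmod (1 - cis (t j - t k))%C.
Proof.
  intros Hk Hj Hne. rewrite Cmod_one_minus_cis.
  generalize (sin_half_gap j k Hk Hj Hne). unfold Rdiv. lra.
Qed.

Lemma nodes_distinct j k : (j <= n)%nat -> (k <= n)%nat -> j <> k -> cis (t j) <> cis (t k).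
Proof.
  intros Hj Hk Hne E. assert (H := node_gap j k Hk Hj Hne).
  assert (HN := SINR_pos n). fold N in HN.
  unfold Rminus in H. rewrite cis_add, E, <- cis_add, Rplus_opp_r, cis_0 in H.
  replace (1 - 1)%C with (RtoC 0) in H by ring. rewrite Cmod_0 in H.
  assert (0 < 2 / N) by (apply Rdiv_lt_0_compat; lra). lra.
Qed.

(** The arguments of the factors add up to N t_j / 2 - (sum of all t_k)/2 - (pi/2)(2j - n), and pi j
    = N tau_j / 2. Hence the phases of the interpolation weights vary only through N (t_j -
    tau_j)/2, which is at most pi delta in absolute value under the assumed displacements. *)
Lemma ej_phase : exists C0, forall j, (j <= n)%nat ->
  nodal_at_node n t j = (RtoC (Cmod (nodal_at_node n t j)) * cis (N * (t j - tau n j) / 2 + C0))%C.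
Proof.
  exists (PI * INR n / 2 - sum_f_R0 t n / 2). intros j Hj.
  assert (HN := SINR_pos n). fold N in HN. assert (HPI := PI_RGT_0).
  unfold nodal_at_node, nodal_except at 1.
  set (f := fun k => (if Nat.eq_dec k j then RtoC 1 else 1 - cis (t j) * cis (- t k))%C).
  assert (Hp : forall k, (k <= n)%nat ->
    f k = (RtoC (Cmod (f k)) * cis ((t j - t k) / 2 - PI / 2 * sg j k))%C).
  { intros k Hk. unfold f, sg. destruct (Nat.eq_dec k j) as [->|Hne].
    - destruct (lt_dec j j); [lia|]. rewrite Cmod_1.
      replace ((t j - t j) / 2 - PI / 2 * 0) with 0 by field. rewrite cis_0. ring.
    - rewrite <- cis_add. change (t j + - t k) with (t j - t k).
      rewrite Cmod_one_minus_cis. rewrite one_minus_cis.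
      assert (Hq : 0 < PI / (2 * N)) by (apply Rdiv_lt_0_compat; lra).
      destruct (lt_dec k j) as [Hlt|Hlt].
      + assert (Hg := half_gap j k Hlt Hj).
        rewrite Rabs_pos_eq by (apply sin_ge_0; lra). now rewrite Rmult_1_r.
      + assert (Hg := half_gap k j ltac:(lia) Hk).
        assert (Hs : sin ((t j - t k) / 2) <= 0).
        { replace ((t j - t k) / 2) with (- ((t k - t j) / 2)) by field. rewrite sin_neg.
          assert (0 <= sin ((t k - t j) / 2)) by (apply sin_ge_0; lra). lra. }
        rewrite Rabs_left1 by exact Hs.
        replace ((t j - t k) / 2 - PI / 2 * -1) with ((t j - t k) / 2 - PI / 2 + PI) by field.
        rewrite cis_add. replace (cis PI) with (RtoC (-1)) by (apply C_eq; simpl; [now rewrite cos_PI|now rewrite sin_PI]).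
        apply C_eq; simpl; ring. }
  change (nodal_except n t j (cis (t j))) with (cprod f n).
  rewrite (cprod_polar f _ n Hp) at 1. f_equal. f_equal.
  rewrite minus_sum.
  rewrite (sum_eq _ (fun k => t j / 2 - t k * / 2)) by (intros; field).
  rewrite minus_sum, <- !scal_sum, sum_cte.
  rewrite (sum_eq (fun i => PI / 2 * sg j i) (fun i => sg j i * (PI / 2))) by (intros; ring).
  rewrite <- scal_sum. change (sum_f_R0 (fun i => sg j i) n) with (sum_f_R0 (sg j) n).
  rewrite sg_sum. destruct (lt_dec n j); [lia|]. unfold tau. fold N. unfold N. rewrite S_INR. field.
  rewrite <- S_INR. fold N. lra.
Qed.

Variable r : R.
Hypothesis Hr : 0 < r < 1.

Lemma EN_neq_0 (w : C) : Cmod w < 1 -> nodal_poly n t w <> 0%C.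
Proof.
  intro Hw. apply cprod_neq_0. intros j _. apply one_minus_neq_0.
  rewrite Cmod_mult, cis_mod. lra.
Qed.

Lemma Cmod_RtoC_cis rho x : 0 <= rho -> Cmod (RtoC rho * cis x)%C = rho.
Proof. intro H. rewrite Cmod_mult, cis_mod, Cmod_R, Rabs_pos_eq by exact H. ring. Qed.

(** The leading coefficient of the nodal polynomial, which relates the polynomial to its reflection
    in the circle. *)
Definition kap : C := cprod (fun j => - cis (- t j))%C n.

Lemma kap_mod : Cmod kap = 1.
Proof.
  unfold kap. generalize n as m. induction m as [|m IH]; cbn [cprod].
  - now rewrite Cmod_opp, cis_mod.
  - rewrite Cmod_mult, IH, Cmod_opp, cis_mod. ring.
Qed.

(** Factor by factor: for w' = 1/conj w and |z| = 1, one has 1 - w' conj z = - conj z w' conj(1 - w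
    conj z). *)
Lemma EN_reflect x :
  nodal_poly n t (RtoC (/ r) * cis x)%C =
  (kap * (RtoC (/ r) * cis x) ^ S n * Cconj (nodal_poly n t (RtoC r * cis x)))%C.
Proof.
  unfold nodal_poly, kap. rewrite cprod_conj, <- (cprod_const (RtoC (/ r) * cis x)%C n), <- !cprod_mult.
  apply cprod_ext. intros j _.
  assert (Hri : RtoC r <> 0%C) by (intro E; apply (f_equal fst) in E; simpl in E; lra).
  assert (E1 : Cconj (1 - RtoC r * cis x * cis (- t j))%C = (1 - RtoC r * cis (- x) * cis (t j))%C).
  { rewrite <- (cis_conj x). replace (cis (t j)) with (Cconj (cis (- t j))) by (rewrite cis_conj; f_equal; ring).
    unfold Cminus. rewrite Cplus_conj, Copp_conj, !Cmult_conj.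
    replace (Cconj 1) with (RtoC 1) by (apply C_eq; simpl; ring).
    replace (Cconj (RtoC r)) with (RtoC r) by (apply C_eq; simpl; ring). reflexivity. }
  rewrite E1, RtoC_inv by lra.
  assert (H1 := cis_inv_l (t j)). assert (H2 := cis_inv_l x).
  transitivity (- (cis (- t j)) * (/ RtoC r * cis x) + (/ RtoC r * RtoC r) * (cis (- x) * cis x) * (cis (- t j) * cis (t j)))%C.
  - rewrite H1, H2, Cinv_l by exact Hri. ring.
  - ring.
Qed.

Lemma EN_outer_neq_0 x : nodal_poly n t (RtoC (/ r) * cis x)%C <> 0%C.
Proof.
  assert (Hri : RtoC (/ r) <> 0%C).
  { intro E. apply (f_equal fst) in E. simpl in E. assert (0 < / r) by (apply Rinv_0_lt_compat; lra). lra. }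
  rewrite EN_reflect. apply Cmult_neq_0; [apply Cmult_neq_0|].
  - intro E. generalize kap_mod. rewrite E, Cmod_0. lra.
  - apply Cpow_nz. apply Cmult_neq_0; [exact Hri|apply cis_neq_0].
  - intro E. apply (f_equal Cconj) in E. rewrite Cconj_conj in E.
    apply (EN_neq_0 (RtoC r * cis x)%C).
    + rewrite Cmod_RtoC_cis; lra.
    + rewrite E. apply C_eq; simpl; ring.
Qed.

Lemma EN_outer_ge x : Cmod (nodal_poly n t (RtoC r * cis x)%C) <= Cmod (nodal_poly n t (RtoC (/ r) * cis x)%C).
Proof.
  rewrite EN_reflect, !Cmod_mult, kap_mod, Cmod_pow, Cmod_conj, Cmod_RtoC_cis.
  2:{ left. apply Rinv_0_lt_compat; lra. }
  assert (H : 1 <= (/ r) ^ S n).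
  { apply pow_R1_Rle. rewrite <- Rinv_1. apply Rinv_le_contravar; lra. }
  generalize (Cmod_ge_0 (nodal_poly n t (RtoC r * cis x)%C)). nra.
Qed.

Lemma jump_formula P x : poly_le n P ->
  (P (RtoC r * cis x) / nodal_poly n t (RtoC r * cis x) - P (RtoC (/ r) * cis x) / nodal_poly n t (RtoC (/ r) * cis x))%C =
  csum (fun j => P (cis (t j)) / nodal_at_node n t j * RtoC (poisson r (x - t j)))%C n.
Proof.
  intro HP.
  rewrite (partial_fractions n t nodes_distinct P _ HP (EN_neq_0 (RtoC r * cis x)%C ltac:(rewrite Cmod_RtoC_cis; lra))).
  rewrite (partial_fractions n t nodes_distinct P _ HP (EN_outer_neq_0 x)).
  unfold Cminus at 1.
  replace (- csum (fun j => P (cis (t j)) / nodal_at_node n t j * / (1 - RtoC (/ r) * cis x * cis (- t j)))%C n)%C with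
    (csum (fun j => (-1) * (P (cis (t j)) / nodal_at_node n t j * / (1 - RtoC (/ r) * cis x * cis (- t j))))%C n).
  2:{ rewrite csum_scal. ring. }
  rewrite <- csum_plus. apply csum_ext. intros j _.
  rewrite poisson_jump by exact Hr. unfold Rminus. rewrite cis_add, !Cmult_assoc. ring.
Qed.

(** For P = 1 the jump is at most 2/|E(w)|, as |E| is no smaller at the outer point. Rotation by
    [C0] brings every term within the angle N a / 2 of the positive axis, so the real part of the
    sum is at least cos(N a / 2) times the sum of moduli. *)
Lemma kernel_row_sum x : N * a / 2 < PI / 2 ->
  cos (N * a / 2) * sum_f_R0 (fun j => poisson r (x - t j) / Cmod (nodal_at_node n t j)) n <=
  2 / Cmod (nodal_poly n t (RtoC r * cis x)%C).
Proof.
  intro Hna. assert (HN := SINR_pos n). fold N in HN. assert (HPI := PI_RGT_0).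
  destruct ej_phase as [C0 HC0].
  assert (HJ := jump_formula (fun _ => 1%C) x (poly_le_const n 1%C)).
  set (Sc := csum _ n) in HJ.
  assert (HE0 : 0 < Cmod (nodal_poly n t (RtoC r * cis x)%C)).
  { apply Cmod_gt_0. apply EN_neq_0. rewrite Cmod_RtoC_cis; lra. }
  assert (HS : Cmod Sc <= 2 / Cmod (nodal_poly n t (RtoC r * cis x)%C)).
  { rewrite <- HJ. unfold Cminus. eapply Rle_trans; [apply Cmod_triangle|]. rewrite Cmod_opp.
    assert (HE1 := EN_outer_ge x).
    rewrite !Cmod_div, Cmod_1.
    2: apply EN_outer_neq_0. 2: apply EN_neq_0; rewrite Cmod_RtoC_cis; lra.
    assert (1 / Cmod (nodal_poly n t (RtoC (/ r) * cis x)%C) <= 1 / Cmod (nodal_poly n t (RtoC r * cis x)%C)).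
    { apply Rmult_le_compat_l; [lra|]. now apply Rinv_le_contravar. }
    unfold Rdiv in *. lra. }
  eapply Rle_trans; [|exact HS].
  apply Rle_trans with (fst (cis C0 * Sc)%C).
  2:{ replace (Cmod Sc) with (Cmod (cis C0 * Sc)%C) by (rewrite Cmod_mult, cis_mod; ring).
      eapply Rle_trans; [apply Rle_abs|]. apply re_le_Cmod. }
  unfold Sc. rewrite <- csum_scal, fst_csum.
  rewrite Rmult_comm. rewrite (Rmult_comm _ (cos _)), scal_sum.
  apply sum_Rle. intros j Hj.
  set (th := N * (t j - tau n j) / 2).
  assert (Hm : 0 < Cmod (nodal_at_node n t j)).
  { apply Cmod_gt_0. apply ej_neq_0; [exact nodes_distinct|exact Hj]. }
  assert (Hinv : (/ nodal_at_node n t j)%C = (RtoC (/ Cmod (nodal_at_node n t j)) * (cis (- th) * cis (- C0)))%C).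
  { assert (Hmc : RtoC (Cmod (nodal_at_node n t j)) <> 0%C).
    { intro E. apply (f_equal fst) in E. simpl in E. lra. }
    rewrite (HC0 j Hj) at 1. fold th. rewrite RtoC_inv by lra. rewrite cis_add.
    assert (H1 := cis_inv_l th). assert (H2 := cis_inv_l C0).
    assert (Hc1 := cis_neq_0 th). assert (Hc2 := cis_neq_0 C0).
    transitivity (/ (RtoC (Cmod (nodal_at_node n t j)) * (cis th * cis C0)) * (cis (- th) * cis th) * (cis (- C0) * cis C0))%C.
    - rewrite H1, H2. ring.
    - field. auto. }
  assert (Ev : (cis C0 * (1 / nodal_at_node n t j * RtoC (poisson r (x - t j))))%C =
    (RtoC (poisson r (x - t j) / Cmod (nodal_at_node n t j)) * cis (- th))%C).
  { unfold Cdiv. rewrite Hinv. unfold Rdiv. rewrite RtoC_mult.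
    transitivity (RtoC (poisson r (x - t j)) * RtoC (/ Cmod (nodal_at_node n t j)) * cis (- th) * (cis (- C0) * cis C0))%C.
    ring. rewrite cis_inv_l. ring. }
  rewrite Ev. cbn [fst Cmult RtoC cis snd]. rewrite Rmult_0_l, Rminus_0_r.
  apply Rmult_le_compat_l.
  { apply Rmult_le_pos; [left; apply poisson_pos; lra|left; now apply Rinv_0_lt_compat]. }
  rewrite cos_neg. apply cos_mono_abs; [|lra].
  unfold th. replace (N * (t j - tau n j) / 2) with (N / 2 * (t j - tau n j)) by field.
  rewrite Rabs_mult, (Rabs_pos_eq (N / 2)) by lra.
  replace (N * a / 2) with (N / 2 * a) by field. apply Rmult_le_compat_l; [lra|now apply Ht].
Qed.

(* Comparison of the nodal polynomial at the radius r^2 with its derivative at a node. *)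
Lemma EN_at_node j Q : (j <= n)%nat -> (1 - r) * N <= Q -> 0 <= Q ->
  Cmod (nodal_poly n t (RtoC (r * r) * cis (t j))%C) <=
  (1 - r * r) * Cmod (nodal_at_node n t j) *
  exp ((1 - r * r) * (Q * Q / 4 + 1) / 2 * sum_f_R0 (fun k => poisson r (t j - t k)) n).
Proof.
  intros Hj HQ HQ0. assert (HN := SINR_pos n). fold N in HN.
  rewrite (EN_factor n t j _ Hj). rewrite Cmod_mult.
  assert (E1 : (1 - RtoC (r * r) * cis (t j) * cis (- t j))%C = RtoC (1 - r * r)).
  { rewrite <- Cmult_assoc, <- cis_add, Rplus_opp_r, cis_0, RtoC_minus. ring. }
  rewrite E1, Cmod_R, Rabs_pos_eq by nra. rewrite Rmult_assoc. apply Rmult_le_compat_l; [nra|].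
  set (L := (1 - r * r) * (Q * Q / 4 + 1) / 2).
  assert (HL : 0 <= L) by (unfold L; apply Rmult_le_pos; [apply Rmult_le_pos; nra|lra]).
  assert (Hr' : 0 <= r < 1) by lra.
  unfold nodal_at_node, nodal_except.
  assert (H : forall m, (m <= n)%nat ->
    Cmod (cprod (fun k => if Nat.eq_dec k j then 1 else 1 - RtoC (r * r) * cis (t j) * cis (- t k))%C m) <=
    Cmod (cprod (fun k => if Nat.eq_dec k j then 1 else 1 - cis (t j) * cis (- t k))%C m) *
    exp (L * sum_f_R0 (fun k => poisson r (t j - t k)) m)).
  { assert (Hfac : forall k, (k <= n)%nat ->
      Cmod (if Nat.eq_dec k j then 1 else 1 - RtoC (r * r) * cis (t j) * cis (- t k))%C <=
      Cmod (if Nat.eq_dec k j then 1 else 1 - cis (t j) * cis (- t k))%C * exp (L * poisson r (t j - t k))).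
    { intros k Hk. assert (HP := poisson_pos r (t j - t k) Hr').
      destruct (Nat.eq_dec k j) as [E|Hne].
      - rewrite Cmod_1, Rmult_1_l. rewrite <- exp_0 at 1.
        assert (H0 : 0 <= L * poisson r (t j - t k)) by (apply Rmult_le_pos; lra).
        destruct H0 as [H0|H0]; [left; now apply exp_increasing|rewrite <- H0; lra].
      - rewrite <- Cmult_assoc, <- cis_add. change (t j + - t k) with (t j - t k).
        assert (Hgap := node_gap j k Hk Hj ltac:(auto)).
        set (y := t j - t k) in *. set (d := Cmod (1 - cis y)%C) in *.
        assert (Hd0 : 0 < d).
        { eapply Rlt_le_trans; [|exact Hgap]. apply Rdiv_lt_0_compat; lra. }
        assert (Hd2 : d * d = 2 - 2 * cos y).
        { unfold d. rewrite Cmod_sqr. simpl. generalize (sin2_cos2 y). unfold Rsqr. intro. nra. }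
        set (e := Cmod (1 - RtoC (r * r) * cis y)%C).
        assert (He0 : 0 <= e) by apply Cmod_ge_0.
        assert (He2 : e * e = (1 - r * r) * (1 - r * r) + r * r * (d * d)).
        { rewrite Hd2. replace (e * e) with (e ^ 2) by ring. unfold e. rewrite <- poisson_den. ring. }
        (* From d >= 2/N and (1 - r) N <= Q follows 1 - r <= (Q/2) d, so the Poisson denominator (1
           - r)^2 + r d^2 is at most (Q^2/4 + 1) d^2. This is the source of the constant in [L]. *)
        assert (HPd : (1 - r * r) <= poisson r y * (d * d * (Q * Q / 4 + 1))).
        { unfold poisson. assert (HD := poisson_den_pos r y Hr').
          apply Rmult_le_reg_r with (1 - 2 * r * cos y + r * r); [exact HD|].
          replace ((1 - r * r) / (1 - 2 * r * cos y + r * r) * (d * d * (Q * Q / 4 + 1)) * (1 - 2 * r * cos y + r * r))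
            with ((1 - r * r) * (d * d * (Q * Q / 4 + 1))) by (field; lra).
          apply Rmult_le_compat_l; [nra|].
          replace (1 - 2 * r * cos y + r * r) with ((1 - r) * (1 - r) + r * (d * d)) by (rewrite Hd2; ring).
          assert (Hq : 1 - r <= Q / 2 * d).
          { apply Rmult_le_reg_r with N; [exact HN|]. apply Rle_trans with Q; [exact HQ|].
            assert (2 <= d * N).
            { apply Rle_trans with (2 / N * N); [right; field; lra|apply Rmult_le_compat_r; lra]. }
            nra. }
          assert ((1 - r) * (1 - r) <= Q / 2 * d * (Q / 2 * d)) by (apply Rmult_le_compat; lra).
          assert (r * (d * d) <= 1 * (d * d)) by (apply Rmult_le_compat_r; nra). nra. }
        assert (Hed : e * e <= d * d * (1 + 2 * L * poisson r y)).
        { rewrite He2.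
          assert ((1 - r * r) * (1 - r * r) <= (1 - r * r) * (poisson r y * (d * d * (Q * Q / 4 + 1)))).
          { apply Rmult_le_compat_l; [nra|exact HPd]. }
          assert (r * r * (d * d) <= 1 * (d * d)) by (apply Rmult_le_compat_r; nra).
          replace (d * d * (1 + 2 * L * poisson r y)) with
            (d * d + (1 - r * r) * (poisson r y * (d * d * (Q * Q / 4 + 1)))) by (unfold L; field). lra. }
        assert (Hexp : 1 + 2 * L * poisson r y <= exp (L * poisson r y) * exp (L * poisson r y)).
        { rewrite <- exp_plus. replace (L * poisson r y + L * poisson r y) with (2 * L * poisson r y) by ring.
          apply exp_ineq1_le. }
        apply Rsqr_incr_0_var.
        2:{ apply Rmult_le_pos; [lra|left; apply exp_pos]. }
        unfold Rsqr. eapply Rle_trans; [exact Hed|].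
        replace (d * exp (L * poisson r y) * (d * exp (L * poisson r y))) with
          (d * d * (exp (L * poisson r y) * exp (L * poisson r y))) by ring.
        apply Rmult_le_compat_l; [nra|exact Hexp]. }
    induction m as [|m IH]; intro Hm; cbn [cprod sum_f_R0].
    - now apply Hfac.
    - rewrite !Cmod_mult, Rmult_plus_distr_l, exp_plus.
      eapply Rle_trans.
      + apply Rmult_le_compat; [apply Cmod_ge_0|apply Cmod_ge_0|apply IH; lia|apply Hfac; exact Hm].
      + right. ring. }
  apply H. lia.
Qed.

End Nodes.

(** * The two inequalities below the critical perturbation *)

Lemma isR_sum (f : nat -> R -> R) (I : nat -> R) a b n :
  (forall j, (j <= n)%nat -> is_RInt (f j) a b (I j)) ->
  is_RInt (fun x => sum_f_R0 (fun j => f j x) n) a b (sum_f_R0 I n).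
Proof.
  induction n as [|n IH]; intro H; simpl; [now apply H|].
  apply (isR_plus (fun x => sum_f_R0 (fun j => f j x) n) (f (S n))); [apply IH; intros; apply H; lia|apply H; lia].
Qed.

Lemma sum_nonneg (f : nat -> R) n : (forall j, (j <= n)%nat -> 0 <= f j) -> 0 <= sum_f_R0 f n.
Proof.
  induction n as [|n IH]; intro H; simpl; [now apply H|].
  apply Rplus_le_le_0_compat; [apply IH; intros; apply H; lia|apply H; lia].
Qed.


(** Sum with weights [K] the tangent line of x^p at m = s/B. Its value (1 - p) m^p at 0 is not
    positive, so a total weight below [B] only helps. *)
Lemma rpow_jensen_sum p B (K y : nat -> R) n : 1 <= p -> 0 < B ->
  (forall j, (j <= n)%nat -> 0 <= K j) -> (forall j, (j <= n)%nat -> 0 <= y j) ->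
  sum_f_R0 K n <= B ->
  rpow (sum_f_R0 (fun j => K j * y j) n) p <= rpow B p / B * sum_f_R0 (fun j => K j * rpow (y j) p) n.
Proof.
  intros Hp HB HK Hy HS.
  assert (HBp := rpow_pos B p HB).
  assert (Hnn : 0 <= sum_f_R0 (fun j => K j * y j) n).
  { apply sum_nonneg. intros j Hj. apply Rmult_le_pos; auto. }
  destruct Hnn as [Hpos|Hz].
  - set (s := sum_f_R0 (fun j => K j * y j) n) in *. set (m := s / B).
    assert (Hm : 0 < m) by now apply Rdiv_lt_0_compat.
    assert (Hmp := rpow_pos m p Hm).
    assert (Hlow : rpow m p * B <= sum_f_R0 (fun j => K j * rpow (y j) p) n).
    { apply Rle_trans with (sum_f_R0 (fun j => K j * (rpow m p * (1 - p)) + K j * y j * (p * (rpow m p / m))) n).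
      - rewrite sum_plus, <- !scal_sum. fold s.
        assert (E : p * (rpow m p / m) * s = p * rpow m p * B) by (unfold m; field; lra).
        rewrite E.
        assert (0 <= rpow m p * (p - 1) * (B - sum_f_R0 K n)).
        { repeat apply Rmult_le_pos; lra. }
        lra.
      - apply sum_Rle. intros j Hj.
        assert (H := rpow_tangent (y j) m p Hp (Hy j Hj) Hm). specialize (HK j Hj).
        replace (K j * (rpow m p * (1 - p)) + K j * y j * (p * (rpow m p / m))) with
          (K j * (rpow m p + p * (rpow m p / m) * (y j - m))) by (field; lra).
        apply Rmult_le_compat_l; lra. }
    replace s with (B * m) by (unfold m; field; lra).
    rewrite rpow_mult by lra.
    apply Rle_trans with (rpow B p / B * (rpow m p * B)); [right; field; lra|].
    apply Rmult_le_compat_l; [left; now apply Rdiv_lt_0_compat|exact Hlow].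
  - rewrite <- Hz, rpow_0. apply Rmult_le_pos; [left; now apply Rdiv_lt_0_compat|].
    apply sum_nonneg. intros j Hj. apply Rmult_le_pos; [auto|apply rpow_ge0].
Qed.

(** With this radius r/(1 - r) = N/c exactly and 1/r = 1 + c/N, so Bernoulli's inequality gives r^N
    <= 1/(1 + c) and the exponential bound gives r^(-N) <= e^c, uniformly in n. *)
Definition rad (n : nat) (c : R) : R := INR (S n) / (INR (S n) + c).

Lemma rad_facts n c : 0 < c -> let r := rad n c in let N := INR (S n) in
  0 < r < 1 /\ r / (1 - r) = N / c /\ (1 - r) * N <= c /\ 1 - r * r <= 2 * c / N /\
  r ^ S n <= / (1 + c) /\ (/ r) ^ S n <= exp c.
Proof.
  intros Hc r N. assert (HN := SINR_pos n). fold N in HN.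
  assert (E : r = N / (N + c)) by reflexivity.
  assert (E1 : 1 - r = c / (N + c)) by (rewrite E; field; lra).
  assert (Hr0 : 0 < r) by (rewrite E; apply Rdiv_lt_0_compat; lra).
  assert (Hr1 : 0 < 1 - r) by (rewrite E1; apply Rdiv_lt_0_compat; lra).
  assert (E2 : (1 - r) * N <= c).
  { rewrite E1. apply Rmult_le_reg_r with (N + c); [lra|].
    replace (c / (N + c) * N * (N + c)) with (c * N) by (field; lra). nra. }
  assert (Ei : / r = 1 + c / N) by (rewrite E; field; lra).
  assert (HcN : 0 < c / N) by now apply Rdiv_lt_0_compat.
  split; [lra|]. split; [rewrite E; field; split; lra|]. split; [exact E2|]. split; [|split].
  - apply Rmult_le_reg_r with N; [exact HN|].
    replace (2 * c / N * N) with (2 * c) by (field; lra). nra.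
  - rewrite <- (Rinv_inv r), Ei, pow_inv. apply Rinv_le_contravar; [lra|].
    assert (H := poly (S n) (c / N) HcN). fold N in H.
    replace (1 + N * (c / N)) with (1 + c) in H by (field; lra). exact H.
  - rewrite Ei. replace (exp c) with (exp (c / N) ^ S n).
    + apply pow_incr. split; [lra|]. apply exp_ineq1_le.
    + assert (Hep : forall k, exp (c / N) ^ k = exp (INR k * (c / N))).
      { induction k as [|k IHk]; [simpl; now rewrite Rmult_0_l, exp_0|].
        rewrite S_INR. simpl. rewrite IHk, <- exp_plus. f_equal. ring. }
      rewrite Hep. f_equal. fold N. field. lra.
Qed.

Lemma ratio_bound rho c : 0 < c -> 0 <= rho -> rho <= / (1 + c) ->
  rho / (1 - rho) <= / c /\ (1 + rho) / (1 - rho) <= 1 + 2 * / c.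
Proof.
  intros Hc H0 H1.
  assert (H2 : rho * (1 + c) <= 1).
  { apply Rle_trans with (/ (1 + c) * (1 + c)); [apply Rmult_le_compat_r; lra|right; field; lra]. }
  assert (H3 : rho < 1) by nra.
  assert (H4 : rho / (1 - rho) <= / c).
  { apply Rmult_le_reg_r with ((1 - rho) * c); [nra|].
    replace (rho / (1 - rho) * ((1 - rho) * c)) with (rho * c) by (field; lra).
    replace (/ c * ((1 - rho) * c)) with (1 - rho) by (field; lra). lra. }
  split; [exact H4|].
  replace ((1 + rho) / (1 - rho)) with (1 + 2 * (rho / (1 - rho))) by (field; lra). lra.
Qed.

Section Config.
Variables (n : nat) (t : nat -> R) (delta c : R).
Hypothesis Hdelta : 0 <= delta <= 1 / 4.
Hypothesis Hc : 1 <= c.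
Let N := INR (S n).
Let a := 2 * PI * delta / N.
Hypothesis Ht : forall j, (j <= n)%nat -> Rabs (t j - tau n j) <= a.
Let r := rad n c.

Lemma cfg_a : 0 <= a <= PI / (2 * N).
Proof.
  assert (HN := SINR_pos n). fold N in HN. assert (HPI := PI_RGT_0). unfold a. split.
  - apply Rmult_le_pos; [nra|left; now apply Rinv_0_lt_compat].
  - replace (PI / (2 * N)) with (PI / 2 / N) by (field; lra).
    apply Rmult_le_compat_r; [left; now apply Rinv_0_lt_compat|nra].
Qed.

Lemma cfg_slow : slow r a = (1 + 2 * PI * delta * / c) ^ 2.
Proof.
  assert (HN := SINR_pos n). fold N in HN.
  destruct (rad_facts n c ltac:(lra)) as (H1 & H2 & _). fold r in H1, H2. fold N in H2.
  unfold slow. replace (r * a / (1 - r)) with (r / (1 - r) * a) by (field; lra).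
  rewrite H2. unfold a. f_equal. field. split; lra.
Qed.

Lemma cfg_u : 0 < / c <= 1.
Proof. split; [apply Rinv_0_lt_compat; lra|]. rewrite <- Rinv_1. apply Rinv_le_contravar; lra. Qed.

Lemma cfg_slow_bound : 0 <= slow r a <= (1 + 2 * / c) ^ 2.
Proof.
  assert (HPI := PI_RGT_0). assert (HP4 := PI_4). assert (Hu := cfg_u).
  rewrite cfg_slow. split; [apply pow2_ge_0|]. apply pow_incr.
  assert (0 <= 2 * PI * delta <= 2) by nra. nra.
Qed.

Lemma cfg_ratio : r ^ S n / (1 - r ^ S n) <= / c /\ (1 + r ^ S n) / (1 - r ^ S n) <= 1 + 2 * / c.
Proof.
  destruct (rad_facts n c ltac:(lra)) as (H1 & _ & _ & _ & H5 & _). fold r in H1, H5.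
  apply ratio_bound; [lra|apply pow_le; lra|exact H5].
Qed.

(** The constant is 9 times 3: for c >= 1 the factor [slow] is at most (1 + 2/c)^2 <= 9 and the
    averaged kernel at most 1 + 2/c <= 3. *)
Lemma cfg_Po_sum x : sum_f_R0 (fun j => poisson r (x - t j)) n <= 27 * N.
Proof.
  assert (HN := SINR_pos n). fold N in HN.
  destruct (rad_facts n c ltac:(lra)) as (H1 & _). fold r in H1.
  eapply Rle_trans; [apply (poisson_nodes_sum n r a t x H1 Ht)|]. fold N.
  destruct cfg_ratio as [_ H2]. assert (Hu := cfg_u). assert (Hs := cfg_slow_bound).
  assert (Hrn := pow_Sn_bound r n ltac:(lra)).
  assert (H3 : 0 <= (1 + r ^ S n) / (1 - r ^ S n)).
  { apply Rmult_le_pos; [lra|left; apply Rinv_0_lt_compat; lra]. }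
  assert (Hs9 : slow r a <= 9).
  { eapply Rle_trans; [apply Hs|]. nra. }
  apply Rle_trans with (9 * (N * 3)); [|lra].
  apply Rmult_le_compat; [apply Hs| |exact Hs9|].
  - apply Rmult_le_pos; lra.
  - apply Rmult_le_compat_l; lra.
Qed.

Lemma cfg_sector : exists C1, forall x,
  Rabs (- sum_f_R0 (fun j => cauchy_arg r (x - t j)) n - C1) <= PI * delta + 27 * / c.
Proof.
  assert (HN := SINR_pos n). fold N in HN. assert (HPI := PI_RGT_0). assert (HP4 := PI_4).
  destruct (rad_facts n c ltac:(lra)) as (H1 & _). fold r in H1.
  assert (Ha := cfg_a).
  destruct (sector_argument n r a t H1 ltac:(lra) Ht) as [C1 HC1].
  exists C1. intro x. eapply Rle_trans; [apply HC1|]. fold N.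
  destruct cfg_ratio as [Hr1 Hr2]. assert (Hu := cfg_u). assert (Hs := cfg_slow_bound).
  assert (Hrn := pow_Sn_bound r n ltac:(lra)).
  assert (H3 : 0 <= (1 + r ^ S n) / (1 - r ^ S n)).
  { apply Rmult_le_pos; [lra|left; apply Rinv_0_lt_compat; lra]. }
  set (q := (1 + r ^ S n) / (1 - r ^ S n)) in *. set (u := / c) in *.
  assert (E : / 2 * a * slow r a * (N * q) = PI * delta * (slow r a * q)).
  { unfold a. field. lra. }
  rewrite E.
  (* For 0 < u <= 1, (1 + 2u)^3 <= 1 + 26 u. With pi delta <= 1 and the first term at most u this
     makes 27 u. *)
  assert (Hsq : slow r a * q <= 1 + 26 * u).
  { apply Rle_trans with ((1 + 2 * u) ^ 2 * (1 + 2 * u)).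
    - apply Rmult_le_compat; lra.
    - assert (u * u <= u) by nra. assert (u * u * u <= u) by nra. nra. }
  assert (Hpd : 0 <= PI * delta <= 1) by nra.
  assert (PI * delta * (slow r a * q) <= PI * delta * (1 + 26 * u)) by (apply Rmult_le_compat_l; lra).
  nra.
Qed.

Lemma EN_polar x : nodal_poly n t (RtoC r * cis x)%C =
  (RtoC (Cmod (nodal_poly n t (RtoC r * cis x)%C)) * cis (- sum_f_R0 (fun j => cauchy_arg r (x - t j)) n))%C.
Proof.
  destruct (rad_facts n c ltac:(lra)) as (H1 & _). fold r in H1.
  unfold nodal_poly at 1. rewrite (cprod_polar _ (fun j => - cauchy_arg r (x - t j))).
  - fold (nodal_poly n t (RtoC r * cis x)%C). f_equal. f_equal.
    rewrite (sum_eq _ (fun j => cauchy_arg r (x - t j) * -1)) by (intros; ring).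
    rewrite <- scal_sum. ring.
  - intros j _. rewrite <- Cmult_assoc, <- cis_add. apply Aa_polar. lra.
Qed.

(** The reflection formula expresses E(1/conj w) by conj E(w), so after multiplication by |E(w)|
    both quotients keep only phases, opposite up to constants. The factor w beside [P'] comes from
    the exponent n + 1 in the reflection formula against the n in the reversal of [P]. *)
Lemma twist_identity P P' C1 x : (forall w : C, w <> 0%C -> P' w = (w ^ n * Cconj (P (/ Cconj w)))%C) ->
  let phi := - sum_f_R0 (fun j => cauchy_arg r (x - t j)) n - C1 in
  (cis (- phi) * (cis (- C1) * P (RtoC r * cis x))
   - cis phi * Cconj (cis (- C1) * kap n t * ((RtoC r * cis x) * P' (RtoC r * cis x))))%C =
  (RtoC (Cmod (nodal_poly n t (RtoC r * cis x))) * (P (RtoC r * cis x) / nodal_poly n t (RtoC r * cis x)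
     - P (RtoC (/ r) * cis x) / nodal_poly n t (RtoC (/ r) * cis x)))%C.
Proof.
  intros HP' phi.
  destruct (rad_facts n c ltac:(lra)) as (H1 & _). fold r in H1.
  set (psi := phi + C1).
  assert (Hpsi : psi = - sum_f_R0 (fun j => cauchy_arg r (x - t j)) n) by (unfold psi, phi; ring).
  assert (HE := EN_polar x). rewrite <- Hpsi in HE.
  set (E := nodal_poly n t (RtoC r * cis x)%C) in *. set (m := Cmod E) in *.
  assert (Hm : 0 < m).
  { apply Cmod_gt_0. apply EN_neq_0. rewrite Cmod_RtoC_cis; lra. }
  assert (Hmc : RtoC m <> 0%C) by (intro H; apply (f_equal fst) in H; simpl in H; lra).
  assert (HRc : RtoC r <> 0%C) by (intro H; apply (f_equal fst) in H; simpl in H; lra).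
  set (W := (RtoC r * cis x)%C) in *.
  assert (HW : W <> 0%C) by (apply Cmult_neq_0; [exact HRc|apply cis_neq_0]).
  assert (HcW : Cconj W = (RtoC r * cis (- x))%C).
  { unfold W. rewrite Cmult_conj, cis_conj. f_equal. apply C_eq; simpl; ring. }
  assert (HcW0 : Cconj W <> 0%C) by (rewrite HcW; apply Cmult_neq_0; [exact HRc|apply cis_neq_0]).
  assert (HW' : (RtoC (/ r) * cis x)%C = (/ Cconj W)%C).
  { rewrite HcW, RtoC_inv by lra.
    transitivity (/ (RtoC r * cis (- x)) * (cis (- x) * cis x))%C.
    - field. split; [apply cis_neq_0|exact HRc].
    - rewrite cis_inv_l. ring. }
  assert (HEr := EN_reflect n t r H1 x). fold W in HEr. fold E in HEr.
  assert (HE' := EN_outer_neq_0 n t r H1 x).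
  rewrite HW' in HEr, HE' |- *.
  set (E' := nodal_poly n t (/ Cconj W)%C) in *.
  rewrite (HP' W HW). rewrite !Cmult_conj, Cpow_conj, Cconj_conj, cis_conj, Ropp_involutive.
  set (PW := P W). set (PW' := P (/ Cconj W)%C).
  assert (HcE : Cconj E = (RtoC m * cis (- psi))%C).
  { rewrite HE, Cmult_conj, cis_conj. f_equal. apply C_eq; simpl; ring. }
  assert (Hkk : (kap n t * Cconj (kap n t))%C = 1%C).
  { rewrite <- Cmod2_conj, kap_mod. apply C_eq; simpl; ring. }
  assert (Hkey : (E' * (Cconj (kap n t) * Cconj W ^ S n) = RtoC m * cis (- psi))%C).
  { rewrite HEr, HcE. rewrite Cpow_inv by exact HcW0.
    assert (Hp := Cpow_nz (Cconj W) (S n) HcW0).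
    transitivity ((kap n t * Cconj (kap n t)) * (RtoC m * cis (- psi)))%C.
    - field. exact Hp.
    - rewrite Hkk. ring. }
  assert (Hc1 : cis phi = (cis psi * cis (- C1))%C) by (rewrite <- cis_add; f_equal; unfold psi; ring).
  assert (Hc2 : cis (- phi) = (cis (- psi) * cis C1)%C) by (rewrite <- cis_add; f_equal; unfold psi; ring).
  assert (Hcc := cis_inv_l C1). assert (Hcp := cis_inv_l psi).
  assert (T1 : (cis (- phi) * (cis (- C1) * PW))%C = (RtoC m * (PW / E))%C).
  { rewrite Hc2, HE.
    transitivity (cis (- psi) * PW * (cis (- C1) * cis C1))%C; [ring|]. rewrite Hcc.
    transitivity (RtoC m * (PW / (RtoC m * cis psi)) * (cis (- psi) * cis psi))%C.
    - field. split; [apply cis_neq_0|exact Hmc].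
    - rewrite Hcp. ring. }
  assert (T2 : (cis phi * (cis C1 * Cconj (kap n t) * (Cconj W * (Cconj W ^ n * PW'))))%C
    = (RtoC m * (PW' / E'))%C).
  { rewrite Hc1.
    transitivity (cis psi * PW' * (cis (- C1) * cis C1) * (E' * (Cconj (kap n t) * Cconj W ^ S n)) / E')%C.
    - rewrite Cpow_S. field. exact HE'.
    - rewrite Hkey, Hcc.
      transitivity (PW' * RtoC m * (cis (- psi) * cis psi) / E')%C; [field; exact HE'|].
      rewrite Hcp. field. exact HE'. }
  rewrite T1, T2. ring.
Qed.

End Config.

Lemma RInt_circle_pos p n F rho : 0 < p -> poly_le n F ->
  is_RInt (fun x => rpow (Cmod (F (RtoC rho * cis x)%C)) p) 0 (2 * PI)
    (RInt (fun x => rpow (Cmod (F (RtoC rho * cis x)%C)) p) 0 (2 * PI)).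
Proof.
  intros Hp HF. apply isR_correct, ex_RInt_cont. intro t.
  exact (poly_le_rpow_continuous n rho p F Hp HF t).
Qed.

Lemma RInt_ge0 (f : R -> R) a b : a <= b -> ex_RInt f a b -> (forall x, 0 <= f x) -> 0 <= RInt f a b.
Proof. intros Hab Hf H. apply RInt_ge_0; [exact Hab|exact Hf|intros; apply H]. Qed.

Lemma sector_const_choice q delta : 0 <= delta < 1 / (2 * q) -> 0 < q ->
  exists c, 1 <= c /\ 2 * (PI * delta + 27 * / c) < PI / q.
Proof.
  intros Hd Hq. assert (HPI := PI_RGT_0).
  set (gap := PI / q - 2 * PI * delta).
  assert (Hgap : 0 < gap).
  { unfold gap. assert (H : 2 * PI * delta < 2 * PI * (1 / (2 * q))) by (apply Rmult_lt_compat_l; lra).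
    replace (2 * PI * (1 / (2 * q))) with (PI / q) in H by (field; lra). lra. }
  (* Twice 27/c has to stay strictly below [gap]; 55 is the next integer after 54. *)
  exists (Rmax 1 (55 / gap)). split; [apply Rmax_l|].
  assert (H55 : 0 < 55 / gap) by (apply Rdiv_lt_0_compat; lra).
  assert (H : / Rmax 1 (55 / gap) <= / (55 / gap)) by (apply Rinv_le_contravar; [exact H55|apply Rmax_r]).
  replace (/ (55 / gap)) with (gap / 55) in H by (field; lra).
  unfold gap in *. lra.
Qed.

Lemma q_ge_2 p : 1 < p -> 2 <= Rmax p (p / (p - 1)).
Proof.
  intro Hp. destruct (Rle_dec 2 p) as [H|H].
  - eapply Rle_trans; [exact H|apply Rmax_l].
  - eapply Rle_trans; [|apply Rmax_r].
    apply Rmult_le_reg_r with (p - 1); [lra|]. replace (p / (p - 1) * (p - 1)) with p by (field; lra). lra.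
Qed.

Lemma delta_le_quarter p delta : 1 < p -> delta < 1 / (2 * Rmax p (p / (p - 1))) -> delta <= 1 / 4.
Proof.
  intros Hp Hd. assert (H := q_ge_2 p Hp).
  assert (1 / (2 * Rmax p (p / (p - 1))) <= 1 / 4); [|lra].
  unfold Rdiv at 1. rewrite Rmult_1_l. replace (1 / 4) with (/ 4) by field.
  apply Rinv_le_contravar; lra.
Qed.

(* The kernel integral: sectoriality of the nodal polynomial turns its modulus into
   the real part of a polynomial, to which the Poisson formula applies. *)
Lemma kernel_column_integral n t delta c j : 0 <= delta <= 1 / 4 -> 1 <= c ->
  PI * delta + 27 * / c <= PI / 4 ->
  (forall j, (j <= n)%nat -> Rabs (t j - tau n j) <= 2 * PI * delta / INR (S n)) -> (j <= n)%nat ->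
  let r := rad n c in
  let Kj := fun x => Cmod (nodal_poly n t (RtoC r * cis x)%C) * (poisson r (x - t j) / Cmod (nodal_at_node n t j)) in
  ex_RInt Kj 0 (2 * PI) /\
  RInt Kj 0 (2 * PI) <= 8 * PI * c * exp (27 * c * (c * c / 4 + 1)) / INR (S n).
Proof.
  intros Hdelta Hc Hsmall Ht Hj r Kj. assert (HPI := PI_RGT_0).
  assert (HN := SINR_pos n). set (N := INR (S n)) in *.
  destruct (rad_facts n c ltac:(lra)) as (Hr & _ & HrN & Hr2 & _). fold r in Hr, HrN, Hr2. fold N in HrN, Hr2.
  destruct (cfg_sector n t delta c Hdelta Hc Ht) as [C1 HC1]. fold r in HC1.
  assert (Ha := cfg_a n delta Hdelta).
  assert (Hdist := nodes_distinct n t _ (proj2 Ha) Ht).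
  assert (Hej : 0 < Cmod (nodal_at_node n t j)) by (apply Cmod_gt_0; apply ej_neq_0; [exact Hdist|exact Hj]).
  assert (HexK : ex_RInt Kj 0 (2 * PI)).
  { apply ex_RInt_cont. intro x. unfold Kj. apply contR_mult.
    - apply (poly_le_Cmod_continuous (S n) r (nodal_poly n t) (poly_le_EN n t)).
    - apply (contR_mult (fun x => poisson r (x - t j)) (fun _ => / Cmod (nodal_at_node n t j))).
      + apply poisson_continuous. lra.
      + apply continuous_const. }
  split; [exact HexK|].
  set (F := fun w => (cis (- C1) * nodal_poly n t w)%C).
  assert (HF : poly_le (S n) F) by (apply poly_le_scal, poly_le_EN).
  assert (HPf := Poisson_formula r r (t j) (S n) F Hr HF).
  (* The argument of the rotated polynomial is at most pi/4 < pi/3 in absolute value, and cos(pi/3)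
     = 1/2. *)
  assert (Hcos : forall x, Cmod (nodal_poly n t (RtoC r * cis x)%C) <= 2 * fst (F (RtoC r * cis x)%C)).
  { intro x. unfold F. assert (HE := EN_polar n t c Hc x). fold r in HE.
    set (m := Cmod (nodal_poly n t (RtoC r * cis x)%C)) in *. rewrite HE.
    set (ps := - sum_f_R0 (fun j => cauchy_arg r (x - t j)) n) in *.
    assert (E : (cis (- C1) * (RtoC m * cis ps))%C = (RtoC m * cis (ps - C1))%C).
    { unfold Rminus. rewrite cis_add. ring. }
    rewrite E. cbn [fst Cmult RtoC cis snd].
    assert (H1 : cos (PI / 3) <= cos (ps - C1)).
    { apply cos_mono_abs; [|lra]. eapply Rle_trans; [apply HC1|]. lra. }
    rewrite cos_PI3 in H1. assert (0 <= m) by apply Cmod_ge_0. nra. }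
  (* The Poisson integral over |w| = r returns [F] at radius r^2 in the direction of the node, where
     [EN_at_node] compares it with [nodal_at_node]. *)
  assert (HK : RInt Kj 0 (2 * PI) <= 2 / Cmod (nodal_at_node n t j) * (2 * PI * fst (F (RtoC (r * r) * cis (t j))%C))).
  { apply (is_RInt_le Kj (fun x => 2 / Cmod (nodal_at_node n t j) * (poisson r (x - t j) * fst (F (RtoC r * cis x)%C))) 0 (2 * PI)).
    - lra.
    - now apply isR_correct.
    - apply isR_scal. exact HPf.
    - intros x _. unfold Kj. specialize (Hcos x).
      assert (HP : 0 < poisson r (x - t j)) by (apply poisson_pos; lra).
      assert (Hi : 0 < poisson r (x - t j) / Cmod (nodal_at_node n t j)) by now apply Rdiv_lt_0_compat.
      apply Rle_trans with (2 * fst (F (RtoC r * cis x)%C) * (poisson r (x - t j) / Cmod (nodal_at_node n t j))).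
      + apply Rmult_le_compat_r; lra.
      + right. field. lra. }
  eapply Rle_trans; [exact HK|].
  assert (HFm : fst (F (RtoC (r * r) * cis (t j))%C) <= Cmod (nodal_poly n t (RtoC (r * r) * cis (t j))%C)).
  { eapply Rle_trans; [apply Rle_abs|]. eapply Rle_trans; [apply re_le_Cmod|].
    unfold F. rewrite Cmod_mult, cis_mod. lra. }
  assert (HEN := EN_at_node n t _ (proj2 Ha) Ht r Hr j c Hj HrN ltac:(lra)).
  assert (Hexp : (1 - r * r) * (c * c / 4 + 1) / 2 * sum_f_R0 (fun k => poisson r (t j - t k)) n <=
    27 * c * (c * c / 4 + 1)).
  { assert (HS := cfg_Po_sum n t delta c Hdelta Hc Ht (t j)). fold r in HS. fold N in HS.
    assert (Hc4 : 0 <= c * c / 4 + 1) by nra.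
    apply Rle_trans with ((2 * c / N) * (c * c / 4 + 1) / 2 * (27 * N)).
    - apply Rmult_le_compat; [|apply sum_nonneg; intros; left; apply poisson_pos; lra| |exact HS].
      + apply Rmult_le_pos; [apply Rmult_le_pos; nra|lra].
      + apply Rmult_le_compat_r; [lra|]. apply Rmult_le_compat_r; lra.
    - right. field. lra. }
  set (ee := exp (27 * c * (c * c / 4 + 1))) in *.
  assert (Hee : exp ((1 - r * r) * (c * c / 4 + 1) / 2 * sum_f_R0 (fun k => poisson r (t j - t k)) n) <= ee).
  { destruct Hexp as [H|H]; [left; now apply exp_increasing|unfold ee; rewrite <- H; lra]. }
  set (e1 := exp _) in HEN, Hee.
  assert (He1 : 0 < e1) by apply exp_pos.
  assert (Hfin : Cmod (nodal_poly n t (RtoC (r * r) * cis (t j))%C) <= 2 * c / N * Cmod (nodal_at_node n t j) * ee).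
  { eapply Rle_trans; [exact HEN|]. apply Rmult_le_compat; [|lra| |exact Hee].
    - apply Rmult_le_pos; [nra|lra].
    - apply Rmult_le_compat_r; lra. }
  apply Rle_trans with (2 / Cmod (nodal_at_node n t j) * (2 * PI * (2 * c / N * Cmod (nodal_at_node n t j) * ee))).
  - apply Rmult_le_compat_l; [left; apply Rdiv_lt_0_compat; lra|].
    apply Rmult_le_compat_l; [lra|]. lra.
  - right. field. lra.
Qed.

Lemma integral_le_sample_sum p delta : 1 < p -> 0 <= delta -> delta < 1 / (2 * Rmax p (p / (p - 1))) ->
  exists C0, 0 < C0 /\ forall n t,
  (forall j, (j <= n)%nat -> Rabs (t j - tau n j) <= 2 * PI * delta / INR (S n)) ->
  forall P, poly_le n P ->
  RInt (fun x => rpow (Cmod (P (cis x))) p) 0 (2 * PI) <=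
  C0 / INR (S n) * sum_f_R0 (fun j => rpow (Cmod (P (cis (t j)))) p) n.
Proof.
  intros Hp Hd0 Hd. assert (HPI := PI_RGT_0).
  set (q := Rmax p (p / (p - 1))) in *. assert (Hq := q_ge_2 p Hp). fold q in Hq.
  assert (Hd4 := delta_le_quarter p delta Hp Hd).
  destruct (sector_const_choice q delta ltac:(lra) ltac:(lra)) as (c & Hc & Hcq).
  assert (Hc0 : 0 < / c) by (apply Rinv_0_lt_compat; lra).
  set (Theta := 2 * (PI * delta + 27 * / c)) in *.
  assert (HTh0 : 0 <= Theta) by (unfold Theta; assert (0 <= PI * delta) by (apply Rmult_le_pos; lra); lra).
  destruct (sector_integral p Theta Hp (conj HTh0 Hcq)) as (C2 & HC2 & Hsec).
  assert (Hq4 : PI / q <= PI / 2) by (apply Rmult_le_compat_l; [lra|apply Rinv_le_contravar; lra]).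
  assert (Hsmall : PI * delta + 27 * / c <= PI / 4) by (unfold Theta in Hcq; lra).
  set (MK := 8 * PI * c * exp (27 * c * (c * c / 4 + 1))).
  assert (HMK : 0 < MK) by (unfold MK; apply Rmult_lt_0_compat; [apply Rmult_lt_0_compat; lra|apply exp_pos]).
  assert (H4p : 0 < rpow 4 p) by (apply rpow_pos; lra).
  assert (H2p : 0 < rpow 2 p) by (apply rpow_pos; lra).
  assert (Hecp : 0 < rpow (exp c) p) by (apply rpow_pos, exp_pos).
  exists (rpow 2 p * (rpow (exp c) p * (C2 * (rpow 4 p / 4 * MK)))). split.
  { clearbody MK. repeat apply Rmult_lt_0_compat; lra. }
  intros n t Ht P HP.
  assert (HN := SINR_pos n). set (N := INR (S n)) in *.
  assert (Hdelta : 0 <= delta <= 1 / 4) by lra.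
  set (r := rad n c).
  destruct (rad_facts n c ltac:(lra)) as (Hr & _ & HrN & Hr2 & _ & Hri). fold r in Hr, HrN, Hr2, Hri.
  destruct (cfg_sector n t delta c Hdelta Hc Ht) as [C1 HC1]. fold r in HC1.
  destruct (cfg_a n delta Hdelta) as [Ha0 Ha].
  assert (Hdist := nodes_distinct n t _ Ha Ht).
  destruct (poly_le_reverse n P HP) as (P' & HP'pd & HP').
  set (phi := fun x => - sum_f_R0 (fun j => cauchy_arg r (x - t j)) n - C1).
  set (F := fun w => (cis (- C1) * P w)%C).
  set (H := fun w => (cis (- C1) * kap n t * (w * P' w))%C).
  set (S1 := sum_f_R0 (fun j => rpow (Cmod (P (cis (t j)))) p) n).
  set (Kj := fun j x => Cmod (nodal_poly n t (RtoC r * cis x)%C) * (poisson r (x - t j) / Cmod (nodal_at_node n t j))).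
  (* Majorant for the p-th power of |E| times the jump: Jensen's inequality with row sums at most 4.
     Its integral is then controlled by the column integrals. *)
  set (U := fun x => rpow 4 p / 4 * sum_f_R0 (fun j => rpow (Cmod (P (cis (t j)))) p * Kj j x) n).
  assert (HU : is_RInt U 0 (2 * PI)
    (rpow 4 p / 4 * sum_f_R0 (fun j => rpow (Cmod (P (cis (t j)))) p * RInt (Kj j) 0 (2 * PI)) n)).
  { apply isR_scal. apply (isR_sum (fun j x => rpow (Cmod (P (cis (t j)))) p * Kj j x)).
    intros j Hj. apply isR_scal. apply isR_correct.
    exact (proj1 (kernel_column_integral n t delta c j Hdelta Hc Hsmall Ht Hj)). }
  assert (HFpd : poly_le (S n) F) by (apply poly_le_S, poly_le_scal; exact HP).
  assert (HHpd : poly_le (S n) H) by (apply poly_le_scal, poly_le_mulX; exact HP'pd).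
  assert (HH0 : H 0%C = 0%C) by (unfold H; ring).
  assert (Hphi : forall x, Rabs (2 * phi x) <= Theta).
  { intro x. rewrite Rabs_mult, (Rabs_pos_eq 2) by lra. unfold Theta, phi.
    apply Rmult_le_compat_l; [lra|apply HC1]. }
  assert (Hexpr : exp (ln r) = r) by (apply exp_ln; lra).
  assert (Hej : forall j, (j <= n)%nat -> 0 < Cmod (nodal_at_node n t j)).
  { intros j Hj. apply Cmod_gt_0. apply ej_neq_0; [exact Hdist|exact Hj]. }
  assert (HD : forall x, rpow (Cmod (cis (- phi x) * F (RtoC (exp (ln r)) * cis x)
      - cis (phi x) * Cconj (H (RtoC (exp (ln r)) * cis x)))%C) p <= U x).
  { intro x. rewrite Hexpr.
    assert (Etw := twist_identity n t c Hc P P' C1 x HP'). cbv zeta in Etw.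
    fold r in Etw. fold (phi x) in Etw. unfold F, H. rewrite Etw.
    rewrite (jump_formula n t _ Ha Ht r Hr P x HP).
    set (m := Cmod (nodal_poly n t (RtoC r * cis x)%C)).
    assert (Hm0 : 0 < m).
    { apply Cmod_gt_0. apply EN_neq_0. rewrite Cmod_RtoC_cis; lra. }
    assert (HKnn : forall j, (j <= n)%nat -> 0 <= Kj j x).
    { intros j Hj. unfold Kj. fold m. apply Rmult_le_pos; [lra|].
      apply Rmult_le_pos; [left; apply poisson_pos; lra|left; apply Rinv_0_lt_compat; now apply Hej]. }
    assert (Hmod : Cmod (RtoC m * csum (fun j => P (cis (t j)) / nodal_at_node n t j * RtoC (poisson r (x - t j))) n)%C <=
      sum_f_R0 (fun j => Kj j x * Cmod (P (cis (t j)))) n).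
    { rewrite <- csum_scal. eapply Rle_trans; [apply csum_triangle|].
      apply sum_Rle. intros j Hj. right. unfold Cdiv. rewrite !Cmod_mult, !Cmod_R, Cmod_inv.
      2:{ apply ej_neq_0; [exact Hdist|exact Hj]. }
      rewrite (Rabs_pos_eq m), (Rabs_pos_eq (poisson _ _)) by (try lra; left; apply poisson_pos; lra).
      unfold Kj. fold m. field. generalize (Hej j Hj). lra. }
    (* The bound 2 / cos(pi delta) is at most 4, since pi delta <= pi/4 < pi/3. *)
    assert (HKsum : sum_f_R0 (fun j => Kj j x) n <= 4).
    { assert (Hrow := kernel_row_sum n t _ Ha Ht r Hr x). fold m in Hrow.
      assert (Ena : INR (S n) * (2 * PI * delta / INR (S n)) / 2 = PI * delta) by (field; fold N; lra).
      rewrite Ena in Hrow.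
      assert (Hpd : 0 <= PI * delta <= PI / 4) by (split; [apply Rmult_le_pos; lra|nra]).
      specialize (Hrow ltac:(lra)).
      assert (Hcos : / 2 <= cos (PI * delta)).
      { assert (H1 : cos (PI / 3) <= cos (PI * delta)) by (apply cos_decr_1; lra).
        rewrite cos_PI3 in H1. lra. }
      unfold Kj. fold m.
      rewrite (sum_eq _ (fun j => poisson r (x - t j) / Cmod (nodal_at_node n t j) * m)) by (intros; ring).
      rewrite <- scal_sum.
      set (sm := sum_f_R0 (fun j => poisson r (x - t j) / Cmod (nodal_at_node n t j)) n) in *.
      assert (Hsm : 0 <= sm).
      { apply sum_nonneg. intros j Hj. apply Rmult_le_pos; [left; apply poisson_pos; lra|left; apply Rinv_0_lt_compat; now apply Hej]. }
      assert (sm * / 2 <= 2 / m) by nra.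
      apply Rle_trans with (m * (4 / m)); [apply Rmult_le_compat_l; lra|right; field; lra]. }
    eapply Rle_trans.
    { apply rpow_le; [lra|]. split; [apply Cmod_ge_0|exact Hmod]. }
    eapply Rle_trans.
    { apply (rpow_jensen_sum p 4 (fun j => Kj j x) (fun j => Cmod (P (cis (t j)))) n); try lra.
      exact HKnn. intros; apply Cmod_ge_0. }
    unfold U. right. f_equal. apply sum_eq. intros; ring. }
  assert (HexU : ex_RInt U 0 (2 * PI)) by (eexists; exact HU).
  assert (Hmain := Hsec (S n) F H (ln r) phi U HFpd HHpd HH0 Hphi HexU HD).
  rewrite Hexpr in Hmain. rewrite (isR_unique _ _ _ _ HU) in Hmain.
  (* Of the two integrals only that of [H] is kept: on |w| = r it describes [P] on the larger circle
     of radius 1/r, and means do not increase, up to 2^p, on the way in to the unit circle. *)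
  set (IH := RInt (fun x => rpow (Cmod (H (RtoC r * cis x)%C)) p) 0 (2 * PI)) in Hmain.
  assert (HIF : 0 <= RInt (fun x => rpow (Cmod (F (RtoC r * cis x)%C)) p) 0 (2 * PI)).
  { apply RInt_ge0; [lra| |intro; apply rpow_ge0]. eexists. apply (RInt_circle_pos p (S n)); [lra|exact HFpd]. }
  assert (HKs : sum_f_R0 (fun j => rpow (Cmod (P (cis (t j)))) p * RInt (Kj j) 0 (2 * PI)) n <= MK / N * S1).
  { unfold S1. rewrite scal_sum. apply sum_Rle. intros j Hj.
    apply Rmult_le_compat_l; [apply rpow_ge0|].
    exact (proj2 (kernel_column_integral n t delta c j Hdelta Hc Hsmall Ht Hj)). }
  assert (HIH : IH <= C2 * (rpow 4 p / 4 * (MK / N * S1))).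
  { apply Rle_trans with (C2 * (rpow 4 p / 4 * sum_f_R0 (fun j => rpow (Cmod (P (cis (t j)))) p * RInt (Kj j) 0 (2 * PI)) n)).
    - lra.
    - apply Rmult_le_compat_l; [lra|]. apply Rmult_le_compat_l; [lra|exact HKs]. }
  assert (Hri0 : 0 < / r) by (apply Rinv_0_lt_compat; lra).
  (* On |w| = r the modulus of [H] is r^N times that of [P] at the reflected point, and r^(-N) <=
     e^c. *)
  assert (HPout : RInt (fun x => rpow (Cmod (P (RtoC (/ r) * cis x)%C)) p) 0 (2 * PI) <= rpow (exp c) p * IH).
  { apply (is_RInt_le (fun x => rpow (Cmod (P (RtoC (/ r) * cis x)%C)) p)
      (fun x => rpow (exp c) p * rpow (Cmod (H (RtoC r * cis x)%C)) p) 0 (2 * PI)).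
    - lra.
    - apply (RInt_circle_pos p n); [lra|exact HP].
    - apply isR_scal. apply (RInt_circle_pos p (S n)); [lra|exact HHpd].
    - intros x _. rewrite <- rpow_mult by (try apply Cmod_ge_0; left; apply exp_pos).
      apply rpow_le; [lra|]. split; [apply Cmod_ge_0|].
      unfold H. rewrite !Cmod_mult, cis_mod, kap_mod.
      assert (HRc : RtoC r <> 0%C) by (intro E; apply (f_equal fst) in E; simpl in E; lra).
      assert (HW : (RtoC r * cis x)%C <> 0%C) by (apply Cmult_neq_0; [exact HRc|apply cis_neq_0]).
      rewrite (HP' _ HW). rewrite Cmod_mult, Cmod_conj, Cmod_pow, Cmod_mult, cis_mod, Cmod_R, Rabs_pos_eq by lra.
      assert (EW : (/ Cconj (RtoC r * cis x))%C = (RtoC (/ r) * cis x)%C).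
      { rewrite Cmult_conj, cis_conj.
        replace (Cconj (RtoC r)) with (RtoC r) by (apply C_eq; simpl; ring).
        rewrite RtoC_inv by lra.
        transitivity (/ (RtoC r * cis (- x)) * (cis (- x) * cis x))%C.
        - rewrite cis_inv_l. ring.
        - field. split; (exact HRc || exact (cis_neq_0 _)). }
      rewrite EW. set (v := Cmod (P (RtoC (/ r) * cis x)%C)).
      assert (Hv : 0 <= v) by apply Cmod_ge_0.
      assert (Hrp : 0 < r ^ S n) by (apply pow_lt; lra).
      replace (exp c * (1 * 1 * (r * 1 * ((r * 1) ^ n * v)))) with (exp c * r ^ S n * v)
        by (rewrite !Rmult_1_r; simpl; ring).
      assert (1 <= exp c * r ^ S n).
      { rewrite pow_inv in Hri.
        apply Rle_trans with (/ r ^ S n * r ^ S n); [right; field; lra|]. apply Rmult_le_compat_r; lra. }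
      nra. }
  assert (Hmono := rpow_mean_mono p n P 0 (ln (/ r)) ltac:(lra) HP).
  rewrite exp_0, exp_ln in Hmono by exact Hri0.
  assert (Hln : 0 <= ln (/ r)).
  { rewrite <- ln_1. apply ln_le; [lra|]. rewrite <- Rinv_1. apply Rinv_le_contravar; lra. }
  specialize (Hmono Hln).
  assert (Ecirc : RInt (fun x => rpow (Cmod (P (RtoC 1 * cis x)%C)) p) 0 (2 * PI) =
    RInt (fun x => rpow (Cmod (P (cis x))) p) 0 (2 * PI)).
  { apply RInt_ext. intros x _. now rewrite Cmult_1_l. }
  rewrite Ecirc in Hmono.
  eapply Rle_trans; [exact Hmono|].
  replace (rpow 2 p * (rpow (exp c) p * (C2 * (rpow 4 p / 4 * MK))) / N * S1) with
    (rpow 2 p * (rpow (exp c) p * (C2 * (rpow 4 p / 4 * (MK / N * S1))))) by (field; lra).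
  apply Rmult_le_compat_l; [lra|].
  eapply Rle_trans; [exact HPout|]. apply Rmult_le_compat_l; [lra|exact HIH].
Qed.

(* Poisson's formula and Jensen's inequality. *)
Lemma rpow_Poisson_le r rho p t0 n P : 0 < r < 1 -> 1 <= p -> poly_le n P ->
  2 * PI * rpow (Cmod (P (RtoC (rho * r) * cis t0)%C)) p <=
  RInt (fun x => poisson r (x - t0) * rpow (Cmod (P (RtoC rho * cis x)%C)) p) 0 (2 * PI).
Proof.
  intros Hr Hp HP. assert (HPI := PI_RGT_0).
  set (z := P (RtoC (rho * r) * cis t0)%C). set (m := Cmod z).
  assert (Hex : ex_RInt (fun x => poisson r (x - t0) * rpow (Cmod (P (RtoC rho * cis x)%C)) p) 0 (2 * PI)).
  { apply ex_RInt_cont. intro x. apply contR_mult; [apply poisson_continuous; lra|].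
    apply (poly_le_rpow_continuous n); [lra|exact HP]. }
  destruct (Cmod_ge_0 z) as [Hm|Hm].
  2:{ fold m. unfold m. rewrite <- Hm, rpow_0, Rmult_0_r. apply RInt_ge0; [lra|exact Hex|].
      intro x. apply Rmult_le_pos; [left; apply poisson_pos; lra|apply rpow_ge0]. }
  fold m in Hm |- *.
  (* Rotation by -[lam] makes the value at the target point equal to its modulus m, so the formula
     for the real part returns m; the tangent line of x^p at m then gives Jensen's inequality. *)
  destruct (cis_polar z) as [lam Hlam]. fold m in Hlam.
  set (F := fun w => (cis (- lam) * P w)%C).
  assert (HF : poly_le n F) by now apply poly_le_scal.
  assert (HPf := Poisson_formula r rho t0 n F Hr HF).
  assert (EF : fst (F (RtoC (rho * r) * cis t0)%C) = m).
  { unfold F. fold z. rewrite Hlam.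
    transitivity (fst (RtoC m * (cis (- lam) * cis lam))%C); [f_equal; ring|].
    rewrite cis_inv_l. simpl. ring. }
  rewrite EF in HPf.
  assert (HP1 := Poisson_formula r rho t0 0 (fun _ => 1%C) Hr (poly_le_const 0 1%C)). simpl fst in HP1.
  assert (Hmp := rpow_pos m p Hm).
  assert (Hcmb := isR_plus _ _ _ _ _ _ (isR_scal _ (rpow m p * (1 - p)) _ _ _ HP1)
    (isR_scal _ (p * (rpow m p / m)) _ _ _ HPf)). cbv beta in Hcmb.
  apply Rle_trans with (rpow m p * (1 - p) * (2 * PI * 1) + p * (rpow m p / m) * (2 * PI * m)).
  { right. field. lra. }
  refine (is_RInt_le _ _ 0 (2 * PI) _ _ ltac:(lra) Hcmb (isR_correct _ _ _ Hex) _).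
  intros x _.
  assert (HPo : 0 < poisson r (x - t0)) by (apply poisson_pos; lra).
  assert (Hre : fst (F (RtoC rho * cis x)%C) <= Cmod (P (RtoC rho * cis x)%C)).
  { eapply Rle_trans; [apply Rle_abs|]. eapply Rle_trans; [apply re_le_Cmod|].
    unfold F. rewrite Cmod_mult, cis_mod. lra. }
  assert (Htan := rpow_tangent (Cmod (P (RtoC rho * cis x)%C)) m p Hp (Cmod_ge_0 _) Hm).
  assert (Hk : 0 <= p * (rpow m p / m)).
  { apply Rmult_le_pos; [lra|]. left; now apply Rdiv_lt_0_compat. }
  apply Rle_trans with (poisson r (x - t0) * (rpow m p + p * (rpow m p / m) * (fst (F (RtoC rho * cis x)%C) - m))).
  { right. field. lra. }
  apply Rmult_le_compat_l; [lra|]. eapply Rle_trans; [|exact Htan].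
  apply Rplus_le_compat_l, Rmult_le_compat_l; lra.
Qed.

(** Poisson's formula is used from |w| = 1/r inwards to the unit circle, with c = 1, and the kernels
    of the nodes sum to at most 27 N. The reversed polynomial transfers the mean over |w| = 1/r to
    |w| = r, from where means increase, up to 2^p, to the unit circle. *)
Lemma sample_sum_le_integral p delta : 1 < p -> 0 <= delta <= 1 / 4 ->
  exists C0, 0 < C0 /\ forall n t,
  (forall j, (j <= n)%nat -> Rabs (t j - tau n j) <= 2 * PI * delta / INR (S n)) ->
  forall P, poly_le n P ->
  / INR (S n) * sum_f_R0 (fun j => rpow (Cmod (P (cis (t j)))) p) n <=
  C0 * RInt (fun x => rpow (Cmod (P (cis x))) p) 0 (2 * PI).
Proof.
  intros Hp Hdelta. assert (HPI := PI_RGT_0).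
  assert (H2p : 0 < rpow 2 p) by (apply rpow_pos; lra).
  assert (Hep : 0 < rpow (exp 1) p) by (apply rpow_pos, exp_pos).
  exists (27 / (2 * PI) * (rpow (exp 1) p * rpow 2 p)). split.
  { apply Rmult_lt_0_compat; [apply Rdiv_lt_0_compat; lra|apply Rmult_lt_0_compat; lra]. }
  intros n t Ht P HP. assert (HN := SINR_pos n). set (N := INR (S n)) in *.
  set (r := rad n 1).
  destruct (rad_facts n 1 ltac:(lra)) as (Hr & _ & _ & _ & _ & Hri). fold r in Hr, Hri.
  assert (Hri0 : 0 < / r) by (apply Rinv_0_lt_compat; lra).
  set (g := fun x => rpow (Cmod (P (RtoC (/ r) * cis x)%C)) p).
  assert (Hg : forall x, continuous g x).
  { intro x. apply (poly_le_rpow_continuous n); [lra|exact HP]. }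
  assert (Hone : forall j, (j <= n)%nat ->
    2 * PI * rpow (Cmod (P (cis (t j)))) p <= RInt (fun x => poisson r (x - t j) * g x) 0 (2 * PI)).
  { intros j _. assert (H := rpow_Poisson_le r (/ r) p (t j) n P Hr ltac:(lra) HP).
    rewrite Rinv_l, Cmult_1_l in H by lra. exact H. }
  set (G := RInt g 0 (2 * PI)).
  assert (isG : is_RInt g 0 (2 * PI) G) by (apply isR_correct, ex_RInt_cont; exact Hg).
  assert (Hsum : 2 * PI * sum_f_R0 (fun j => rpow (Cmod (P (cis (t j)))) p) n <= 27 * N * G).
  { apply Rle_trans with (sum_f_R0 (fun j => RInt (fun x => poisson r (x - t j) * g x) 0 (2 * PI)) n).
    - rewrite scal_sum. apply sum_Rle. intros j Hj. rewrite Rmult_comm. now apply Hone.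
    - assert (Hs : is_RInt (fun x => sum_f_R0 (fun j => poisson r (x - t j) * g x) n) 0 (2 * PI)
        (sum_f_R0 (fun j => RInt (fun x => poisson r (x - t j) * g x) 0 (2 * PI)) n)).
      { apply (isR_sum (fun j x => poisson r (x - t j) * g x)). intros j _.
        apply isR_correct, ex_RInt_cont. intro x. apply contR_mult; [apply poisson_continuous; lra|apply Hg]. }
      apply (is_RInt_le (fun x => sum_f_R0 (fun j => poisson r (x - t j) * g x) n) (fun x => 27 * N * g x) 0 (2 * PI)).
      + lra.
      + exact Hs.
      + apply isR_scal. exact isG.
      + intros x _. rewrite <- scal_sum. rewrite Rmult_comm. apply Rmult_le_compat_r; [apply rpow_ge0|].
        exact (cfg_Po_sum n t delta 1 Hdelta (Rle_refl 1) Ht x). }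
  destruct (poly_le_reverse n P HP) as (P' & HP'pd & HP').
  assert (Hout : G <= rpow (exp 1) p * RInt (fun x => rpow (Cmod (P' (RtoC r * cis x)%C)) p) 0 (2 * PI)).
  { apply (is_RInt_le g (fun x => rpow (exp 1) p * rpow (Cmod (P' (RtoC r * cis x)%C)) p) 0 (2 * PI)).
    - lra.
    - exact isG.
    - apply isR_scal. apply (RInt_circle_pos p n); [lra|exact HP'pd].
    - intros x _. unfold g. rewrite <- rpow_mult by (try apply Cmod_ge_0; left; apply exp_pos).
      apply rpow_le; [lra|]. split; [apply Cmod_ge_0|].
      assert (HRc : RtoC r <> 0%C) by (intro E; apply (f_equal fst) in E; simpl in E; lra).
      assert (HW : (RtoC r * cis x)%C <> 0%C) by (apply Cmult_neq_0; [exact HRc|apply cis_neq_0]).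
      rewrite (HP' _ HW). rewrite Cmod_mult, Cmod_conj, Cmod_pow, Cmod_mult, cis_mod, Cmod_R, Rabs_pos_eq by lra.
      assert (EW : (/ Cconj (RtoC r * cis x))%C = (RtoC (/ r) * cis x)%C).
      { rewrite Cmult_conj, cis_conj.
        replace (Cconj (RtoC r)) with (RtoC r) by (apply C_eq; simpl; ring).
        rewrite RtoC_inv by lra.
        transitivity (/ (RtoC r * cis (- x)) * (cis (- x) * cis x))%C.
        - rewrite cis_inv_l. ring.
        - field. split; (exact HRc || exact (cis_neq_0 _)). }
      rewrite EW. set (v := Cmod (P (RtoC (/ r) * cis x)%C)).
      assert (Hv : 0 <= v) by apply Cmod_ge_0.
      assert (Hrp : 0 < r ^ n) by (apply pow_lt; lra).
      assert (1 <= exp 1 * r ^ n).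
      { apply Rle_trans with ((/ r) ^ n * r ^ n).
        - rewrite pow_inv. right. field. lra.
        - apply Rmult_le_compat_r; [lra|]. eapply Rle_trans; [|exact Hri]. simpl.
          assert (1 <= / r) by (rewrite <- Rinv_1; apply Rinv_le_contravar; lra).
          assert (0 < (/ r) ^ n) by (apply pow_lt; lra). nra. }
      rewrite !Rmult_1_r. nra. }
  assert (Hmono := rpow_mean_mono p n P' (ln r) 0 ltac:(lra) HP'pd).
  rewrite exp_0, exp_ln in Hmono by lra.
  assert (Hln : ln r <= 0) by (rewrite <- ln_1; apply ln_le; lra).
  specialize (Hmono Hln).
  assert (Ecirc : RInt (fun x => rpow (Cmod (P' (RtoC 1 * cis x)%C)) p) 0 (2 * PI) =
    RInt (fun x => rpow (Cmod (P (cis x))) p) 0 (2 * PI)).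
  { apply RInt_ext. intros x _. rewrite Cmult_1_l. rewrite (HP' _ (cis_neq_0 x)).
    rewrite Cmod_mult, Cmod_pow, cis_mod, pow1, Cmod_conj, Rmult_1_l, cis_conj.
    do 3 f_equal. transitivity (/ cis (- x) * (cis (- x) * cis x))%C.
    - rewrite cis_inv_l. ring.
    - field. apply cis_neq_0. }
  rewrite Ecirc in Hmono.
  set (S1 := sum_f_R0 (fun j => rpow (Cmod (P (cis (t j)))) p) n) in *.
  set (I0 := RInt (fun x => rpow (Cmod (P (cis x))) p) 0 (2 * PI)) in *.
  assert (HG2 : G <= rpow (exp 1) p * (rpow 2 p * I0)).
  { eapply Rle_trans; [exact Hout|]. apply Rmult_le_compat_l; [lra|exact Hmono]. }
  apply Rmult_le_reg_l with (2 * PI * N); [nra|].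
  replace (2 * PI * N * (/ N * S1)) with (2 * PI * S1) by (field; lra).
  replace (2 * PI * N * (27 / (2 * PI) * (rpow (exp 1) p * rpow 2 p) * I0)) with
    (27 * N * (rpow (exp 1) p * (rpow 2 p * I0))) by (field; lra).
  eapply Rle_trans; [exact Hsum|]. apply Rmult_le_compat_l; [lra|exact HG2].
Qed.

(** * Passage to the notions of the statement, and sufficiency *)

Lemma Defs_Cmod (z : C) : Defs.Cmod z = Cmod z.
Proof. unfold Defs.Cmod, Cmod. f_equal. ring. Qed.

Lemma atan_polar x y : 0 < x -> x * x + y * y = 1 -> cos (atan (y / x)) = x /\ sin (atan (y / x)) = y.
Proof.
  intros Hx H.
  assert (Hs : sqrt (1 + (y / x)²) = / x).
  { apply sqrt_lem_1.
    - generalize (Rle_0_sqr (y / x)); lra.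
    - left; now apply Rinv_0_lt_compat.
    - unfold Rsqr. replace (1 + y / x * (y / x)) with ((x * x + y * y) / (x * x)) by (field; lra).
      rewrite H. field. lra. }
  rewrite cos_atan, sin_atan, Hs. split; field; lra.
Qed.

Lemma cis_arg (z : C) : Cmod z = 1 -> cis (arg z) = z.
Proof.
  intro Hz. assert (H : fst z * fst z + snd z * snd z = 1) by (rewrite <- Cmod_sqr, Hz; ring).
  destruct z as [x y]. unfold arg. simpl in *.
  destruct (Rlt_dec 0 x) as [Hx|Hx].
  - destruct (atan_polar x y Hx H). now apply C_eq.
  - destruct (Rlt_dec x 0) as [Hx'|Hx'].
    + destruct (atan_polar (- x) (- y)) as [H1 H2]; [lra|lra|].
      replace (- y / - x) with (y / x) in H1, H2 by (field; lra).
      destruct (Rle_dec 0 y).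
      * apply C_eq; simpl; [rewrite neg_cos|rewrite neg_sin]; lra.
      * replace (atan (y / x) - PI) with (- (PI - atan (y / x))) by ring.
        apply C_eq; simpl; [rewrite cos_neg, Rtrigo_facts.cos_pi_minus|rewrite sin_neg, Rtrigo_facts.sin_pi_minus]; lra.
    + assert (Hx0 : x = 0) by lra. subst x.
      destruct (Rlt_dec 0 y) as [Hy|Hy]; [|destruct (Rlt_dec y 0) as [Hy'|Hy']].
      * apply C_eq; simpl; [rewrite cos_PI2|rewrite sin_PI2]; nra.
      * apply C_eq; simpl; [rewrite cos_neg, cos_PI2|rewrite sin_neg, sin_PI2]; nra.
      * exfalso. assert (y = 0) by lra. subst y. lra.
Qed.

Lemma arg_cis x : Rabs x < PI / 2 -> arg (cis x) = x.
Proof.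
  intro Hx. apply Rabs_def2 in Hx. assert (Hc : 0 < cos x) by (apply cos_gt_0; lra).
  unfold arg, cis. simpl. destruct (Rlt_dec 0 (cos x)); [|lra].
  change (sin x / cos x) with (tan x). apply atan_tan. lra.
Qed.


Lemma integral_is_RInt f a b I : integral_is f a b I -> RInt f a b = I.
Proof. intros [pr H]. rewrite <- H. apply RInt_Reals. Qed.

Lemma RInt_integral_is f a b : ex_RInt f a b -> integral_is f a b (RInt f a b).
Proof. intro H. exists (ex_RInt_Reals_0 f a b H). symmetry. apply RInt_Reals. Qed.

Lemma MZ_sufficient p delta : 1 < p -> 0 <= delta -> delta < 1 / (2 * Rmax p (p / (p - 1))) ->
  MZ_property p delta.
Proof.
  intros Hp Hd0 Hd. assert (HPI := PI_RGT_0).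
  assert (Hd4 := delta_le_quarter p delta Hp Hd).
  destruct (integral_le_sample_sum p delta Hp Hd0 Hd) as (C1 & HC1 & Hright).
  destruct (sample_sum_le_integral p delta Hp (conj Hd0 Hd4)) as (C2 & HC2 & Hleft).
  (* The factors 2 pi account for the normalized measure on the circle. *)
  set (Cp := Rmax (C1 / (2 * PI)) (C2 * (2 * PI))).
  assert (H1 : C1 / (2 * PI) <= Cp) by apply Rmax_l.
  assert (H2 : C2 * (2 * PI) <= Cp) by apply Rmax_r.
  assert (HCp : 0 < Cp) by (assert (0 < C2 * (2 * PI)) by (apply Rmult_lt_0_compat; lra); lra).
  exists Cp. split; [exact HCp|].
  intros n z Hz a I HI Ssum. assert (HN := SINR_pos n).
  (* The nodes are lifted to real angles: t_j is tau_j plus the principal argument of the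
     displacement, so |t_j - tau_j| is exactly what the hypothesis bounds. *)
  set (alpha := fun j => arg (Defs.Cmul (z j) (Defs.Cconj (omega n j)))).
  set (t := fun j => tau n j + alpha j).
  assert (Ht : forall j, (j <= n)%nat -> Rabs (t j - tau n j) <= 2 * PI * delta / INR (S n)).
  { intros j Hj. destruct (Hz j Hj) as [_ H]. unfold t. fold (alpha j) in H.
    replace (tau n j + alpha j - tau n j) with (alpha j) by ring. exact H. }
  assert (Hzt : forall j, (j <= n)%nat -> z j = cis (t j)).
  { intros j Hj. destruct (Hz j Hj) as [Hm _]. rewrite Defs_Cmod in Hm.
    unfold t. rewrite cis_add. unfold alpha.
    change (Defs.Cmul (z j) (Defs.Cconj (omega n j))) with (Cmult (z j) (Cconj (cis (tau n j)))).
    rewrite cis_arg.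
    2:{ rewrite Cmod_mult, Cmod_conj, cis_mod. change (Cmod (z j)) with (Cmod (z j)). rewrite Hm. ring. }
    rewrite cis_conj.
    transitivity (Cmult (z j) (cis (- tau n j) * cis (tau n j))%C); [rewrite cis_inv_l; apply C_eq; simpl; ring|].
    match goal with |- ?x = ?y => change (@eq C x y) end. ring. }
  assert (HP := poly_le_Peval a n).
  apply integral_is_RInt in HI.
  assert (EI : RInt (fun x => rpow (Cmod (Peval a n (cis x))) p) 0 (2 * PI) = I).
  { rewrite <- HI. apply RInt_ext. intros x _. now rewrite Defs_Cmod. }
  assert (ES : Ssum = sum_f_R0 (fun j => rpow (Cmod (Peval a n (cis (t j)))) p) n).
  { apply sum_eq. intros j Hj. rewrite Defs_Cmod, (Hzt j Hj). reflexivity. }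
  assert (HL := Hleft n t Ht (Peval a n) HP). assert (HR := Hright n t Ht (Peval a n) HP).
  rewrite EI, <- ES in HL, HR.
  assert (HS0 : 0 <= Ssum) by (rewrite ES; apply sum_nonneg; intros; apply rpow_ge0).
  assert (HI0 : 0 <= I).
  { assert (H : 0 <= / INR (S n) * Ssum) by (apply Rmult_le_pos; [left; now apply Rinv_0_lt_compat|exact HS0]). nra. }
  split.
  - unfold Rdiv. rewrite Rmult_assoc.
    apply Rle_trans with (/ Cp * (C2 * I)); [apply Rmult_le_compat_l; [left; now apply Rinv_0_lt_compat|exact HL]|].
    apply Rmult_le_reg_l with (Cp * (2 * PI)); [nra|].
    replace (Cp * (2 * PI) * (/ Cp * (C2 * I))) with (C2 * (2 * PI) * I) by (field; lra).
    replace (Cp * (2 * PI) * (I * / (2 * PI))) with (Cp * I) by (field; lra).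
    apply Rmult_le_compat_r; lra.
  - apply Rmult_le_reg_l with (2 * PI); [lra|].
    replace (2 * PI * (I / (2 * PI))) with I by (field; lra).
    eapply Rle_trans; [exact HR|].
    replace (2 * PI * (Cp / INR (S n) * Ssum)) with (2 * PI * Cp * (/ INR (S n) * Ssum)) by (field; lra).
    replace (C1 / INR (S n) * Ssum) with (C1 * (/ INR (S n) * Ssum)) by (field; lra).
    apply Rmult_le_compat_r.
    + apply Rmult_le_pos; [left; now apply Rinv_0_lt_compat|exact HS0].
    + apply Rmult_le_reg_l with (/ (2 * PI)); [apply Rinv_0_lt_compat; lra|].
      replace (/ (2 * PI) * (2 * PI * Cp)) with Cp by (field; lra). unfold Rdiv in H1. lra.
Qed.

(** * Polynomial approximation of (1 - r z)^(-g) on the circle *)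

Ltac rring := match goal with |- ?x = ?y => change (@eq R x y) end; ring.

(** Partial sum, with powers 1 to d, of the series of -log(1 - r e^(ix)); [Gser] is its derivative
    in r, a geometric sum. *)
Fixpoint Lser (r : R) (d : nat) (x : R) : C :=
  match d with
  | O => RtoC 0
  | S k => (Lser r k x + RtoC (r ^ S k / INR (S k)) * cis (INR (S k) * x))%C
  end.

Fixpoint Gser (r : R) (d : nat) (x : R) : C :=
  match d with
  | O => RtoC 0
  | S k => (Gser r k x + RtoC (r ^ k) * cis (INR (S k) * x))%C
  end.

Lemma Lser_derive d x r :
  is_derive (fun r => fst (Lser r d x)) r (fst (Gser r d x)) /\
  is_derive (fun r => snd (Lser r d x)) r (snd (Gser r d x)).
Proof.
  induction d as [|d [IH1 IH2]].
  - split; apply (der_cst _ 0); reflexivity.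
  - assert (HN := SINR_pos d).
    assert (Hk : forall c, is_derive (fun r => r ^ S d / INR (S d) * c) r (r ^ d * c)).
    { intro c. evar_last; [auto_derive; [easy|reflexivity]|]. change (match d with O => 1 | S _ => INR d + 1 end) with (INR (S d)). field. lra. }
    split.
    + apply (is_derive_ext (fun r => fst (Lser r d x) + r ^ S d / INR (S d) * cos (INR (S d) * x))).
      { intro u. cbn [Lser fst snd Cplus Cmult RtoC cis]. rring. }
      evar_last; [apply (is_derive_plus (fun r => fst (Lser r d x)) (fun r => r ^ S d / INR (S d) * cos (INR (S d) * x)) r _ _ IH1 (Hk _))|].
      cbn [Gser fst snd Cplus Cmult RtoC cis]. unfold plus; simpl. rring.
    + apply (is_derive_ext (fun r => snd (Lser r d x) + r ^ S d / INR (S d) * sin (INR (S d) * x))).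
      { intro u. cbn [Lser fst snd Cplus Cmult RtoC cis]. rring. }
      evar_last; [apply (is_derive_plus (fun r => snd (Lser r d x)) (fun r => r ^ S d / INR (S d) * sin (INR (S d) * x)) r _ _ IH2 (Hk _))|].
      cbn [Gser fst snd Cplus Cmult RtoC cis]. unfold plus; simpl. rring.
Qed.

Lemma Gser_sum r d x : ((1 - RtoC r * cis x) * Gser r d x = cis x - RtoC (r ^ d) * cis (INR (S d) * x))%C.
Proof.
  induction d as [|d IH].
  - cbn [Gser]. simpl. rewrite !Rmult_1_l. ring.
  - change (Gser r (S d) x) with (Gser r d x + RtoC (r ^ d) * cis (INR (S d) * x))%C.
    rewrite Cmult_plus_distr_l, IH. rewrite (S_INR (S d)), Rmult_plus_distr_r, cis_add, Rmult_1_l.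
    simpl (r ^ S d). rewrite RtoC_mult. ring.
Qed.

Definition lnmu (r x : R) : R := / 2 * ln (1 - 2 * r * cos x + r * r).

Lemma exp_lnmu r x : 0 <= r < 1 -> exp (lnmu r x) = Cmod (1 - RtoC r * cis x)%C.
Proof.
  intro Hr. assert (HD := poisson_den_pos r x Hr). assert (Hm := Cmod_one_minus r x Hr).
  unfold lnmu. rewrite poisson_den. set (m := Cmod _) in *.
  assert (Hm0 : 0 < m) by lra.
  replace (m ^ 2) with (m * m) by ring. rewrite ln_mult by exact Hm0.
  replace (/ 2 * (ln m + ln m)) with (ln m) by field. now apply exp_ln.
Qed.

(** The limit is e^(ix)/(1 - rho e^(ix)), whose two components appear in the statement; the
    remainder of the geometric sum has modulus rho^d / |1 - rho e^(ix)|. *)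
Lemma Gser_error rho d x : 0 <= rho < 1 ->
  Rabs (fst (Gser rho d x) + (rho - cos x) / (1 - 2 * rho * cos x + rho * rho)) <= rho ^ d / (1 - rho) /\
  Rabs (snd (Gser rho d x) - sin x / (1 - 2 * rho * cos x + rho * rho)) <= rho ^ d / (1 - rho).
Proof.
  intro Hr. assert (HD := poisson_den_pos rho x Hr). assert (Hm := Cmod_one_minus rho x Hr).
  set (D := 1 - 2 * rho * cos x + rho * rho) in *.
  assert (Hne : (1 - RtoC rho * cis x)%C <> 0%C) by (apply Cmod_gt_0; lra).
  set (e := (cis x / (1 - RtoC rho * cis x))%C).
  assert (He : e = ((cos x - rho) / D, sin x / D)).
  { unfold e. assert (HDc : RtoC D <> 0%C) by (intro E; apply (f_equal fst) in E; simpl in E; lra).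
    assert (Hsc := sin2_cos2 x). unfold Rsqr in Hsc.
    assert (E : (cis x * RtoC D)%C = (((cos x - rho)%R, sin x) * (1 - RtoC rho * cis x))%C).
    { unfold D. apply C_eq; simpl.
      - replace (rho * rho) with (rho * rho * 1) by ring. 
        assert (sin x * sin x = 1 - cos x * cos x) by lra. nra.
      - nra. }
    assert (E2 : ((cos x - rho) / D, sin x / D) = (((cos x - rho)%R, sin x) / RtoC D)%C).
    { apply C_eq; simpl; field; lra. }
    rewrite E2. unfold Cdiv.
    transitivity (cis x * RtoC D * / RtoC D * / (1 - RtoC rho * cis x))%C; [field; auto|].
    rewrite E. field. auto. }
  assert (Hdiff : (Gser rho d x - e)%C = (- (RtoC (rho ^ d) * cis (INR (S d) * x)) / (1 - RtoC rho * cis x))%C).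
  { unfold e. assert (HG := Gser_sum rho d x).
    transitivity (((1 - RtoC rho * cis x) * Gser rho d x - cis x) / (1 - RtoC rho * cis x))%C; [field; exact Hne|].
    rewrite HG. field. exact Hne. }
  assert (Hmod : Cmod (Gser rho d x - e)%C <= rho ^ d / (1 - rho)).
  { assert (Hp : 0 <= rho ^ d) by (apply pow_le; lra).
    rewrite Hdiff, Cmod_div, Cmod_opp, Cmod_mult, cis_mod, Cmod_R, Rabs_pos_eq by assumption.
    rewrite Rmult_1_r. apply Rmult_le_compat_l; [exact Hp|]. apply Rinv_le_contravar; lra. }
  assert (Hmx := Rmax_Cmod (Gser rho d x - e)%C).
  rewrite He in Hmod, Hmx. simpl in Hmx.
  split; (eapply Rle_trans; [|exact Hmod]); (eapply Rle_trans; [|exact Hmx]).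
  - eapply Rle_trans; [|apply Rmax_l]. right. f_equal. unfold Cminus. simpl. field. lra.
  - eapply Rle_trans; [|apply Rmax_r]. right. f_equal.
Qed.

Lemma Aa_r_derive rho x : 0 <= rho < 1 ->
  is_derive (fun r => cauchy_arg r x) rho (sin x / (1 - 2 * rho * cos x + rho * rho)).
Proof.
  intro Hr. assert (H := Aa_den rho x Hr). assert (HD := poisson_den_pos rho x Hr).
  evar_last.
  - apply (is_derive_comp atan (fun r => r * sin x / (1 - r * cos x))).
    + apply is_derive_Reals, derivable_pt_lim_atan.
    + apply (is_derive_div (fun r => r * sin x) (fun r => 1 - r * cos x) rho (sin x) (- cos x)).
      auto_derive; [easy|ring]. auto_derive; [easy|ring]. lra.
  - unfold minus, plus, opp, scal; simpl; unfold mult; simpl. unfold Rsqr.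
    generalize (sin2_cos2 x). unfold Rsqr. set (c := cos x) in *. set (s := sin x). intro Hsc.
    assert (Hs2 : s * s = 1 - c * c) by lra.
    replace (1 + rho * s / (1 - rho * c) * (rho * s / (1 - rho * c) * 1)) with
      ((1 - 2 * rho * c + rho * rho) / ((1 - rho * c) * (1 - rho * c))).
    2:{ replace (1 - 2 * rho * c + rho * rho) with ((1 - rho * c) * (1 - rho * c) + rho * rho * (s * s))
          by (rewrite Hs2; ring). field. lra. }
    field. lra.
Qed.

Lemma lnmu_r_derive rho x : 0 <= rho < 1 ->
  is_derive (fun r => lnmu r x) rho ((rho - cos x) / (1 - 2 * rho * cos x + rho * rho)).
Proof.
  intro Hr. assert (HD := poisson_den_pos rho x Hr). unfold lnmu. auto_derive; [lra|]. field. lra.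
Qed.

Lemma bound_by_derivative (f f' : R -> R) r K : 0 < r -> f 0 = 0 ->
  (forall rho, 0 <= rho <= r -> is_derive f rho (f' rho) /\ Rabs (f' rho) <= K) ->
  Rabs (f r) <= K * r.
Proof.
  intros Hr H0 H.
  destruct (MVT_gen f 0 r f') as (c & Hc & E).
  - intros x Hx. rewrite Rmin_left, Rmax_right in Hx by lra. apply H. lra.
  - intros x Hx. rewrite Rmin_left, Rmax_right in Hx by lra.
    apply continuity_pt_filterlim. apply (ex_derive_continuous f). exists (f' x). apply H. lra.
  - rewrite Rmin_left, Rmax_right in Hc by lra. rewrite H0, Rminus_0_r, Rminus_0_r in E.
    rewrite E, Rabs_mult, (Rabs_pos_eq r) by lra. apply Rmult_le_compat_r; [lra|]. now apply H.
Qed.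

(** Both differences vanish at radius 0 and their derivatives in the radius are geometric
    remainders, so the mean value theorem replaces any convergence argument for the logarithmic
    series. *)
Lemma Lser_error r d x : 0 < r < 1 ->
  Rabs (fst (Lser r d x) + lnmu r x) <= r ^ d / (1 - r) /\
  Rabs (snd (Lser r d x) - cauchy_arg r x) <= r ^ d / (1 - r).
Proof.
  intro Hr.
  assert (L0 : Lser 0 d x = RtoC 0).
  { induction d as [|d IH]; [reflexivity|]. cbn [Lser]. rewrite IH. simpl (0 ^ S d).
    rewrite Rmult_0_l. unfold Rdiv. rewrite Rmult_0_l. ring. }
  assert (HK : forall rho, 0 <= rho <= r -> rho ^ d / (1 - rho) <= r ^ d / (1 - r)).
  { intros rho Hrho. apply Rmult_le_compat.
    - apply pow_le; lra.
    - left; apply Rinv_0_lt_compat; lra.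
    - apply pow_incr; lra.
    - apply Rinv_le_contravar; lra. }
  assert (HK0 : 0 <= r ^ d / (1 - r)).
  { apply Rmult_le_pos; [apply pow_le; lra|left; apply Rinv_0_lt_compat; lra]. }
  split.
  - apply Rle_trans with (r ^ d / (1 - r) * r); [|nra].
    apply (bound_by_derivative (fun rho => fst (Lser rho d x) + lnmu rho x)
      (fun rho => fst (Gser rho d x) + (rho - cos x) / (1 - 2 * rho * cos x + rho * rho))).
    + lra.
    + rewrite L0. unfold lnmu. simpl. replace (1 - 2 * 0 * cos x + 0 * 0) with 1 by ring. rewrite ln_1. ring.
    + intros rho Hrho. assert (Hrho' : 0 <= rho < 1) by lra. split.
      * apply (is_derive_plus (fun rho => fst (Lser rho d x)) (fun rho => lnmu rho x)).
        apply Lser_derive. now apply lnmu_r_derive.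
      * eapply Rle_trans; [apply (Gser_error rho d x Hrho')|now apply HK].
  - apply Rle_trans with (r ^ d / (1 - r) * r); [|nra].
    apply (bound_by_derivative (fun rho => snd (Lser rho d x) - cauchy_arg rho x)
      (fun rho => snd (Gser rho d x) - sin x / (1 - 2 * rho * cos x + rho * rho))).
    + lra.
    + rewrite L0. unfold cauchy_arg. simpl. replace (0 * sin x / (1 - 0 * cos x)) with 0 by (field; lra).
      rewrite atan_0. ring.
    + intros rho Hrho. assert (Hrho' : 0 <= rho < 1) by lra. split.
      * apply (is_derive_minus (fun rho => snd (Lser rho d x)) (fun rho => cauchy_arg rho x)).
        apply Lser_derive. now apply Aa_r_derive.
      * eapply Rle_trans; [apply (Gser_error rho d x Hrho')|now apply HK].
Qed.

Lemma Lser_poly r d : exists Lp, poly_le d Lp /\ forall x, Lp (cis x) = Lser r d x.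
Proof.
  induction d as [|d (Lp & H1 & H2)].
  - exists (fun _ => RtoC 0). split; [apply poly_le_const|reflexivity].
  - exists (fun w => Lp w + RtoC (r ^ S d / INR (S d)) * w ^ S d)%C. split.
    + apply poly_le_add; [now apply poly_le_S|apply poly_le_scal, poly_le_Xn].
    + intro x. rewrite H2, cis_pow. reflexivity.
Qed.

Lemma Lser_mod r d x : 0 <= r <= 1 -> Cmod (Lser r d x) <= INR d.
Proof.
  intro Hr. induction d as [|d IH].
  - simpl. rewrite Cmod_0. lra.
  - change (Lser r (S d) x) with (Lser r d x + RtoC (r ^ S d / INR (S d)) * cis (INR (S d) * x))%C.
    eapply Rle_trans; [apply Cmod_triangle|]. assert (E := S_INR d).
    apply Rle_trans with (INR d + 1); [|lra]. apply Rplus_le_compat; [exact IH|].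
    assert (HN : 1 <= INR (S d)) by (rewrite S_INR; generalize (pos_INR d); lra).
    assert (Hp : 0 <= r ^ S d) by (apply pow_le; lra).
    assert (Hp1 := pow_incr r 1 (S d) Hr). rewrite pow1 in Hp1.
    rewrite Cmod_mult, cis_mod, Cmod_R, Rmult_1_r, Rabs_pos_eq.
    + apply Rmult_le_reg_r with (INR (S d)); [lra|].
      replace (r ^ S d / INR (S d) * INR (S d)) with (r ^ S d) by (field; lra).
      rewrite Rmult_1_l. exact (Rle_trans _ _ _ Hp1 HN).
    + apply Rmult_le_pos; [exact Hp|left; apply Rinv_0_lt_compat; lra].
Qed.

Lemma ln_1_plus_error s : Rabs s <= / 2 -> Rabs (ln (1 + s) - s) <= 2 * (s * s).
Proof.
  intro Hs. apply Rabs_le_between in Hs.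
  assert (H1 : ln (1 + s) <= s).
  { assert (H := ln_le (1 + s) (exp s) ltac:(lra) (exp_ineq1_le s)). now rewrite ln_exp in H. }
  assert (H2 : - ln (1 + s) <= / (1 + s) - 1).
  { rewrite <- ln_Rinv by lra.
    assert (Hi : 0 < / (1 + s)) by (apply Rinv_0_lt_compat; lra).
    assert (H := ln_le (/ (1 + s)) (exp (/ (1 + s) - 1)) Hi).
    rewrite ln_exp in H. apply H. generalize (exp_ineq1_le (/ (1 + s) - 1)). lra. }
  assert (H3 : / (1 + s) - 1 = - s + s * s * / (1 + s)) by (field; lra).
  assert (H4 : / (1 + s) <= 2).
  { replace 2 with (/ / 2) by field. apply Rinv_le_contravar; lra. }
  assert (H5 : s * s * / (1 + s) <= s * s * 2) by (apply Rmult_le_compat_l; nra).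
  apply Rabs_le. split; nra.
Qed.

Lemma atan_error w : Rabs w <= 1 -> Rabs (atan w - w) <= w * w.
Proof.
  assert (Hpos : forall y, 0 <= y <= 1 -> Rabs (atan y - y) <= y * y).
  { intros y [[Hy| <-] Hy1]; [|rewrite atan_0, Rminus_0_r, Rabs_R0; lra].
    destruct (MVT_is_derive (fun t => t - atan t) (fun t => 1 - / (1 + t²)) 0 y Hy) as (c & Hc & E).
    - intro t. auto_derive; [easy|]. unfold Rsqr. field. nra.
    - rewrite atan_0 in E. unfold Rsqr in E.
      assert (H1 : / (1 + c * c) <= 1) by (rewrite <- Rinv_1; apply Rinv_le_contravar; nra).
      assert (H2 : 1 - c * c <= / (1 + c * c)).
      { apply Rmult_le_reg_r with (1 + c * c); [nra|]. rewrite Rinv_l by nra. nra. }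
      rewrite Rabs_minus_sym, Rabs_pos_eq by nra.
      assert ((1 - / (1 + c * c)) * y <= c * c * y) by (apply Rmult_le_compat_r; lra).
      assert (c * c * y <= y * y * y) by (apply Rmult_le_compat_r; nra). nra. }
  intro Hw. destruct (Rle_dec 0 w) as [H|H].
  - apply Hpos. rewrite Rabs_pos_eq in Hw; lra.
  - rewrite Rabs_left in Hw by lra.
    replace (atan w - w) with (- (atan (- w) - - w)) by (rewrite atan_opp; ring).
    rewrite Rabs_Ropp. replace (w * w) with (- w * - w) by ring. apply Hpos. lra.
Qed.

Lemma atan_polar_gen x y : 0 < x ->
  cos (atan (y / x)) = x / sqrt (x * x + y * y) /\ sin (atan (y / x)) = y / sqrt (x * x + y * y).
Proof.
  intros Hx. assert (H2 : 0 < x * x + y * y) by nra.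
  assert (Hq := sqrt_lt_R0 _ H2).
  assert (Hs : sqrt (1 + (y / x)²) = sqrt (x * x + y * y) / x).
  { apply sqrt_lem_1.
    - generalize (Rle_0_sqr (y / x)); lra.
    - left; now apply Rdiv_lt_0_compat.
    - unfold Rsqr. replace (sqrt (x * x + y * y) / x * (sqrt (x * x + y * y) / x)) with
        (sqrt (x * x + y * y) * sqrt (x * x + y * y) / (x * x)) by (field; lra).
      rewrite sqrt_sqrt by lra. field. lra. }
  rewrite cos_atan, sin_atan, Hs. split; field; lra.
Qed.

(** A quantitative form of (1 + z)^m being close to exp(m z) for small z = u + i v. Since 1 + u > 0,
    the logarithm of the modulus and the argument have explicit formulas continuous in u and v. *)
Lemma polar_power (m : nat) (u v kp : R) : (0 < m)%nat -> 0 <= kp <= / 8 -> Rabs u <= kp -> Rabs v <= kp ->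
  let X := INR m / 2 * ln ((1 + u) * (1 + u) + v * v) in
  let Y := INR m * atan (v / (1 + u)) in
  ((1 + (u, v)) ^ m)%C = (RtoC (exp X) * cis Y)%C /\
  Rabs (X - INR m * u) <= INR m * (10 * (kp * kp)) /\
  Rabs (Y - INR m * v) <= INR m * (10 * (kp * kp)).
Proof.
  intros Hm Hk Hu Hv X Y. assert (HM : 0 < INR m) by (apply lt_0_INR; lia).
  assert (Hu' := Hu). assert (Hv' := Hv).
  apply Rabs_le_between in Hu'. apply Rabs_le_between in Hv'.
  assert (Huu : u * u <= kp * kp).
  { rewrite <- (Rabs_pos_eq (u * u)) by nra. rewrite Rabs_mult. generalize (Rabs_pos u). nra. }
  assert (Hvv : v * v <= kp * kp).
  { rewrite <- (Rabs_pos_eq (v * v)) by nra. rewrite Rabs_mult. generalize (Rabs_pos v). nra. }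
  set (mu2 := (1 + u) * (1 + u) + v * v) in *.
  assert (Hmu2 : 0 < mu2) by (unfold mu2; nra).
  set (mu := sqrt mu2). assert (Hmu : 0 < mu) by (apply sqrt_lt_R0; exact Hmu2).
  assert (Hmumu : mu * mu = mu2) by (apply sqrt_sqrt; lra).
  assert (Hbase : (1 + (u, v))%C = (RtoC mu * cis (atan (v / (1 + u))))%C).
  { destruct (atan_polar_gen (1 + u) v) as [H1 H2]; [lra|].
    fold mu2 in H1, H2. fold mu in H1, H2.
    apply C_eq; simpl; rewrite H1, H2; field; lra. }
  split; [|split].
  - rewrite Hbase, Cpow_mult_l, cis_pow, <- RtoC_pow. f_equal. f_equal.
    unfold X. rewrite <- Hmumu, ln_mult by exact Hmu.
    replace (INR m / 2 * (ln mu + ln mu)) with (INR m * ln mu) by field.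
    rewrite <- (rpow_pow mu m Hm) by lra. now apply rpow_pos_eq.
  - unfold X. set (s := 2 * u + u * u + v * v).
    assert (Hs : Rabs s <= 3 * kp).
    { unfold s. apply Rabs_le. nra. }
    assert (Hln := ln_1_plus_error s ltac:(nra)).
    replace (1 + s) with mu2 in Hln by (unfold mu2, s; ring).
    assert (Hss : s * s <= 9 * (kp * kp)).
    { rewrite <- (Rabs_pos_eq (s * s)) by nra. rewrite Rabs_mult. generalize (Rabs_pos s). nra. }
    replace (INR m / 2 * ln mu2 - INR m * u) with (INR m / 2 * ((ln mu2 - s) + (u * u + v * v)))
      by (unfold s; field).
    rewrite Rabs_mult, Rabs_pos_eq by lra.
    (* The 20 is 2 times 9 from [ln_1_plus_error] and 2 from u^2 + v^2. *)
    assert (H1 : Rabs ((ln mu2 - s) + (u * u + v * v)) <= 20 * (kp * kp)).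
    { eapply Rle_trans; [apply Rabs_triang|]. rewrite (Rabs_pos_eq (u * u + v * v)) by nra. lra. }
    apply Rle_trans with (INR m / 2 * (20 * (kp * kp))); [apply Rmult_le_compat_l; lra|lra].
  - unfold Y. set (w := v / (1 + u)).
    assert (Hw : Rabs w <= 2 * kp).
    { unfold w, Rdiv. rewrite Rabs_mult, Rabs_inv, (Rabs_pos_eq (1 + u)) by lra.
      apply Rmult_le_reg_r with (1 + u); [lra|].
      replace (Rabs v * / (1 + u) * (1 + u)) with (Rabs v) by (field; lra). nra. }
    assert (Hat := atan_error w ltac:(lra)).
    assert (Hww : w * w <= 4 * (kp * kp)).
    { rewrite <- (Rabs_pos_eq (w * w)) by nra. rewrite Rabs_mult. generalize (Rabs_pos w). nra. }
    assert (Hwv : Rabs (w - v) <= 2 * (kp * kp)).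
    { replace (w - v) with (- (u * w)) by (unfold w; field; lra). rewrite Rabs_Ropp, Rabs_mult.
      generalize (Rabs_pos u) (Rabs_pos w). nra. }
    replace (INR m * atan w - INR m * v) with (INR m * ((atan w - w) + (w - v))) by ring.
    rewrite Rabs_mult, Rabs_pos_eq by lra. apply Rmult_le_compat_l; [lra|].
    eapply Rle_trans; [apply Rabs_triang|]. nra.
Qed.

Lemma contR_pt (f : R -> R) x : continuous f x <-> continuity_pt f x.
Proof. symmetry. apply continuity_pt_filterlim. Qed.

(** The logarithm is truncated to a polynomial L, and exp(g L) is replaced by (1 + g L / m)^m, again
    a polynomial. [X] and [Y] are continuous choices of log-modulus and argument, the latter being
    needed to place nodes by the intermediate value theorem. *)
Lemma approx_power r g eps : 0 < r < 1 -> 0 <= g <= 1 -> 0 < eps ->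
  exists d B X Y, poly_le d B /\
  (forall x, B (cis x) = (RtoC (exp (X x)) * cis (Y x))%C) /\
  (forall x, continuous X x) /\ (forall x, continuous Y x) /\
  (forall x, Rabs (X x + g * lnmu r x) <= eps) /\ (forall x, Rabs (Y x - g * cauchy_arg r x) <= eps).
Proof.
  intros Hr Hg He.
  destruct (pow_lt_1_zero r ltac:(rewrite Rabs_pos_eq; lra) (eps / 2 * (1 - r))) as [d Hd].
  { apply Rmult_lt_0_compat; lra. }
  specialize (Hd d (le_n d)). rewrite Rabs_pos_eq in Hd by (apply pow_le; lra).
  assert (Hd' : r ^ d / (1 - r) <= eps / 2).
  { apply Rmult_le_reg_r with (1 - r); [lra|].
    replace (r ^ d / (1 - r) * (1 - r)) with (r ^ d) by (field; lra). lra. }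
  set (D := INR d). assert (HD : 0 <= D) by apply pos_INR.
  (* Large enough for |g L / m| <= D/m <= 1/8 and for the error 10 D^2/m to be at most eps/2; the
     truncation uses the other half. *)
  destruct (nfloor_ex (20 * (D * D) / eps + 8 * D)) as [m0 [_ Hm0]].
  { assert (0 <= 20 * (D * D) / eps) by (apply Rmult_le_pos; [nra|left; now apply Rinv_0_lt_compat]). lra. }
  set (m := S m0). assert (Hm : 20 * (D * D) / eps + 8 * D < INR m) by (unfold m; rewrite S_INR; exact Hm0).
  assert (Hq : 0 <= 20 * (D * D) / eps) by (apply Rmult_le_pos; [nra|left; now apply Rinv_0_lt_compat]).
  assert (HM : 0 < INR m) by (apply lt_0_INR; unfold m; lia).
  set (kp := D / INR m).
  assert (Hkp : 0 <= kp <= / 8).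
  { unfold kp. split; [apply Rmult_le_pos; [lra|left; now apply Rinv_0_lt_compat]|].
    apply Rmult_le_reg_r with (INR m); [exact HM|].
    replace (D / INR m * INR m) with D by (field; lra). lra. }
  assert (Hkk : INR m * (10 * (kp * kp)) <= eps / 2).
  { unfold kp. replace (INR m * (10 * (D / INR m * (D / INR m)))) with (10 * (D * D) / INR m) by (field; lra).
    apply Rmult_le_reg_r with (INR m); [exact HM|].
    replace (10 * (D * D) / INR m * INR m) with (10 * (D * D)) by (field; lra).
    assert (20 * (D * D) / eps * eps <= INR m * eps) by (apply Rmult_le_compat_r; lra).
    replace (20 * (D * D) / eps * eps) with (20 * (D * D)) in H by (field; lra). lra. }
  destruct (Lser_poly r d) as (Lp & HLp & HLe).
  set (u := fun x => g / INR m * fst (Lser r d x)). set (v := fun x => g / INR m * snd (Lser r d x)).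
  assert (Hgm : 0 <= g / INR m) by (apply Rmult_le_pos; [lra|left; now apply Rinv_0_lt_compat]).
  assert (Hmx : forall x, Rabs (fst (Lser r d x)) <= D /\ Rabs (snd (Lser r d x)) <= D).
  { intro x. assert (H := Rmax_Cmod (Lser r d x)). assert (H2 := Lser_mod r d x ltac:(lra)). fold D in H2.
    split; eapply Rle_trans; [|apply (Rle_trans _ _ _ H H2)| |apply (Rle_trans _ _ _ H H2)].
    apply Rmax_l. apply Rmax_r. }
  assert (Hgk : g / INR m * D <= kp).
  { unfold kp, Rdiv. rewrite Rmult_assoc, (Rmult_comm (/ INR m)).
    assert (0 <= D * / INR m) by (apply Rmult_le_pos; [lra|left; now apply Rinv_0_lt_compat]). nra. }
  assert (Hu : forall x, Rabs (u x) <= kp).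
  { intro x. unfold u. rewrite Rabs_mult, (Rabs_pos_eq (g / INR m)) by exact Hgm.
    eapply Rle_trans; [apply Rmult_le_compat_l; [exact Hgm|apply Hmx]|exact Hgk]. }
  assert (Hv : forall x, Rabs (v x) <= kp).
  { intro x. unfold v. rewrite Rabs_mult, (Rabs_pos_eq (g / INR m)) by exact Hgm.
    eapply Rle_trans; [apply Rmult_le_compat_l; [exact Hgm|apply Hmx]|exact Hgk]. }
  assert (Hcu : forall x, continuity_pt u x /\ continuity_pt v x).
  { intro x. destruct (poly_le_cont_cis d 1 Lp HLp x) as [C1 C2]. apply contR_pt in C1. apply contR_pt in C2.
    split.
    - apply (continuity_pt_ext (fun x => g / INR m * fst (Lp (RtoC 1 * cis x)%C))).
      { intro y. unfold u. now rewrite Cmult_1_l, HLe. }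
      now apply continuity_pt_scal.
    - apply (continuity_pt_ext (fun x => g / INR m * snd (Lp (RtoC 1 * cis x)%C))).
      { intro y. unfold v. now rewrite Cmult_1_l, HLe. }
      now apply continuity_pt_scal. }
  assert (Hpol := fun x => polar_power m (u x) (v x) kp ltac:(unfold m; lia) Hkp (Hu x) (Hv x)).
  cbv zeta in Hpol.
  assert (Hu1 : forall x, 0 < 1 + u x).
  { intro x. assert (H := Hu x). apply Rabs_le_between in H. lra. }
  exists (m * d)%nat, (fun w => (1 + RtoC (g / INR m) * Lp w) ^ m)%C,
    (fun x => INR m / 2 * ln ((1 + u x) * (1 + u x) + v x * v x)),
    (fun x => INR m * atan (v x / (1 + u x))).
  split; [|split; [|split; [|split; [|split]]]].
  - apply (poly_le_pow d m (fun w => 1 + RtoC (g / INR m) * Lp w)%C).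
    apply poly_le_add; [apply poly_le_const|now apply poly_le_scal].
  - intro x. rewrite <- (proj1 (Hpol x)). rewrite HLe. f_equal. f_equal.
    unfold u, v. destruct (Lser r d x) as [l1 l2]. apply C_eq; simpl; ring.
  - intro x. destruct (Hcu x) as [C1 C2]. apply contR_pt.
    apply continuity_pt_scal.
    apply (continuity_pt_comp (fun x => (1 + u x) * (1 + u x) + v x * v x) ln).
    + assert (C1' : continuity_pt (fun x => 1 + u x) x).
      { apply (continuity_pt_plus (fun _ => 1) u); [apply continuity_pt_const; intros ? ?; reflexivity|exact C1]. }
      apply (continuity_pt_plus (fun x => (1 + u x) * (1 + u x)) (fun x => v x * v x));
      [apply (continuity_pt_mult (fun x => 1 + u x) (fun x => 1 + u x))|apply (continuity_pt_mult v v)]; assumption.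
    + apply derivable_continuous_pt. exists (/ ((1 + u x) * (1 + u x) + v x * v x)).
      apply derivable_pt_lim_ln. generalize (Hu1 x). nra.
  - intro x. destruct (Hcu x) as [C1 C2]. apply contR_pt.
    apply continuity_pt_scal.
    apply (continuity_pt_comp (fun x => v x / (1 + u x)) atan).
    + assert (C1' : continuity_pt (fun x => 1 + u x) x).
      { apply (continuity_pt_plus (fun _ => 1) u); [apply continuity_pt_const; intros ? ?; reflexivity|exact C1]. }
      apply (continuity_pt_div v (fun x => 1 + u x)); [exact C2|exact C1'|generalize (Hu1 x); lra].
    + apply derivable_continuous_pt, derivable_pt_atan.
  - intro x. destruct (Hpol x) as (_ & H & _). destruct (Lser_error r d x Hr) as [HL _].
    set (X := INR m / 2 * ln ((1 + u x) * (1 + u x) + v x * v x)) in *.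
    replace (X + g * lnmu r x) with ((X - INR m * u x) + g * (fst (Lser r d x) + lnmu r x)).
    2:{ unfold u. field. lra. }
    eapply Rle_trans; [apply Rabs_triang|]. rewrite (Rabs_mult g), (Rabs_pos_eq g) by lra.
    assert (g * Rabs (fst (Lser r d x) + lnmu r x) <= 1 * (eps / 2)).
    { apply Rmult_le_compat; [lra|apply Rabs_pos|lra|lra]. }
    lra.
  - intro x. destruct (Hpol x) as (_ & _ & H). destruct (Lser_error r d x Hr) as [_ HL].
    set (Y := INR m * atan (v x / (1 + u x))) in *.
    replace (Y - g * cauchy_arg r x) with ((Y - INR m * v x) + g * (snd (Lser r d x) - cauchy_arg r x)).
    2:{ unfold v. field. lra. }
    eapply Rle_trans; [apply Rabs_triang|]. rewrite (Rabs_mult g), (Rabs_pos_eq g) by lra.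
    assert (g * Rabs (snd (Lser r d x) - cauchy_arg r x) <= 1 * (eps / 2)).
    { apply Rmult_le_compat; [lra|apply Rabs_pos|lra|lra]. }
    lra.
Qed.

(** * Oscillatory integrals, logarithmic divergence and placement of nodes *)

(** On each of n equal arcs g is within eps/(2 pi) of a constant, and constants integrate to zero
    against [c]. Leaving [c] general lets cosine and sine share the argument. *)
Lemma riemann_lebesgue (g : R -> R) : (forall x, continuous g x) -> forall eps, 0 < eps ->
  exists n0, forall n, (n0 <= n)%nat -> forall c : R -> R,
  (forall x, continuous c x) -> (forall x, Rabs (c x) <= 1) ->
  (forall k, RInt c (2 * PI / INR n * INR k) (2 * PI / INR n * INR (S k)) = 0) ->
  Rabs (RInt (fun x => g x * c x) 0 (2 * PI)) <= eps.
Proof.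
  intros Hg eps He. assert (HPI := PI_RGT_0).
  assert (He' : 0 < eps / (2 * PI)) by (apply Rdiv_lt_0_compat; lra).
  destruct (@Heine_cor2 g 0 (2 * PI) (fun x _ => proj1 (contR_pt g x) (Hg x)) (mkposreal _ He')) as [d Hd].
  simpl in Hd. assert (Hd0 := cond_pos d).
  destruct (nfloor_ex (2 * PI / d)) as [m [_ Hm]].
  { left. apply Rdiv_lt_0_compat; lra. }
  exists (S m). intros n Hn c Hc Hc1 Hc0.
  assert (Hn1 : INR m + 1 <= INR n) by (rewrite <- S_INR; apply le_INR; exact Hn).
  assert (Hm0 := pos_INR m). assert (HN : 0 < INR n) by lra.
  set (h := 2 * PI / INR n) in *. assert (Hh : 0 < h) by (apply Rdiv_lt_0_compat; lra).
  assert (Hhd : h < d).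
  { unfold h. apply Rmult_lt_reg_r with (INR n); [exact HN|].
    replace (2 * PI / INR n * INR n) with (2 * PI) by (field; lra).
    assert (2 * PI < (INR m + 1) * d).
    { apply Rmult_lt_reg_r with (/ d); [now apply Rinv_0_lt_compat|].
      replace ((INR m + 1) * d * / d) with (INR m + 1) by (field; lra). exact Hm. }
    nra. }
  assert (Hhn : h * INR n = 2 * PI) by (unfold h; field; lra).
  assert (Hgc : forall x, continuous (fun x => g x * c x) x) by (intro x; apply contR_mult; auto).
  assert (Hk : forall k, (k <= n)%nat ->
    Rabs (RInt (fun x => g x * c x) 0 (h * INR k)) <= INR k * (h * (eps / (2 * PI)))).
  { induction k as [|k IH]; intro Hkn.
    - simpl. rewrite Rmult_0_r, RInt_point. unfold zero; simpl. rewrite Rabs_R0. lra.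
    - assert (Hkk : h * INR (S k) <= 2 * PI).
      { rewrite <- Hhn. apply Rmult_le_compat_l; [lra|]. apply le_INR. exact Hkn. }
      assert (Hk0 := pos_INR k). rewrite S_INR in Hkk.
      rewrite <- (RInt_Chasles (fun x => g x * c x) 0 (h * INR k) (h * INR (S k))) by (apply ex_RInt_cont; exact Hgc).
      unfold plus; simpl (AbelianMonoid.plus _ _ _ _).
      assert (Hstep : Rabs (RInt (fun x => g x * c x) (h * INR k) (h * INR (S k))) <= h * (eps / (2 * PI))).
      { assert (E : RInt (fun x => g x * c x) (h * INR k) (h * INR (S k)) =
          RInt (fun x => (g x - g (h * INR k)) * c x) (h * INR k) (h * INR (S k))).
        { assert (H1 := isR_correct (fun x => g x * c x) (h * INR k) (h * INR (S k)) (ex_RInt_cont _ _ _ Hgc)).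
          assert (H2 := isR_correct c (h * INR k) (h * INR (S k)) (ex_RInt_cont _ _ _ Hc)).
          rewrite Hc0 in H2.
          assert (H3 := isR_plus _ _ _ _ _ _ H1 (isR_scal _ (- g (h * INR k)) _ _ _ H2)).
          apply isR_unique in H3. cbv beta in H3.
          transitivity (RInt (fun x => g x * c x) (h * INR k) (h * INR (S k)) + - g (h * INR k) * 0); [rewrite Rmult_0_r; symmetry; apply Rplus_0_r|].
          rewrite <- H3. apply RInt_ext. intros x _. rring. }
        rewrite E.
        replace (h * (eps / (2 * PI))) with ((h * INR (S k) - h * INR k) * (eps / (2 * PI))) by (rewrite S_INR; ring).
        apply abs_RInt_le_const.
        - rewrite S_INR. nra.
        - apply ex_RInt_cont. intro x. apply (contR_mult (fun x => g x - g (h * INR k)) c); [|apply Hc].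
          apply contR_pt. apply (continuity_pt_minus g (fun _ => g (h * INR k))).
          apply contR_pt, Hg. apply continuity_pt_const. intros ? ?; reflexivity.
        - intros x Hx. rewrite S_INR in Hx. rewrite Rabs_mult.
          assert (Hgx : Rabs (g x - g (h * INR k)) < eps / (2 * PI)).
          { apply Hd; try nra. rewrite Rabs_pos_eq; lra. }
          specialize (Hc1 x). generalize (Rabs_pos (c x)) (Rabs_pos (g x - g (h * INR k))). nra. }
      eapply Rle_trans; [apply Rabs_triang|]. specialize (IH ltac:(lia)). 
      replace (INR (S k) * (h * (eps / (2 * PI)))) with (INR k * (h * (eps / (2 * PI))) + h * (eps / (2 * PI)))
        by (rewrite (S_INR k); ring).
      apply Rplus_le_compat; [exact IH|exact Hstep]. }
  specialize (Hk n (le_n n)). rewrite Hhn in Hk. eapply Rle_trans; [exact Hk|].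
  right. transitivity (h * INR n * (eps / (2 * PI))); [ring|]. rewrite Hhn. field. lra.
Qed.

Lemma cos_period_zero n k : (0 < n)%nat ->
  RInt (fun x => cos (INR n * x)) (2 * PI / INR n * INR k) (2 * PI / INR n * INR (S k)) = 0 /\
  RInt (fun x => sin (INR n * x)) (2 * PI / INR n * INR k) (2 * PI / INR n * INR (S k)) = 0.
Proof.
  intro Hn. assert (HN : 0 < INR n) by (apply lt_0_INR; lia).
  assert (E1 : INR n * (2 * PI / INR n * INR k) = 0 + 2 * INR k * PI) by (field; lra).
  assert (E2 : INR n * (2 * PI / INR n * INR (S k)) = 0 + 2 * INR (S k) * PI) by (field; lra).
  assert (Hl : forall x, is_derive (fun x => INR n * x) x (INR n)).
  { intro x. auto_derive; [easy|ring]. }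
  assert (Hcl : forall x, continuous (fun x => INR n * x) x).
  { intro x. apply (ex_derive_continuous (fun x => INR n * x)). exists (INR n). apply Hl. }
  split; apply isR_unique.
  - evar_last.
    + apply (is_RInt_derive (fun x => sin (INR n * x) / INR n)).
      * intros x _. auto_derive; [lra|]. field. lra.
      * intros x _. apply (continuous_comp (fun x => INR n * x) cos); [apply Hcl|apply continuous_cos].
    + rewrite E1, E2, !sin_period. unfold minus, plus, opp; simpl. rring.
  - evar_last.
    + apply (is_RInt_derive (fun x => - cos (INR n * x) / INR n)).
      * intros x _. auto_derive; [lra|]. field. lra.
      * intros x _. apply (continuous_comp (fun x => INR n * x) sin); [apply Hcl|apply continuous_sin].
    + rewrite E1, E2, !cos_period. unfold minus, plus, opp; simpl. rring.
Qed.

(** For x >= 0, |1 - r e^(ix)| <= 1 - r + x, and the reciprocal of the right-hand side integrates to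
    a logarithm. This is the divergence that defeats a uniform constant. *)
Lemma RInt_inv_mu r : 0 < r < 1 ->
  - ln (1 - r) <= RInt (fun x => / Cmod (1 - RtoC r * cis x)%C) 0 (2 * PI).
Proof.
  intro Hr. assert (HPI := PI_RGT_0). assert (Hr' : 0 <= r < 1) by lra.
  assert (Hmu : forall x, 0 < Cmod (1 - RtoC r * cis x)%C).
  { intro x. generalize (Cmod_one_minus r x Hr'). lra. }
  assert (Hcont : forall x, continuous (fun x => / Cmod (1 - RtoC r * cis x)%C) x).
  { intro x. apply contR_pt. apply (continuity_pt_inv (fun x => Cmod (1 - RtoC r * cis x)%C)).
    - apply contR_pt.
      apply (continuous_ext (fun x => Cmod (1 - (RtoC r * cis x) * 1)%C)).
      { intro y. f_equal. ring. }
      exact (poly_le_Cmod_continuous 1 r (fun w => 1 - w * 1)%C (poly_le_lin 1%C) x).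
    - generalize (Hmu x). lra. }
  assert (Hi : is_RInt (fun x => / (1 - r + x)) 0 (2 * PI) (ln (1 - r + 2 * PI) - ln (1 - r + 0))).
  { apply (is_RInt_derive (fun x => ln (1 - r + x))).
    - intros x Hx. rewrite Rmin_left, Rmax_right in Hx by lra. auto_derive; [lra|]. field. lra.
    - intros x Hx. rewrite Rmin_left, Rmax_right in Hx by lra. apply contR_pt.
      apply (continuity_pt_inv (fun x => 1 - r + x)); [|lra].
      apply derivable_continuous_pt. reg. }
  apply Rle_trans with (ln (1 - r + 2 * PI) - ln (1 - r + 0)).
  - rewrite Rplus_0_r. assert (0 <= ln (1 - r + 2 * PI)); [|lra].
    rewrite <- ln_1. apply ln_le; [lra|]. generalize PI2_1. lra.
  - apply (is_RInt_le (fun x => / (1 - r + x)) (fun x => / Cmod (1 - RtoC r * cis x)%C) 0 (2 * PI)).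
    + lra.
    + exact Hi.
    + apply isR_correct, ex_RInt_cont. exact Hcont.
    + intros x Hx. apply Rinv_le_contravar; [apply Hmu|].
      replace (1 - RtoC r * cis x)%C with (RtoC (1 - r) - RtoC r * (cis x - 1))%C by (rewrite RtoC_minus; ring).
      unfold Cminus at 1. eapply Rle_trans; [apply Cmod_triangle|].
      rewrite Cmod_opp, Cmod_mult, !Cmod_R, !Rabs_pos_eq by lra.
      assert (H := cis_minus_1_le x). rewrite Rabs_pos_eq in H by lra.
      assert (0 <= Cmod (cis x - 1)%C) by apply Cmod_ge_0. nra.
Qed.

(** Here r is fixed and n large. Then N (1 - r) >= 5 and 2 pi dl <= 2 give [slow] <= (7/5)^2 <= 2,
    and r^N < 1/3 bounds the averaged kernel by 2. *)
Lemma poisson_sum_large r dl : 0 < r < 1 -> 0 <= dl <= 1 / 4 ->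
  exists n0, forall n, (n0 <= n)%nat -> forall t,
  (forall j, (j <= n)%nat -> Rabs (t j - tau n j) <= 2 * PI * dl / INR (S n)) ->
  sum_f_R0 (fun j => poisson r (0 - t j)) n <= 4 * INR (S n).
Proof.
  intros Hr Hdl. assert (HPI := PI_RGT_0). assert (HP4 := PI_4).
  destruct (pow_lt_1_zero r ltac:(rewrite Rabs_pos_eq; lra) (/ 3) ltac:(lra)) as [n1 Hn1].
  destruct (nfloor_ex (5 / (1 - r))) as [n2 [_ Hn2]].
  { left. apply Rdiv_lt_0_compat; lra. }
  exists (max n1 n2). intros n Hn t Ht.
  assert (HN := SINR_pos n). set (N := INR (S n)) in *.
  assert (HN2 : INR n2 + 1 <= N) by (unfold N; rewrite <- S_INR; apply le_INR; lia).
  assert (Hrn : 0 <= r ^ S n < / 3).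
  { split; [apply pow_le; lra|]. specialize (Hn1 (S n) ltac:(lia)).
    rewrite Rabs_pos_eq in Hn1 by (apply pow_le; lra). exact Hn1. }
  assert (HNr : 5 <= N * (1 - r)).
  { apply Rle_trans with (5 / (1 - r) * (1 - r)); [right; field; lra|]. apply Rmult_le_compat_r; lra. }
  eapply Rle_trans; [apply (poisson_nodes_sum n r _ t 0 Hr Ht)|]. fold N.
  set (a := 2 * PI * dl / N).
  assert (Ha : 0 <= r * a / (1 - r) <= 2 / 5).
  { assert (Ha0 : 0 <= a) by (apply Rmult_le_pos; [nra|left; now apply Rinv_0_lt_compat]).
    split; [apply Rmult_le_pos; [nra|left; apply Rinv_0_lt_compat; lra]|].
    apply Rmult_le_reg_r with (N * (1 - r)); [lra|].
    replace (r * a / (1 - r) * (N * (1 - r))) with (r * (2 * PI * dl)) by (unfold a; field; lra).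
    assert (0 <= 2 * PI * dl <= 2) by nra. nra. }
  assert (Hsl : 0 <= slow r a <= 2) by (unfold slow; split; nra).
  assert (Hq : 0 <= (1 + r ^ S n) / (1 - r ^ S n) <= 2).
  { set (rho := r ^ S n) in *. split.
    - apply Rmult_le_pos; [lra|left; apply Rinv_0_lt_compat; lra].
    - apply Rmult_le_reg_r with (1 - rho); [lra|].
      replace ((1 + rho) / (1 - rho) * (1 - rho)) with (1 + rho) by (field; lra). lra. }
  apply Rle_trans with (2 * (N * 2)); [|lra].
  apply Rmult_le_compat; [lra|apply Rmult_le_pos; lra|lra|]. apply Rmult_le_compat_l; lra.
Qed.

(** Solves z^N = A/conj A near each root of unity, where [aa] is the argument of A: the function N x
    - 2 pi j - 2 aa(x) changes sign between tau_j - 2b/N and tau_j + 2b/N. *)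
Lemma nodes_exist n (aa : R -> R) b : (forall x, continuous aa x) -> (forall x, Rabs (aa x) <= b) ->
  exists t : nat -> R, forall j,
  INR (S n) * t j = 2 * PI * INR j + 2 * aa (t j) /\ Rabs (t j - tau n j) <= 2 * b / INR (S n).
Proof.
  intros Hc Hb. assert (HN := SINR_pos n). set (N := INR (S n)) in *.
  set (f := fun j x => N * x - 2 * PI * INR j - 2 * aa x).
  assert (Hf : forall j, continuity (f j)).
  { intros j x. unfold f.
    apply (continuity_pt_minus (fun x => N * x - 2 * PI * INR j) (fun x => 2 * aa x)).
    - apply derivable_continuous_pt. reg.
    - apply continuity_pt_scal. apply contR_pt, Hc. }
  assert (Hb0 : 0 <= b) by (eapply Rle_trans; [apply Rabs_pos|apply (Hb 0)]).
  set (eta := 2 * b / N). assert (He : 0 <= eta) by (apply Rmult_le_pos; [lra|left; now apply Rinv_0_lt_compat]).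
  assert (HNe : N * eta = 2 * b) by (unfold eta; field; lra).
  assert (HNt : forall j, N * tau n j = 2 * PI * INR j) by (intro j; unfold tau; fold N; field; lra).
  assert (Hs : forall j, f j (tau n j - eta) * f j (tau n j + eta) <= 0).
  { intro j. assert (H1 := Hb (tau n j - eta)). assert (H2 := Hb (tau n j + eta)).
    apply Rabs_le_between in H1. apply Rabs_le_between in H2. specialize (HNt j).
    assert (f j (tau n j - eta) <= 0).
    { unfold f. replace (N * (tau n j - eta)) with (N * tau n j - N * eta) by ring. lra. }
    assert (0 <= f j (tau n j + eta)).
    { unfold f. replace (N * (tau n j + eta)) with (N * tau n j + N * eta) by ring. lra. }
    nra. }
  exists (fun j => proj1_sig (IVT_cor (f j) (tau n j - eta) (tau n j + eta) (Hf j) ltac:(lra) (Hs j))).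
  intro j. destruct (IVT_cor (f j) _ _ _ _ _) as (x & Hx & E). simpl. unfold f in E. split; [lra|].
  fold eta. apply Rabs_le. lra.
Qed.

Lemma exp_le_exp x y : x <= y -> exp x <= exp y.
Proof. intros [H| ->]; [left; now apply exp_increasing|lra]. Qed.

Lemma cis_opp_inv x : (/ cis (- x))%C = cis x.
Proof.
  transitivity (/ cis (- x) * (cis (- x) * cis x))%C.
  - rewrite cis_inv_l. ring.
  - field. apply cis_neq_0.
Qed.

(** * The counterexample, in a form common to both ranges of p *)

Section Necessity.
Variables (p r : R).
Hypothesis Hp : 1 < p.
Hypothesis Hr : 0 < r < 1.
Variables (d : nat) (B : C -> C) (X Y aa : R -> R) (sg0 b Cp : R) (w : R -> R).
Hypothesis HB : poly_le d B.
Hypothesis HBp : forall x, B (cis x) = (RtoC (exp (X x)) * cis (Y x))%C.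
Hypothesis HX : forall x, continuous X x.
Hypothesis HY : forall x, continuous Y x.
Hypothesis Haa : forall x, continuous aa x.
Hypothesis Hb : forall x, Rabs (aa x) <= b.
Hypothesis Hb4 : b <= PI / 4.
Hypothesis Hsg : Rabs sg0 <= 1.
Hypothesis HXlow : forall x, / 2 * / Cmod (1 - RtoC r * cis x)%C <= exp (p * X x).
Hypothesis Hw : forall n t j, INR (S n) * t = 2 * PI * INR j + 2 * aa t ->
  rpow (Cmod (B (cis t) + RtoC (sg0 * r) * (cis (INR n * t) * Cconj (B (cis t))))%C) p <= rpow 2 p * w t.
Hypothesis HCp : 0 < Cp.
Hypothesis Hwsum : exists n0, forall n, (n0 <= n)%nat -> forall t,
  (forall j, (j <= n)%nat -> Rabs (t j - tau n j) <= 2 * b / INR (S n)) ->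
  sum_f_R0 (fun j => w (t j)) n <= 4 * INR (S n).
Hypothesis HMZ : forall n (t : nat -> R) P, (1 <= n)%nat -> poly_le n P ->
  (forall j, (j <= n)%nat -> Rabs (t j - tau n j) <= 2 * b / INR (S n)) ->
  RInt (fun x => rpow (Cmod (P (cis x))) p) 0 (2 * PI) / (2 * PI) <=
  Cp / INR (S n) * sum_f_R0 (fun j => rpow (Cmod (P (cis (t j)))) p) n.

(** In the section, [X] and [Y] are log-modulus and argument of [B] on the circle, [aa] is the
    argument of A, [sg0] the sign in P, and [w] the profile bounding |P|^p at the nodes: constant
    for p >= 2, a Poisson kernel for p < 2. Letting n grow at fixed r bounds the integral of |B|^p,
    and with it -ln(1 - r), by a quantity free of r. *)
Lemma necessity_bound : - ln (1 - r) <= 2 * (1 + 2 * PI * (Cp * (4 * rpow 2 p))).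
Proof.
  assert (HPI := PI_RGT_0). assert (Hr' : 0 <= r < 1) by lra.
  assert (HcE : forall x, continuous (fun x => exp (p * X x)) x).
  { intro x. apply (continuous_comp (fun x => p * X x) exp); [|apply continuous_exp].
    apply (contR_mult (fun _ => p) X); [apply continuous_const|apply HX]. }
  assert (Hc2Y : forall x, continuous (fun x => 2 * Y x) x).
  { intro x. apply (contR_mult (fun _ => 2) Y); [apply continuous_const|apply HY]. }
  (* Bernoulli's inequality bounds |P|^p from below by e^(pX) (1 + p sg0 r cos(n x - 2Y)). Expanding
     the cosine leaves [g1] and [g2] against the frequency n. *)
  set (g1 := fun x => exp (p * X x) * cos (2 * Y x)). set (g2 := fun x => exp (p * X x) * sin (2 * Y x)).
  assert (Hg1 : forall x, continuous g1 x).
  { intro x. apply contR_mult; [apply HcE|].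
    apply (continuous_comp (fun x => 2 * Y x) cos); [apply Hc2Y|apply continuous_cos]. }
  assert (Hg2 : forall x, continuous g2 x).
  { intro x. apply contR_mult; [apply HcE|].
    apply (continuous_comp (fun x => 2 * Y x) sin); [apply Hc2Y|apply continuous_sin]. }
  (* Two oscillatory integrals of size at most 1/(2p), multiplied by p, lower the integral by at
     most 1. *)
  assert (Hep : 0 < / (2 * p)) by (apply Rinv_0_lt_compat; lra).
  destruct (riemann_lebesgue g1 Hg1 _ Hep) as [n1 Hn1].
  destruct (riemann_lebesgue g2 Hg2 _ Hep) as [n2 Hn2].
  destruct Hwsum as [n3 Hn3].
  set (n := (1 + d + n1 + n2 + n3)%nat).
  assert (Hn0 : (0 < n)%nat) by (unfold n; lia).
  specialize (Hn1 n ltac:(unfold n; lia)). specialize (Hn2 n ltac:(unfold n; lia)).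
  specialize (Hn3 n ltac:(unfold n; lia)).
  assert (HN := SINR_pos n).
  assert (Hcl : forall x, continuous (fun x => INR n * x) x).
  { intro x. apply (contR_mult (fun _ => INR n) (fun x => x)); [apply continuous_const|apply continuous_id]. }
  assert (Hccos : forall x, continuous (fun x => cos (INR n * x)) x).
  { intro x. apply (continuous_comp (fun x => INR n * x) cos); [apply Hcl|apply continuous_cos]. }
  assert (Hcsin : forall x, continuous (fun x => sin (INR n * x)) x).
  { intro x. apply (continuous_comp (fun x => INR n * x) sin); [apply Hcl|apply continuous_sin]. }
  specialize (Hn1 (fun x => cos (INR n * x)) Hccos (fun x => Rabs_le _ _ (COS_bound _))
    (fun k => proj1 (cos_period_zero n k Hn0))).
  specialize (Hn2 (fun x => sin (INR n * x)) Hcsin (fun x => Rabs_le _ _ (SIN_bound _))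
    (fun k => proj2 (cos_period_zero n k Hn0))).
  cbv beta in Hn1, Hn2.
  destruct (nodes_exist n aa b Haa Hb) as [t Ht].
  destruct (poly_le_reverse n B (poly_le_le d n B ltac:(unfold n; lia) HB)) as (B' & HB' & HB'e).
  set (P := fun z => (B z + RtoC (sg0 * r) * B' z)%C).
  assert (HP : poly_le n P).
  { apply poly_le_add; [apply (poly_le_le d); [unfold n; lia|exact HB]|now apply poly_le_scal]. }
  assert (HPc : forall x, P (cis x) = (B (cis x) + RtoC (sg0 * r) * (cis (INR n * x) * Cconj (B (cis x))))%C).
  { intro x. unfold P. rewrite (HB'e _ (cis_neq_0 x)), cis_pow, cis_conj.
    now rewrite cis_opp_inv. }
  assert (Hmz := HMZ n t P ltac:(unfold n; lia) HP (fun j _ => proj2 (Ht j))).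
  set (I0 := RInt (fun x => rpow (Cmod (P (cis x))) p) 0 (2 * PI)) in Hmz.
  assert (isI : is_RInt (fun x => rpow (Cmod (P (cis x))) p) 0 (2 * PI) I0).
  { apply isR_correct, ex_RInt_cont. intro x.
    apply (continuous_ext (fun x => rpow (Cmod (P (RtoC 1 * cis x)%C)) p)).
    { intro y. now rewrite Cmult_1_l. }
    apply (poly_le_rpow_continuous n); [lra|exact HP]. }
  set (Sm := sum_f_R0 (fun j => rpow (Cmod (P (cis (t j)))) p) n) in Hmz.
  assert (H2p : 0 < rpow 2 p) by (apply rpow_pos; lra).
  assert (HSm : Sm <= rpow 2 p * (4 * INR (S n))).
  { apply Rle_trans with (sum_f_R0 (fun j => w (t j) * rpow 2 p) n).
    - apply sum_Rle. intros j Hj. rewrite HPc, (Rmult_comm (w (t j))). apply (Hw n (t j) j). apply Ht.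
    - rewrite <- scal_sum. apply Rmult_le_compat_l; [lra|]. apply Hn3. intros j _. apply Ht. }
  assert (HI0 : I0 <= 2 * PI * (Cp * (4 * rpow 2 p))).
  { apply Rmult_le_reg_l with (/ (2 * PI)); [apply Rinv_0_lt_compat; lra|].
    replace (/ (2 * PI) * (2 * PI * (Cp * (4 * rpow 2 p)))) with (Cp / INR (S n) * (rpow 2 p * (4 * INR (S n))))
      by (field; lra).
    rewrite Rmult_comm. eapply Rle_trans; [exact Hmz|].
    apply Rmult_le_compat_l; [left; now apply Rdiv_lt_0_compat|exact HSm]. }
  set (IE := RInt (fun x => exp (p * X x)) 0 (2 * PI)).
  set (I1 := RInt (fun x => g1 x * cos (INR n * x)) 0 (2 * PI)) in Hn1.
  set (I2 := RInt (fun x => g2 x * sin (INR n * x)) 0 (2 * PI)) in Hn2.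
  assert (isE : is_RInt (fun x => exp (p * X x)) 0 (2 * PI) IE) by (apply isR_correct, ex_RInt_cont; exact HcE).
  assert (is1 : is_RInt (fun x => g1 x * cos (INR n * x)) 0 (2 * PI) I1).
  { apply isR_correct, ex_RInt_cont. intro x. apply contR_mult; [apply Hg1|apply Hccos]. }
  assert (is2 : is_RInt (fun x => g2 x * sin (INR n * x)) 0 (2 * PI) I2).
  { apply isR_correct, ex_RInt_cont. intro x. apply contR_mult; [apply Hg2|apply Hcsin]. }
  assert (Hlow : IE + p * sg0 * r * (I1 + I2) <= I0).
  { apply (is_RInt_le (fun x => exp (p * X x) + p * sg0 * r * (g1 x * cos (INR n * x) + g2 x * sin (INR n * x)))
      (fun x => rpow (Cmod (P (cis x))) p) 0 (2 * PI)).
    - lra.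
    - apply isR_plus; [exact isE|]. apply isR_scal. apply isR_plus; [exact is1|exact is2].
    - exact isI.
    - intros x _. rewrite HPc, HBp.
      assert (EP : (RtoC (exp (X x)) * cis (Y x) + RtoC (sg0 * r) *
          (cis (INR n * x) * Cconj (RtoC (exp (X x)) * cis (Y x))))%C =
        (RtoC (exp (X x)) * cis (Y x) * (1 + RtoC (sg0 * r) * cis (INR n * x - 2 * Y x)))%C).
      { rewrite Cmult_conj, cis_conj.
        replace (Cconj (RtoC (exp (X x)))) with (RtoC (exp (X x))) by (apply C_eq; simpl; ring).
        replace (INR n * x - 2 * Y x) with (INR n * x + (- Y x + - Y x)) by ring.
        rewrite !cis_add.
        transitivity (RtoC (exp (X x)) * cis (Y x) + RtoC (sg0 * r) * RtoC (exp (X x)) * cis (INR n * x) * cis (- Y x)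
          * (cis (- Y x) * cis (Y x)))%C; [rewrite cis_inv_l; ring|ring]. }
      rewrite EP. rewrite !Cmod_mult, cis_mod, Cmod_R, Rabs_pos_eq by (left; apply exp_pos).
      rewrite Rmult_1_r. set (u := (1 + RtoC (sg0 * r) * cis (INR n * x - 2 * Y x))%C).
      rewrite rpow_mult by (try apply Cmod_ge_0; left; apply exp_pos).
      rewrite (rpow_pos_eq (exp (X x))) by apply exp_pos. rewrite ln_exp.
      assert (Hre : 1 + sg0 * r * cos (INR n * x - 2 * Y x) <= Cmod u).
      { apply Rle_trans with (fst u); [right; unfold u; simpl; ring|].
        eapply Rle_trans; [apply Rle_abs|apply re_le_Cmod]. }
      assert (Hber := rpow_bernoulli (Cmod u) p ltac:(lra) (Cmod_ge_0 u)).
      apply Rle_trans with (exp (p * X x) * (1 + p * (sg0 * r * cos (INR n * x - 2 * Y x)))).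
      + right. unfold g1, g2. rewrite cos_minus. ring.
      + apply Rmult_le_compat_l; [left; apply exp_pos|]. nra. }
  assert (Hs12 : - 1 <= p * sg0 * r * (I1 + I2)).
  { assert (Ha : Rabs (p * sg0 * r * (I1 + I2)) <= 1).
    { rewrite !Rabs_mult, (Rabs_pos_eq p), (Rabs_pos_eq r) by lra.
      assert (H12 : Rabs (I1 + I2) <= / p).
      { eapply Rle_trans; [apply Rabs_triang|].
        replace (/ p) with (/ (2 * p) + / (2 * p)) by (field; lra). lra. }
      assert (H3 : p * Rabs sg0 * r <= p).
      { assert (Hq : 0 <= Rabs sg0) by apply Rabs_pos.
        assert (Rabs sg0 * r <= 1) by nra.
        rewrite Rmult_assoc. rewrite <- (Rmult_1_r p) at 2. apply Rmult_le_compat_l; lra. }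
      apply Rle_trans with (p * / p); [|right; field; lra].
      apply Rmult_le_compat; [|apply Rabs_pos|exact H3|exact H12].
      apply Rmult_le_pos; [apply Rmult_le_pos; [lra|apply Rabs_pos]|lra]. }
    apply Rabs_le_between in Ha. lra. }
  assert (HIE : / 2 * - ln (1 - r) <= IE).
  { apply Rle_trans with (/ 2 * RInt (fun x => / Cmod (1 - RtoC r * cis x)%C) 0 (2 * PI)).
    - apply Rmult_le_compat_l; [lra|now apply RInt_inv_mu].
    - apply (is_RInt_le (fun x => / 2 * / Cmod (1 - RtoC r * cis x)%C) (fun x => exp (p * X x)) 0 (2 * PI)).
      + lra.
      + apply isR_scal. apply isR_correct, ex_RInt_cont. intro x. apply contR_pt.
        apply (continuity_pt_inv (fun x => Cmod (1 - RtoC r * cis x)%C)).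
        * apply contR_pt. apply (continuous_ext (fun x => Cmod (1 - (RtoC r * cis x) * 1)%C)).
          { intro y. f_equal. ring. }
          exact (poly_le_Cmod_continuous 1 r (fun w => 1 - w * 1)%C (poly_le_lin 1%C) x).
        * generalize (Cmod_one_minus r x Hr'). lra.
      + exact isE.
      + intros x _. apply HXlow. }
  lra.
Qed.

End Necessity.

(** The bound is uniform in x and strictly below pi/2. This slack absorbs the approximation error,
    so that the counterexample already works at the critical delta. *)
Lemma Aa_strict r x : 0 < r < 1 -> Rabs (cauchy_arg r x) <= atan (r / (1 - r)) /\ atan (r / (1 - r)) < PI / 2.
Proof.
  intro Hr. split; [|apply atan_bound].
  assert (Hc := Aa_den r x ltac:(lra)).
  assert (Hq : Rabs (r * sin x / (1 - r * cos x)) <= r / (1 - r)).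
  { unfold Rdiv. rewrite Rabs_mult, (Rabs_mult r), (Rabs_pos_eq r), Rabs_inv, (Rabs_pos_eq (1 - _)) by lra.
    assert (H1 : Rabs (sin x) <= 1) by (apply Rabs_le, SIN_bound). assert (H0 := Rabs_pos (sin x)).
    apply Rmult_le_compat; [nra|left; now apply Rinv_0_lt_compat|nra|].
    apply Rinv_le_contravar; [lra|]. generalize (COS_bound x). nra. }
  assert (Hm : forall u v, u <= v -> atan u <= atan v).
  { intros u v [H| ->]; [left; now apply atan_increasing|lra]. }
  apply Rabs_le_between in Hq. unfold cauchy_arg. apply Rabs_le. rewrite <- atan_opp. split; apply Hm; lra.
Qed.

Lemma MZ_necessary p delta : 1 < p -> MZ_property p delta ->
  1 / (2 * Rmax p (p / (p - 1))) <= delta -> False.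
Proof.
  intros Hp (Cp & HCp & HMZ) Hd. assert (HPI := PI_RGT_0).
  set (q := Rmax p (p / (p - 1))) in *. assert (Hq2 := q_ge_2 p Hp). fold q in Hq2.
  (* The critical value of pi delta; displacements 2b/N are admissible for every delta at or above
     the threshold. *)
  set (b := PI / (2 * q)).
  assert (Hb0 : 0 < b) by (apply Rdiv_lt_0_compat; lra).
  assert (Hb4 : b <= PI / 4) by (apply Rmult_le_compat_l; [lra|apply Rinv_le_contravar; lra]).
  assert (Hbd : b <= PI * delta).
  { unfold b. replace (PI / (2 * q)) with (PI * (1 / (2 * q))) by (field; lra). apply Rmult_le_compat_l; lra. }
  (* With n >= 1 the displacement 2b/N is at most pi/4, inside the range where [arg_cis] identifies
     the principal argument. *)
  assert (HMZ' : forall n (t : nat -> R) P, (1 <= n)%nat -> poly_le n P ->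
    (forall j, (j <= n)%nat -> Rabs (t j - tau n j) <= 2 * b / INR (S n)) ->
    RInt (fun x => rpow (Cmod (P (cis x))) p) 0 (2 * PI) / (2 * PI) <=
    Cp / INR (S n) * sum_f_R0 (fun j => rpow (Cmod (P (cis (t j)))) p) n).
  { intros n t P Hn HP Ht. assert (HN := SINR_pos n).
    assert (HN2 : 2 <= INR (S n)) by (apply (le_INR 2); lia).
    destruct (Peval_of_pd n P HP) as [co Hco].
    assert (Hz : forall j, (j <= n)%nat -> Defs.Cmod (cis (t j)) = 1 /\
      Rabs (arg (Defs.Cmul (cis (t j)) (Defs.Cconj (omega n j)))) <= 2 * PI * delta / INR (S n)).
    { intros j Hj. split; [rewrite Defs_Cmod; apply cis_mod|].
      change (Defs.Cmul (cis (t j)) (Defs.Cconj (omega n j))) with (cis (t j) * Cconj (cis (tau n j)))%C.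
      rewrite cis_conj, <- cis_add. specialize (Ht j Hj).
      assert (H1 : 2 * b / INR (S n) <= PI / 4).
      { apply Rmult_le_reg_r with (INR (S n)); [exact HN|].
        replace (2 * b / INR (S n) * INR (S n)) with (2 * b) by (field; lra). nra. }
      change (t j + - tau n j) with (t j - tau n j).
      rewrite arg_cis by lra. eapply Rle_trans; [exact Ht|].
      apply Rmult_le_compat_r; [left; now apply Rinv_0_lt_compat|lra]. }
    assert (Hint : integral_is (fun theta => rpow (Defs.Cmod (Peval co n (Cexp_i theta))) p) 0 (2 * PI)
      (RInt (fun x => rpow (Cmod (P (cis x))) p) 0 (2 * PI))).
    { replace (RInt (fun x => rpow (Cmod (P (cis x))) p) 0 (2 * PI)) with
        (RInt (fun theta => rpow (Defs.Cmod (Peval co n (Cexp_i theta))) p) 0 (2 * PI)).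
      2:{ apply RInt_ext. intros x _. now rewrite Defs_Cmod, Hco. }
      apply RInt_integral_is. apply ex_RInt_cont. intro x.
      apply (continuous_ext (fun x => rpow (Cmod (P (RtoC 1 * cis x)%C)) p)).
      { intro y. now rewrite Cmult_1_l, Defs_Cmod, Hco. }
      apply (poly_le_rpow_continuous n); [lra|exact HP]. }
    destruct (HMZ n (fun j => cis (t j)) Hz co _ Hint) as [_ H].
    eapply Rle_trans; [exact H|]. right. f_equal. apply sum_eq. intros j _.
    now rewrite Defs_Cmod, Hco. }
  clear HMZ.
  assert (H2p : 0 < rpow 2 p) by (apply rpow_pos; lra).
  set (K := 2 * (1 + 2 * PI * (Cp * (4 * rpow 2 p)))).
  assert (HK : 0 < K).
  { unfold K. assert (0 < 2 * PI * (Cp * (4 * rpow 2 p))); [|lra].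
    apply Rmult_lt_0_compat; [lra|]. apply Rmult_lt_0_compat; lra. }
  assert (Hcore : forall r, 0 < r < 1 -> - ln (1 - r) <= K).
  { intros r Hr. assert (Hr' : 0 <= r < 1) by lra.
    set (A0 := atan (r / (1 - r))).
    assert (HA0 : A0 < PI / 2) by apply atan_bound.
    assert (HA0' : 0 <= A0).
    { destruct (Aa_strict r 0 Hr) as [H _]. eapply Rle_trans; [apply Rabs_pos|exact H]. }
    set (g := / p).
    assert (Hg : 0 < g < 1).
    { unfold g. split; [apply Rinv_0_lt_compat; lra|]. rewrite <- Rinv_1. apply Rinv_lt_contravar; lra. }
    assert (Hpg : p * g = 1) by (unfold g; field; lra).
    (* The first two bounds keep the argument of A within [b] in the two cases; the third makes
       |B|^p agree with 1/|1 - r z| up to a factor 2. *)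
    set (eps := Rmin (Rmin (g * (PI / 2 - A0)) ((1 - g) * (PI / 2 - A0))) (ln 2 / p)).
    assert (Hln2 : 0 < ln 2) by (rewrite <- ln_1; apply ln_increasing; lra).
    assert (He : 0 < eps).
    { unfold eps. repeat apply Rmin_pos; [apply Rmult_lt_0_compat; lra|apply Rmult_lt_0_compat; lra|apply Rdiv_lt_0_compat; lra]. }
    assert (He1 : eps <= g * (PI / 2 - A0)) by (eapply Rle_trans; [apply Rmin_l|apply Rmin_l]).
    assert (He2 : eps <= (1 - g) * (PI / 2 - A0)) by (eapply Rle_trans; [apply Rmin_l|apply Rmin_r]).
    assert (He3 : p * eps <= ln 2).
    { apply Rle_trans with (p * (ln 2 / p)); [apply Rmult_le_compat_l; [lra|apply Rmin_r]|right; field; lra]. }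
    destruct (approx_power r g eps Hr ltac:(lra) He) as (d & B & X & Y & HB & HBp & HX & HY & HXe & HYe).
    assert (Hmu : forall x, 0 < Cmod (1 - RtoC r * cis x)%C).
    { intro x. generalize (Cmod_one_minus r x Hr'). lra. }
    assert (HlnX : forall x, ln (Cmod (1 - RtoC r * cis x)%C) = lnmu r x).
    { intro x. rewrite <- exp_lnmu by exact Hr'. apply ln_exp. }
    assert (HXlow : forall x, / 2 * / Cmod (1 - RtoC r * cis x)%C <= exp (p * X x)).
    { intro x. rewrite <- Rinv_mult. rewrite <- (exp_ln (/ (2 * _))).
      2:{ apply Rinv_0_lt_compat. generalize (Hmu x). lra. }
      apply exp_le_exp. rewrite ln_Rinv, ln_mult, HlnX; try (generalize (Hmu x); lra).
      specialize (HXe x). apply Rabs_le_between in HXe.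
      assert (p * (- eps) <= p * (X x + g * lnmu r x)) by (apply Rmult_le_compat_l; lra).
      assert (p * (X x + g * lnmu r x) = p * X x + lnmu r x) by (rewrite Rmult_plus_distr_l, <- Rmult_assoc, Hpg; ring).
      lra. }
    assert (HXup : forall x, exp (p * X x) <= 2 * / Cmod (1 - RtoC r * cis x)%C).
    { intro x. assert (Hm2 : 0 < 2 * / Cmod (1 - RtoC r * cis x)%C).
      { apply Rmult_lt_0_compat; [lra|]. apply Rinv_0_lt_compat, Hmu. }
      rewrite <- (exp_ln _ Hm2). apply exp_le_exp.
      rewrite ln_mult, ln_Rinv, HlnX; try apply Hmu; try apply Rinv_0_lt_compat, Hmu; try lra.
      specialize (HXe x). apply Rabs_le_between in HXe.
      assert (p * (X x + g * lnmu r x) <= p * eps) by (apply Rmult_le_compat_l; lra).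
      assert (p * (X x + g * lnmu r x) = p * X x + lnmu r x) by (rewrite Rmult_plus_distr_l, <- Rmult_assoc, Hpg; ring).
      lra. }
    assert (Hrp : forall x v, 0 <= v -> rpow (exp (X x) * v) p = exp (p * X x) * rpow v p).
    { intros x v Hv. rewrite rpow_mult by (try exact Hv; left; apply exp_pos).
      rewrite (rpow_pos_eq (exp _)) by apply exp_pos. now rewrite ln_exp. }
    assert (H2p1 : 2 * rpow 2 (p - 1) = rpow 2 p).
    { replace p with (1 + (p - 1)) at 2 by ring. rewrite rpow_plus, rpow_x1 by lra. reflexivity. }
    (* At a node z^N = e^(2 i aa), hence z^n = conj z e^(2 i aa). *)
    assert (Hper : forall n t j aat, INR (S n) * t = 2 * PI * INR j + 2 * aat ->
      cis (INR n * t) = (cis (- t) * cis (2 * aat))%C).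
    { intros n t j aat E. rewrite <- cis_add. rewrite S_INR in E.
      replace (INR n * t) with (- t + 2 * aat + 2 * INR j * PI) by lra. apply cis_period. }
    destruct (Rle_dec 2 p) as [Hp2|Hp2].
    (* Here A = B, with argument [Y] of size at most (1/p)(pi/2). *)
    - assert (Hqp : q = p).
      { unfold q. apply Rmax_left. apply Rmult_le_reg_r with (p - 1); [lra|].
        replace (p / (p - 1) * (p - 1)) with p by (field; lra). nra. }
      assert (Hbg : b = g * (PI / 2)) by (unfold b, g; rewrite Hqp; field; lra).
      apply (necessity_bound p r Hp Hr d B X Y Y (-1) b Cp (fun _ => 1)); try assumption.
      + intro x. specialize (HYe x). destruct (Aa_strict r x Hr) as [HA _]. fold A0 in HA.
        replace (Y x) with ((Y x - g * cauchy_arg r x) + g * cauchy_arg r x) by ring.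
        eapply Rle_trans; [apply Rabs_triang|]. rewrite (Rabs_mult g), (Rabs_pos_eq g) by lra.
        assert (g * Rabs (cauchy_arg r x) <= g * A0) by (apply Rmult_le_compat_l; lra). rewrite Hbg. lra.
      + rewrite Rabs_left; lra.
      + intros n t j E. rewrite (Hper n t j (Y t) E), HBp.
        (* At a node e^(2iY) turns conj B into B, so P = B conj(1 - r z). The extra factor cancels
           the singularity: with mu = |1 - r z| <= 2, |P|^p is at most 2 mu^(p-1) <= 2^p. *)
        assert (EP : (RtoC (exp (X t)) * cis (Y t) + RtoC (-1 * r) *
            (cis (- t) * cis (2 * Y t) * Cconj (RtoC (exp (X t)) * cis (Y t))))%C =
          (RtoC (exp (X t)) * cis (Y t) * Cconj (1 - RtoC r * cis t))%C).
        { rewrite Cmult_conj, cis_conj. unfold Cminus. rewrite Cplus_conj, Copp_conj, Cmult_conj, cis_conj.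
          replace (Cconj (RtoC (exp (X t)))) with (RtoC (exp (X t))) by (apply C_eq; simpl; ring).
          replace (Cconj (RtoC r)) with (RtoC r) by (apply C_eq; simpl; ring).
          replace (Cconj 1) with (RtoC 1) by (apply C_eq; simpl; ring).
          replace (2 * Y t) with (Y t + Y t) by ring. rewrite cis_add, RtoC_mult.
          transitivity (RtoC (exp (X t)) * cis (Y t) + RtoC (-1) * RtoC r * cis (- t) * RtoC (exp (X t)) * cis (Y t)
            * (cis (- Y t) * cis (Y t)))%C; [ring|rewrite cis_inv_l; ring]. }
        rewrite EP, !Cmod_mult, cis_mod, Cmod_conj, Cmod_R, Rabs_pos_eq by (left; apply exp_pos).
        rewrite Rmult_1_r. set (mu := Cmod (1 - RtoC r * cis t)%C).
        assert (Hmu0 : 0 < mu) by apply Hmu.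
        assert (Hmu2 : mu <= 2) by (generalize (Cmod_one_minus r t Hr'); fold mu; lra).
        rewrite Hrp, Rmult_1_r by lra. rewrite <- H2p1.
        assert (E1 : rpow mu p = mu * rpow mu (p - 1)).
        { replace p with (1 + (p - 1)) at 1 by ring. rewrite rpow_plus, rpow_x1 by lra. reflexivity. }
        assert (H3 : rpow mu (p - 1) <= rpow 2 (p - 1)) by (apply rpow_le; lra).
        apply Rle_trans with (2 * / mu * rpow mu p).
        * apply Rmult_le_compat_r; [apply rpow_ge0|apply HXup].
        * rewrite E1. apply Rle_trans with (2 * rpow mu (p - 1)); [right; field; lra|lra].
      + exists O. intros n _ t _. rewrite sum_cte. generalize (SINR_pos n). lra.
    (* Here A = B (1 - r z), whose argument is close to -(1 - 1/p) times [cauchy_arg]. *)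
    - assert (Hqp : q = p / (p - 1)).
      { unfold q. apply Rmax_right. apply Rmult_le_reg_r with (p - 1); [lra|].
        replace (p / (p - 1) * (p - 1)) with p by (field; lra). nra. }
      assert (Hbg : b = (1 - g) * (PI / 2)) by (unfold b, g; rewrite Hqp; field; lra).
      apply (necessity_bound p r Hp Hr d B X Y (fun x => Y x - cauchy_arg r x) 1 b Cp (fun t => poisson r (0 - t))); try assumption.
      + intro x. apply contR_pt. apply (continuity_pt_minus Y (cauchy_arg r)); [apply contR_pt, HY|].
        apply contR_pt. apply (ex_derive_continuous (cauchy_arg r)). eexists. apply Aa_derive. exact Hr'.
      + intro x. cbv beta. specialize (HYe x). destruct (Aa_strict r x Hr) as [HA _]. fold A0 in HA.
        replace (Y x - cauchy_arg r x) with ((Y x - g * cauchy_arg r x) - (1 - g) * cauchy_arg r x) by ring.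
        unfold Rminus at 1. eapply Rle_trans; [apply Rabs_triang|]. rewrite Rabs_Ropp.
        rewrite (Rabs_mult (1 - g)), (Rabs_pos_eq (1 - g)) by lra.
        assert ((1 - g) * Rabs (cauchy_arg r x) <= (1 - g) * A0) by (apply Rmult_le_compat_l; lra). rewrite Hbg. lra.
      + rewrite Rabs_R1. lra.
      + intros n t j E. rewrite (Hper n t j _ E), HBp.
        set (mu := Cmod (1 - RtoC r * cis t)%C).
        assert (Hmu0 : 0 < mu) by apply Hmu.
        assert (Hmuc : RtoC mu <> 0%C) by (intro H; apply (f_equal fst) in H; simpl in H; lra).
        assert (Hpol := Aa_polar r t Hr'). fold mu in Hpol.
        (* The two numbers 1 - r z and 1 - r conj z have the same modulus and opposite arguments. *)
        assert (Hrel : ((1 - RtoC r * cis (- t)) * cis (- cauchy_arg r t) * cis (- cauchy_arg r t) = 1 - RtoC r * cis t)%C).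
        { assert (Hpc : (1 - RtoC r * cis (- t))%C = (RtoC mu * cis (cauchy_arg r t))%C).
          { apply (f_equal Cconj) in Hpol. unfold Cminus in Hpol.
            rewrite Cplus_conj, Copp_conj, !Cmult_conj, !cis_conj, Ropp_involutive in Hpol.
            replace (Cconj (RtoC mu)) with (RtoC mu) in Hpol by (apply C_eq; simpl; ring).
            replace (Cconj (RtoC r)) with (RtoC r) in Hpol by (apply C_eq; simpl; ring).
            replace (Cconj 1) with (RtoC 1) in Hpol by (apply C_eq; simpl; ring). exact Hpol. }
          rewrite Hpc, Hpol.
          transitivity (RtoC mu * cis (- cauchy_arg r t) * (cis (- cauchy_arg r t) * cis (cauchy_arg r t)))%C; [ring|].
          rewrite cis_inv_l. ring. }
        assert (Hden : (1 - RtoC r * cis (- t))%C <> 0%C).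
        { apply one_minus_neq_0. rewrite Cmod_RtoC_cis; lra. }
        assert (Hdm : Cmod (1 - RtoC r * cis (- t))%C = mu).
        { unfold mu. rewrite <- (Cmod_conj (1 - RtoC r * cis t)%C). f_equal.
          unfold Cminus. rewrite Cplus_conj, Copp_conj, Cmult_conj, cis_conj.
          replace (Cconj (RtoC r)) with (RtoC r) by (apply C_eq; simpl; ring).
          replace (Cconj 1) with (RtoC 1) by (apply C_eq; simpl; ring). reflexivity. }
        (* At a node P = B (1 - r^2)/(1 - r conj z). With y = (1 - r^2)/mu <= 2, |P|^p is at most
           (2/mu) y^p <= 2^p y/mu, and y/mu is the Poisson kernel, whose sum over the nodes is of
           order N although its maximum is not bounded in r. *)
        assert (EP : (RtoC (exp (X t)) * cis (Y t) + RtoC (1 * r) *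
            (cis (- t) * cis (2 * (Y t - cauchy_arg r t)) * Cconj (RtoC (exp (X t)) * cis (Y t))))%C =
          (RtoC (exp (X t)) * cis (Y t) * (RtoC (1 - r * r) / (1 - RtoC r * cis (- t))))%C).
        { rewrite Cmult_conj, cis_conj.
          replace (Cconj (RtoC (exp (X t)))) with (RtoC (exp (X t))) by (apply C_eq; simpl; ring).
          replace (2 * (Y t - cauchy_arg r t)) with (Y t + Y t + (- cauchy_arg r t + - cauchy_arg r t)) by ring.
          rewrite !cis_add, Rmult_1_l, RtoC_minus, RtoC_mult.
          transitivity (RtoC (exp (X t)) * cis (Y t) * (1 + RtoC r * cis (- t) *
            ((1 - RtoC r * cis (- t)) * cis (- cauchy_arg r t) * cis (- cauchy_arg r t)) * (cis (- Y t) * cis (Y t))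
            / (1 - RtoC r * cis (- t))))%C; [field; exact Hden|].
          rewrite Hrel, cis_inv_l.
          transitivity (RtoC (exp (X t)) * cis (Y t) * ((1 - RtoC r * RtoC r * (cis (- t) * cis t)) / (1 - RtoC r * cis (- t))))%C;
            [field; exact Hden|]. rewrite cis_inv_l. field. exact Hden. }
        rewrite EP, !Cmod_mult, cis_mod, Cmod_div, Hdm, !Cmod_R by exact Hden.
        rewrite !Rabs_pos_eq by (try (left; apply exp_pos); nra).
        rewrite Rmult_1_r.
        set (y := (1 - r * r) / mu).
        assert (Hy0 : 0 < y) by (apply Rdiv_lt_0_compat; nra).
        assert (Hy2 : y <= 2).
        { unfold y. apply Rmult_le_reg_r with mu; [exact Hmu0|].
          replace ((1 - r * r) / mu * mu) with (1 - r * r) by (field; lra).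
          assert (1 - r <= mu) by (generalize (Cmod_one_minus r t Hr'); fold mu; lra). nra. }
        rewrite Hrp by lra.
        assert (E1 : rpow y p = y * rpow y (p - 1)).
        { replace p with (1 + (p - 1)) at 1 by ring. rewrite rpow_plus, rpow_x1 by lra. reflexivity. }
        assert (H3 : rpow y (p - 1) <= rpow 2 (p - 1)) by (apply rpow_le; lra).
        assert (HPo : poisson r (0 - t) = y / mu).
        { unfold poisson. replace (0 - t) with (- t) by ring. rewrite poisson_den, Hdm. unfold y. field. lra. }
        rewrite HPo, <- H2p1.
        apply Rle_trans with (2 * / mu * rpow y p).
        * apply Rmult_le_compat_r; [apply rpow_ge0|apply HXup].
        * rewrite E1. apply Rle_trans with (2 * rpow y (p - 1) * (y / mu)); [right; field; lra|].
          apply Rmult_le_compat_r; [left; now apply Rdiv_lt_0_compat|lra].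
      + destruct (poisson_sum_large r (1 / (2 * q)) Hr) as [n0 Hn0].
        { split; [left; apply Rdiv_lt_0_compat; lra|].
          replace (1 / 4) with (1 / (2 * 2)) by field. apply Rmult_le_compat_l; [lra|apply Rinv_le_contravar; lra]. }
        exists n0. intros n Hn t Ht. apply (Hn0 n Hn t). intros j Hj.
        replace (2 * PI * (1 / (2 * q)) / INR (S n)) with (2 * b / INR (S n)).
        * now apply Ht.
        * unfold b. generalize (SINR_pos n). generalize (INR (S n)). intros N HN. field. split; lra. }
  assert (He1 : exp (- (K + 1)) < exp 0) by (apply exp_increasing; lra). rewrite exp_0 in He1.
  assert (He0 := exp_pos (- (K + 1))).
  (* For this r the logarithm -ln(1 - r) equals K + 1. *)
  specialize (Hcore (1 - exp (- (K + 1))) ltac:(lra)).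
  replace (1 - (1 - exp (- (K + 1)))) with (exp (- (K + 1))) in Hcore by ring.
  rewrite ln_exp in Hcore. lra.
Qed.

Theorem mainTheorem1 (p delta : R) (hp : 1 < p) (hdelta : 0 <= delta) :
  MZ_property p delta <-> delta < 1 / (2 * Rmax p (p / (p - 1))).
Proof.
  split.
  - intro H. apply Rnot_le_lt. exact (MZ_necessary p delta hp H).
  - exact (MZ_sufficient p delta hp hdelta).
Qed.
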